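(* Let $S=\{z\in\mathbb{C}: a<\operatorname{Im} z<b\}$ with $-\infty\le a<b\le+\infty$, let $m\ge 1$ be an integer, and let $a_0,a_1,\dots,a_m\in AP(S)$ be not all identically zero. Let $w$ be a meromorphic function on $S$ satisfying $$a_m(z)w(z)^m+a_{m-1}(z)w(z)^{m-1}+\dots+a_1(z)w(z)+a_0(z)=0$$ (at all points $z\in S$ that are not poles of $w$). Suppose that for each substrip $S'\subset\subset S$, $$\operatorname{card}\{z\in S': |\operatorname{Re} z|<t,\ w(z)=\infty\}=o(t)\qquad\text{as } t\to\infty.$$ Then $w\in AP(S)$ (in particular, $w$ has no poles in $S$).
   Context: For a strip $S=\{z\in\mathbb{C}: a<\operatorname{Im} z<b\}$ ($a$ may be $-\infty$ and $b$ may be $+\infty$), write $S'\subset\subset S$ if $S'=\{z\in\mathbb{C}: a'<\operatorname{Im} z<b'\}$ with $a<a'<b'<b$. A function $f$ on $S$ is called analytic almost periodic on $S$ if it belongs to the closure of the set of finite exponential sums $\sum a_n e^{i\lambda_n z}$, $a_n\in\mathbb{C}$, $\lambda_n\in\mathbb{R}$, with respect to the topology of uniform convergence on every substrip $S'\subset\subset S$. Equivalently, the family $\{f(z+h)\}_{h\in\mathbb{R}}$ of real translates of the analytic function $f$ is relatively compact with respect to the topology of uniform convergence on every substrip $S'\subset\subset S$. $AP(S)$ denotes the space of all analytic almost periodic functions on $S$. The notation $w(z)=\infty$ means that $z$ is a pole of $w$. Meromorphic functions are identified with their extensions across removable singularities. *)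

(* Defs.v *)
From Stdlib Require Import Reals List.
From Coquelicot Require Import Coquelicot.
Open Scope R_scope.

Definition Cexp (z : C) : C := (exp (Re z) * cos (Im z), exp (Re z) * sin (Im z)).

Definition strip (a b : Rbar) (z : C) : Prop := Rbar_lt a (Im z) /\ Rbar_lt (Im z) b.

(* The bounds a', b' are real because a < a' < b' < b forces them to be finite. *)
Definition substrip (a' b' : R) (a b : Rbar) : Prop :=
  Rbar_lt a a' /\ a' < b' /\ Rbar_lt b' b.

Definition exp_sum (N : nat) (c : nat -> C) (lam : nat -> R) (z : C) : C :=
  sum_n (fun n => Cmult (c n) (Cexp (Cmult (Cmult Ci (RtoC (lam n))) z))) N.

(* Membership in AP(S) for S = [strip a b]; the values of f outside S are
   irrelevant.  Substrips of S are directed under inclusion, so this is the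
   closure of the exponential sums for uniform convergence on every substrip. *)
Definition AP (a b : Rbar) (f : C -> C) : Prop :=
  forall a' b' : R, substrip a' b' a b ->
  forall eps : R, 0 < eps ->
  exists (N : nat) (c : nat -> C) (lam : nat -> R),
    forall z : C, strip a' b' z -> Cmod (Cminus (f z) (exp_sum N c lam z)) <= eps.

Definition analytic_at (g : C -> C) (z0 : C) : Prop :=
  locally z0 (fun z => ex_derive (K := C_AbsRing) (V := C_NormedModule) g z).

(* Meromorphic functions take values in [option C], where [None] is the value
   infinity; a removable singularity therefore cannot occur. *)
Definition regular_at (w : C -> option C) (z0 : C) : Prop :=
  exists g : C -> C, analytic_at g z0 /\ locally z0 (fun z => w z = Some (g z)).

Definition pole_at (w : C -> option C) (z0 : C) : Prop :=
  w z0 = None /\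
  exists (k : nat) (g : C -> C),
    (1 <= k)%nat /\ analytic_at g z0 /\ g z0 <> RtoC 0 /\
    locally' z0 (fun z => w z = Some (Cdiv (g z) (Cpow (Cminus z z0) k))).

Definition meromorphic_on (D : C -> Prop) (w : C -> option C) : Prop :=
  forall z0 : C, D z0 -> regular_at w z0 \/ pole_at w z0.

Definition has_card (A : C -> Prop) (n : nat) : Prop :=
  exists l : list C, NoDup l /\ length l = n /\ forall z, In z l <-> A z.

(* card {z in strip a' b' : |Re z| < t, w z = infinity} = o(t), t -> +oo;
   [is_domin F f g] means g = o(f) along F. *)
Definition few_poles (w : C -> option C) (a' b' : R) : Prop :=
  exists N : R -> nat,
    (forall t : R,
       has_card (fun z => strip a' b' z /\ Rabs (Re z) < t /\ w z = None) (N t)) /\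
    is_domin (Rbar_locally p_infty) (fun t : R => t) (fun t : R => INR (N t)).

(* Main.v *)
Require Import Defs.
From Stdlib Require Import Reals List Lra Lia Arith FinFun Classical ClassicalEpsilon.
From Coquelicot Require Import Coquelicot.
Open Scope R_scope.

(** Write [S] for the strip.  The equation is translated into statements about holomorphic functions
    and about small real translations, and everything is reduced to one principle:

      a holomorphic function [u], bounded on substrips, that is a root of a nonzero polynomial
      with almost periodic coefficients is almost periodic ([HB_root_APH]).

    Call a set of real numbers a Bohr neighbourhood of [0] if it contains all [tau] for which
    [exp (i lam tau)] is close to [1] for finitely many frequencies [lam].  Such sets are stable
    under intersection and dilation, and relatively dense ([near0_dense]).  A function is almost
    periodic iff it is holomorphic, bounded on substrips, and on every substrip and for every
    [eps] its [eps]-almost periods contain a Bohr neighbourhood ([AP_APH], [APH_AP]).  For the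
    converse direction [f] is convolved with the trigonometric polynomial
    [prod cos^2n (lam t)], which concentrates on a Bohr neighbourhood; the mean of
    [f (z + t) exp (i mu t)] over a long interval is nearly [exp (- i mu z)] times a constant.

    The principle.  For the polynomial [P] of minimal degree that annihilates [u], Euclid's algorithm
    gives [X P + Y P' = D] with [D] almost periodic and not identically zero
    ([separable_equation]).  So at a point with [D] bounded below, [u] is a simple root, and
    another approximate root is either far from [u] or very close to it.  If [tau] is Bohr-small,
    [u (z + tau)] is an approximate root of [P] at [z]; if it is close to [u (z)] at one good
    point, it is close near this point, hence, by propagation of smallness for holomorphic
    functions ([propagation]), at the next good point, and so along the whole strip
    ([agreement_spreads]).  Among the translates of [u] by [0, t, 2 t, .., N t] two are close at a
    given good point by the pigeonhole principle, so a multiple [k t] with [0 < k <= N], and with it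
    [N! t], is an almost period.  Since [R] is divisible the numbers [N! t] form again a Bohr
    neighbourhood ([root_bap]).

    The theorem.  Let [a] be the highest coefficient that is not identically zero.  Then [u = a w]
    satisfies a monic equation, is therefore bounded on substrips, extends over the poles of [w], and is
    almost periodic by the principle ([cleared_solution_APH]).  If [w] had a pole, then
    [w = u / a] would have a pole near each translate of it by a Bohr-small [tau]
    ([poles_recur]), and these are too many for the hypothesis on the number of poles
    ([few_poles_no_pole]).  So [w] is holomorphic.  It is bounded on substrips, because every
    point is the centre of a small circle on which [|a|] has a uniform positive lower bound
    ([min_modulus], [quotient_bdd]).  Being a root of [a v - u], it is almost periodic by
    the principle again.

    The function theory is developed from complex differentiability: Goursat's
    theorem by bisection for smoothly parametrised rectangles, from it Cauchy's formula on circles by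
    shrinking the circle, and then finite Taylor expansions with explicit remainders. *)

(** * Continuity and complex differentiability *)

Definition dist_R (s t : R) : R := Rabs (s - t).
Definition dist_C (z w : C) : R := Cmod (z - w).

Definition cont_at {X : Type} (d : X -> X -> R) (f : X -> C) (x : X) : Prop :=
  forall eps, 0 < eps -> exists del, 0 < del /\
    forall y, d y x < del -> Cmod (f y - f x) < eps.

Lemma Cmod_diag (z : C) : Cmod (z - z) = 0.
Proof. replace (z - z)%C with (RtoC 0) by ring. apply Cmod_0. Qed.

Ltac Rmin_le := eauto using Rle_trans, Rmin_l, Rmin_r.

Lemma Cmod_minus_sym (z w : C) : Cmod (z - w) = Cmod (w - z).
Proof. rewrite <- (Cmod_opp (z - w)%C). f_equal. ring. Qed.

Lemma Cmod_tri3 (x y z : C) : Cmod (x - z) <= Cmod (x - y) + Cmod (y - z).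
Proof.
  replace (x - z)%C with ((x - y) + (y - z))%C by ring. apply Cmod_triangle.
Qed.

Lemma Cmod_tri_inv (x y : C) : Cmod x - Cmod y <= Cmod (x - y).
Proof.
  assert (H := Cmod_triangle (x - y)%C y).
  replace (x - y + y)%C with x in H by ring. lra.
Qed.

Lemma Cmod_minus_le (x y : C) : Cmod (x - y) <= Cmod x + Cmod y.
Proof.
  assert (H := Cmod_triangle x (- y)%C). rewrite Cmod_opp in H.
  replace (x - y)%C with (x + - y)%C by ring. exact H.
Qed.

Lemma cont_at_ext {X : Type} (d : X -> X -> R) (f g : X -> C) (x : X) :
  (forall y, f y = g y) -> cont_at d f x -> cont_at d g x.
Proof.
  intros H Hf eps He. destruct (Hf eps He) as [del [Hd Hy]].
  exists del. split; [assumption|]. intros y Hy'. rewrite <- !H. auto.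
Qed.

Lemma cont_at_const {X : Type} (d : X -> X -> R) (c : C) (x : X) :
  cont_at d (fun _ => c) x.
Proof.
  intros eps He. exists 1. split; [lra|]. intros y _.
  rewrite Cmod_diag. exact He.
Qed.

Lemma cont_at_plus {X : Type} (d : X -> X -> R) (f g : X -> C) (x : X) :
  cont_at d f x -> cont_at d g x -> cont_at d (fun y => f y + g y)%C x.
Proof.
  intros Hf Hg eps He.
  destruct (Hf (eps / 2)) as [d1 [Hd1 H1]]; [lra|].
  destruct (Hg (eps / 2)) as [d2 [Hd2 H2]]; [lra|].
  exists (Rmin d1 d2). split; [apply Rmin_pos; assumption|]. intros y Hy.
  assert (A := H1 y ltac:(eapply Rlt_le_trans; [exact Hy|apply Rmin_l])).
  assert (B := H2 y ltac:(eapply Rlt_le_trans; [exact Hy|apply Rmin_r])).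
  replace (f y + g y - (f x + g x))%C with ((f y - f x) + (g y - g x))%C by ring.
  eapply Rle_lt_trans; [apply Cmod_triangle|]. lra.
Qed.

Lemma cont_at_mult {X : Type} (d : X -> X -> R) (f g : X -> C) (x : X) :
  cont_at d f x -> cont_at d g x -> cont_at d (fun y => f y * g y)%C x.
Proof.
  intros Hf Hg eps He.
  set (A := Cmod (f x)). set (B := Cmod (g x)).
  assert (HA : 0 <= A) by apply Cmod_ge_0. assert (HB : 0 <= B) by apply Cmod_ge_0.
  set (e := Rmin 1 (eps / (2 * (A + B + 1)))).
  assert (He0 : 0 < e).
  { apply Rmin_pos; [lra|]. apply Rdiv_lt_0_compat; lra. }
  assert (He1 : e <= 1) by apply Rmin_l.
  assert (He2 : e * (A + B + 1) <= eps / 2).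
  { assert (e <= eps / (2 * (A + B + 1))) by apply Rmin_r.
    replace (eps / 2) with (eps / (2 * (A + B + 1)) * (A + B + 1)) by (field; lra).
    apply Rmult_le_compat_r; lra. }
  destruct (Hf e He0) as [d1 [Hd1 H1]]. destruct (Hg e He0) as [d2 [Hd2 H2]].
  exists (Rmin d1 d2). split; [apply Rmin_pos; assumption|]. intros y Hy.
  assert (P := H1 y ltac:(eapply Rlt_le_trans; [exact Hy|apply Rmin_l])).
  assert (Q := H2 y ltac:(eapply Rlt_le_trans; [exact Hy|apply Rmin_r])).
  replace (f y * g y - f x * g x)%C
    with ((f y - f x) * (g y - g x) + (f x * (g y - g x) + (f y - f x) * g x))%C by ring.
  eapply Rle_lt_trans; [apply Cmod_triangle|].
  eapply Rle_lt_trans; [apply Rplus_le_compat_l, Cmod_triangle|].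
  rewrite !Cmod_mult. fold A. fold B.
  assert (0 <= Cmod (f y - f x)) by apply Cmod_ge_0.
  assert (0 <= Cmod (g y - g x)) by apply Cmod_ge_0.
  set (p := Cmod (f y - f x)) in *. set (q := Cmod (g y - g x)) in *.
  assert (p * q <= e * 1) by (apply Rmult_le_compat; lra).
  assert (A * q <= A * e) by (apply Rmult_le_compat_l; lra).
  assert (p * B <= e * B) by (apply Rmult_le_compat_r; lra).
  lra.
Qed.

Lemma cont_at_inv {X : Type} (d : X -> X -> R) (f : X -> C) (x : X) :
  f x <> RtoC 0 -> cont_at d f x -> cont_at d (fun y => / f y)%C x.
Proof.
  intros Hx Hf eps He.
  assert (HA := proj1 (Cmod_gt_0 _) Hx). set (A := Cmod (f x)) in *.
  set (e := Rmin (A / 2) (eps * (A * A / 4))).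
  assert (He0 : 0 < e).
  { apply Rmin_pos; [lra|]. apply Rmult_lt_0_compat; [exact He|].
    assert (0 < A * A) by (apply Rmult_lt_0_compat; exact HA). lra. }
  destruct (Hf e He0) as [d1 [Hd1 H1]].
  exists d1. split; [assumption|]. intros y Hy. specialize (H1 y Hy).
  assert (L1 : e <= A / 2) by apply Rmin_l.
  assert (L2 : e <= eps * (A * A / 4)) by apply Rmin_r.
  assert (Hfy : A / 2 < Cmod (f y)).
  { assert (T := Cmod_tri_inv (f x) (f y)). rewrite Cmod_minus_sym in T. fold A in T. lra. }
  assert (Hy0 : f y <> RtoC 0) by (apply Cmod_gt_0; lra).
  replace (/ f y - / f x)%C with (- (f y - f x) * / (f y * f x))%C
    by (field; split; assumption).
  rewrite Cmod_mult, Cmod_opp, Cmod_inv, Cmod_mult by (apply Cmult_neq_0; assumption).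
  fold A.
  assert (0 < Cmod (f y) * A) by nra.
  apply (Rmult_lt_reg_r (Cmod (f y) * A)); [assumption|].
  rewrite Rmult_assoc, Rinv_l, Rmult_1_r by lra.
  eapply Rlt_le_trans; [exact H1|]. eapply Rle_trans; [exact L2|].
  apply Rmult_le_compat_l; nra.
Qed.

Lemma cont_at_comp {X Y : Type} (dX : X -> X -> R) (g : X -> Y) (f : Y -> C)
  (dY : Y -> Y -> R) (x : X) :
  cont_at dY f (g x) ->
  (forall eps, 0 < eps -> exists del, 0 < del /\ forall y, dX y x < del -> dY (g y) (g x) < eps) ->
  cont_at dX (fun y => f (g y)) x.
Proof.
  intros Hf Hg eps He. destruct (Hf eps He) as [e1 [He1 H1]].
  destruct (Hg e1 He1) as [del [Hd H2]]. exists del. split; [assumption|].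
  intros y Hy. apply H1, H2, Hy.
Qed.

Lemma cont_at_id (z : C) : cont_at dist_C (fun y => y) z.
Proof. intros eps He. exists eps. split; auto. Qed.

Lemma cont_at_opp {X : Type} (d : X -> X -> R) (f : X -> C) (x : X) :
  cont_at d f x -> cont_at d (fun y => - f y)%C x.
Proof.
  intros H. apply (cont_at_ext d (fun y => RtoC (-1) * f y)%C).
  - intros y. apply injective_projections; simpl; ring.
  - apply cont_at_mult; [apply cont_at_const|exact H].
Qed.

Lemma cont_at_minus {X : Type} (d : X -> X -> R) (f g : X -> C) (x : X) :
  cont_at d f x -> cont_at d g x -> cont_at d (fun y => f y - g y)%C x.
Proof. intros. apply cont_at_plus; [|apply cont_at_opp]; assumption. Qed.

(** Carathéodory's form of differentiability: the difference quotient extends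
    continuously to [z].  The rules of calculus reduce to those of continuity. *)
Definition is_cderiv (f : C -> C) (z l : C) : Prop :=
  exists phi : C -> C, cont_at dist_C phi z /\ phi z = l /\
    forall w, f w = (f z + phi w * (w - z))%C.

Definition Cdiff (f : C -> C) (z : C) : Prop := exists l, is_cderiv f z l.

Lemma Cdiff_cont (f : C -> C) (z : C) : Cdiff f z -> cont_at dist_C f z.
Proof.
  intros [l [phi [Hc [Hl Hf]]]].
  apply (cont_at_ext _ (fun w => f z + phi w * (w - z))%C); [intros; symmetry; apply Hf|].
  apply cont_at_plus; [apply cont_at_const|]. apply cont_at_mult; [exact Hc|].
  apply cont_at_minus; [apply cont_at_id|apply cont_at_const].
Qed.

Lemma Cdiff_const (c z : C) : Cdiff (fun _ => c) z.
Proof.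
  exists (RtoC 0), (fun _ => RtoC 0). split; [apply cont_at_const|]. split; [reflexivity|].
  intros w. ring.
Qed.

Lemma Cdiff_id (z : C) : Cdiff (fun w => w) z.
Proof.
  exists (RtoC 1), (fun _ => RtoC 1). split; [apply cont_at_const|]. split; [reflexivity|].
  intros w. ring.
Qed.

Lemma Cdiff_plus (f g : C -> C) (z : C) :
  Cdiff f z -> Cdiff g z -> Cdiff (fun w => f w + g w)%C z.
Proof.
  intros [l [phi [Hc [Hl Hf]]]] [m [psi [Hd [Hm Hg]]]].
  exists (phi z + psi z)%C, (fun w => phi w + psi w)%C.
  split; [apply cont_at_plus; assumption|]. split; [reflexivity|].
  intros w. rewrite (Hf w), (Hg w). ring.
Qed.

Lemma Cdiff_mult (f g : C -> C) (z : C) :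
  Cdiff f z -> Cdiff g z -> Cdiff (fun w => f w * g w)%C z.
Proof.
  intros Hf' Hg'. assert (Cg := Cdiff_cont g z Hg').
  destruct Hf' as [l [phi [Hc [Hl Hf]]]]. destruct Hg' as [m [psi [Hd [Hm Hg]]]].
  eexists. exists (fun w => phi w * g w + f z * psi w)%C.
  split; [|split; [reflexivity|]].
  - apply cont_at_plus; apply cont_at_mult; auto. apply cont_at_const.
  - intros w. rewrite (Hf w) at 1. rewrite (Hg w). ring.
Qed.

Lemma Cdiff_inv (f : C -> C) (z : C) :
  f z <> RtoC 0 -> Cdiff f z -> Cdiff (fun w => / f w)%C z.
Proof.
  intros Hz Hf'. assert (Cf := Cdiff_cont f z Hf').
  destruct Hf' as [l [phi [Hc [Hl Hf]]]].
  (* At a zero of [f] the value of [/ f] is arbitrary; there the slope is defined as the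
     difference quotient itself. *)
  eexists.
  exists (fun w => if excluded_middle_informative (f w = RtoC 0)
            then ((/ f w - / f z) * / (w - z))%C else (- phi w * / (f w * f z))%C).
  split; [|split; [reflexivity|]].
  - destruct (Cf (Cmod (f z))) as [d0 [Hd0 H0]]; [apply Cmod_gt_0, Hz|].
    assert (Hnz : forall y, dist_C y z < d0 -> f y <> RtoC 0).
    { intros y Hy E. specialize (H0 y Hy). rewrite E in H0.
      replace (RtoC 0 - f z)%C with (- f z)%C in H0 by ring. rewrite Cmod_opp in H0. lra. }
    assert (Hk : cont_at dist_C (fun w => - phi w * / (f w * f z))%C z).
    { apply cont_at_mult; [apply cont_at_opp, Hc|].
      apply (cont_at_inv _ (fun w => f w * f z)%C); [apply Cmult_neq_0; assumption|].
      apply cont_at_mult; [exact Cf|apply cont_at_const]. }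
    intros eps He. destruct (Hk eps He) as [d1 [Hd1 H1]].
    exists (Rmin d0 d1). split; [apply Rmin_pos; assumption|]. intros y Hy.
    destruct (excluded_middle_informative (f z = RtoC 0)) as [E|_]; [contradiction|].
    destruct (excluded_middle_informative (f y = RtoC 0)) as [E|_].
    + exfalso. apply (Hnz y); [|exact E]. eapply Rlt_le_trans; [exact Hy|apply Rmin_l].
    + apply H1. eapply Rlt_le_trans; [exact Hy|apply Rmin_r].
  - intros w. destruct (excluded_middle_informative (f w = RtoC 0)) as [E|N].
    + assert (Hwz : (w - z)%C <> RtoC 0).
      { intros H. apply Hz. rewrite <- E. f_equal.
        replace w with ((w - z) + z)%C by ring. rewrite H. ring. }
      generalize (/ f w)%C (/ f z)%C. intros p q. field. exact Hwz.
    + assert (E := Hf w).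
      replace (- phi w * / (f w * f z) * (w - z))%C
        with (- (phi w * (w - z)) * / (f w * f z))%C by ring.
      replace (phi w * (w - z))%C with (f w - f z)%C by (rewrite E; ring).
      field. split; assumption.
Qed.

Lemma Cdiff_local (f g : C -> C) (z : C) (r : R) :
  0 < r -> (forall w, Cmod (w - z) < r -> f w = g w) -> Cdiff f z -> Cdiff g z.
Proof.
  intros Hr H [l [phi [Hc [Hl Hf]]]].
  exists l, (fun w => if excluded_middle_informative (Cmod (w - z) < r)
                then phi w else ((g w - g z) * / (w - z))%C).
  assert (Hz : Cmod (z - z) < r).
  { rewrite Cmod_diag. exact Hr. }
  split; [|split].
  - intros eps He. destruct (Hc eps He) as [d1 [Hd1 H1]].
    exists (Rmin r d1). split; [apply Rmin_pos; assumption|]. intros y Hy.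
    destruct (excluded_middle_informative (Cmod (z - z) < r)) as [_|N]; [|contradiction].
    destruct (excluded_middle_informative (Cmod (y - z) < r)) as [_|N].
    + apply H1. eapply Rlt_le_trans; [exact Hy|apply Rmin_r].
    + exfalso. apply N. eapply Rlt_le_trans; [exact Hy|apply Rmin_l].
  - destruct (excluded_middle_informative (Cmod (z - z) < r)) as [_|N]; [exact Hl|contradiction].
  - intros w. destruct (excluded_middle_informative (Cmod (w - z) < r)) as [L|N].
    + rewrite <- (H w L), <- (H z Hz). apply Hf.
    + assert (Hwz : (w - z)%C <> RtoC 0).
      { intros E. apply N. rewrite E, Cmod_0. exact Hr. }
      field. exact Hwz.
Qed.

Lemma Cdiff_ext (f g : C -> C) (z : C) :
  (forall w, f w = g w) -> Cdiff f z -> Cdiff g z.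
Proof. intros H. apply (Cdiff_local f g z 1); [lra|auto]. Qed.

Lemma Cdiff_opp (f : C -> C) (z : C) : Cdiff f z -> Cdiff (fun w => - f w)%C z.
Proof.
  intros H. apply (Cdiff_ext (fun w => RtoC (-1) * f w)%C).
  - intros y. apply injective_projections; simpl; ring.
  - apply Cdiff_mult; [apply Cdiff_const|exact H].
Qed.

Lemma Cdiff_minus (f g : C -> C) (z : C) :
  Cdiff f z -> Cdiff g z -> Cdiff (fun w => f w - g w)%C z.
Proof. intros. apply Cdiff_plus; [|apply Cdiff_opp]; assumption. Qed.

Lemma Cdiff_pow (f : C -> C) (z : C) (n : nat) :
  Cdiff f z -> Cdiff (fun w => Cpow (f w) n) z.
Proof.
  intros H. induction n as [|n IH]; simpl; [apply Cdiff_const|apply Cdiff_mult; assumption].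
Qed.

Lemma Cdiff_comp_shift (f : C -> C) (z h : C) :
  Cdiff f (z + h)%C -> Cdiff (fun w => f (w + h)%C) z.
Proof.
  intros [l [phi [Hc [Hl Hf]]]].
  exists l, (fun w => phi (w + h)%C). split; [|split; [exact Hl|]].
  - intros eps He. destruct (Hc eps He) as [d [Hd H]]. exists d. split; [exact Hd|].
    intros y Hy. apply H. unfold dist_C in *.
    replace (y + h - (z + h))%C with (y - z)%C by ring. exact Hy.
  - intros w. rewrite (Hf (w + h)%C). ring.
Qed.

Lemma Cdiff_eps (f : C -> C) (z : C) :
  Cdiff f z -> exists l, forall eps, 0 < eps -> exists del, 0 < del /\
    forall w, Cmod (w - z) < del ->
      Cmod (f w - (f z + l * (w - z)))%C <= eps * Cmod (w - z).
Proof.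
  intros [l [phi [Hc [Hl Hf]]]]. exists l. intros eps He.
  destruct (Hc eps He) as [d [Hd H]]. exists d. split; [exact Hd|].
  intros w Hw. specialize (H w Hw). rewrite (Hf w).
  replace (f z + phi w * (w - z) - (f z + l * (w - z)))%C
    with ((phi w - phi z) * (w - z))%C by (rewrite Hl; ring).
  rewrite Cmod_mult. apply Rmult_le_compat_r; [apply Cmod_ge_0|lra].
Qed.

Lemma eps_Cdiff (f : C -> C) (z l : C) :
  (forall eps, 0 < eps -> exists del, 0 < del /\
    forall w, Cmod (w - z) < del ->
      Cmod (f w - (f z + l * (w - z)))%C <= eps * Cmod (w - z)) -> Cdiff f z.
Proof.
  intros H.
  exists l, (fun w => if excluded_middle_informative (w = z)
                then l else ((f w - f z) * / (w - z))%C).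
  split; [|split].
  - intros eps He. destruct (H (eps / 2)) as [d [Hd Hw]]; [lra|].
    exists d. split; [exact Hd|]. intros y Hy.
    destruct (excluded_middle_informative (z = z)) as [_|N]; [|congruence].
    destruct (excluded_middle_informative (y = z)) as [E|N].
    + rewrite Cmod_diag. exact He.
    + assert (Hyz : (y - z)%C <> RtoC 0).
      { intros E. apply N. replace y with ((y - z) + z)%C by ring. rewrite E. ring. }
      replace ((f y - f z) * / (y - z) - l)%C
        with ((f y - (f z + l * (y - z))) * / (y - z))%C by (field; exact Hyz).
      rewrite Cmod_mult, Cmod_inv by exact Hyz.
      assert (P := proj1 (Cmod_gt_0 _) Hyz). specialize (Hw y Hy).
      apply (Rmult_lt_reg_r (Cmod (y - z))); [exact P|].
      rewrite Rmult_assoc, Rinv_l, Rmult_1_r by lra. nra.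
  - destruct (excluded_middle_informative (z = z)) as [_|N]; [reflexivity|congruence].
  - intros w. destruct (excluded_middle_informative (w = z)) as [E|N].
    + rewrite E. ring.
    + assert (Hwz : (w - z)%C <> RtoC 0).
      { intros E. apply N. replace w with ((w - z) + z)%C by ring. rewrite E. ring. }
      field. exact Hwz.
Qed.

(** * Integrals of complex-valued functions of a real variable *)

Definition CI (f : R -> C) (a b : R) : C :=
  (RInt (fun t => fst (f t)) a b, RInt (fun t => snd (f t)) a b).

Definition exCI (f : R -> C) (a b : R) : Prop :=
  ex_RInt (fun t => fst (f t)) a b /\ ex_RInt (fun t => snd (f t)) a b.

Lemma cont_at_fst (f : R -> C) (t : R) :
  cont_at dist_R f t -> continuous (fun s => fst (f s)) t.
Proof.
  intros H. apply filterlim_locally. intros eps.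
  destruct (H eps (cond_pos eps)) as [d [Hd Hs]].
  exists (mkposreal d Hd). intros s Hb. specialize (Hs s Hb).
  eapply Rle_lt_trans; [|exact Hs].
  eapply Rle_trans; [|apply Rmax_Cmod]. apply Rmax_l.
Qed.

Lemma cont_at_snd (f : R -> C) (t : R) :
  cont_at dist_R f t -> continuous (fun s => snd (f s)) t.
Proof.
  intros H. apply filterlim_locally. intros eps.
  destruct (H eps (cond_pos eps)) as [d [Hd Hs]].
  exists (mkposreal d Hd). intros s Hb. specialize (Hs s Hb).
  eapply Rle_lt_trans; [|exact Hs].
  eapply Rle_trans; [|apply Rmax_Cmod]. apply Rmax_r.
Qed.

Lemma cont_at_pair (f : R -> C) (t : R) :
  continuous (fun s => fst (f s)) t -> continuous (fun s => snd (f s)) t ->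
  cont_at dist_R f t.
Proof.
  intros H1 H2 eps He.
  assert (He2 : 0 < eps / 2) by lra.
  destruct (proj1 (filterlim_locally _ _) H1 (mkposreal _ He2)) as [d1 P1].
  destruct (proj1 (filterlim_locally _ _) H2 (mkposreal _ He2)) as [d2 P2].
  exists (Rmin d1 d2). split; [apply Rmin_pos; apply cond_pos|]. intros s Hs.
  assert (Q1 := P1 s (Rlt_le_trans _ _ _ Hs (Rmin_l _ _))).
  assert (Q2 := P2 s (Rlt_le_trans _ _ _ Hs (Rmin_r _ _))).
  change (Rabs (fst (f s) - fst (f t)) < eps / 2) in Q1.
  change (Rabs (snd (f s) - snd (f t)) < eps / 2) in Q2.
  replace (f s - f t)%C with (RtoC (fst (f s) - fst (f t)) + Ci * RtoC (snd (f s) - snd (f t)))%C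
    by (apply injective_projections; simpl; ring).
  eapply Rle_lt_trans; [apply Cmod_triangle|].
  rewrite Cmod_mult, Cmod_Ci, !Cmod_R. lra.
Qed.

Lemma cont_exCI (f : R -> C) (a b : R) :
  a <= b -> (forall t, a <= t <= b -> cont_at dist_R f t) -> exCI f a b.
Proof.
  intros Hab H. split; apply (ex_RInt_continuous (V := R_CompleteNormedModule));
    intros t Ht; rewrite Rmin_left, Rmax_right in Ht by exact Hab.
  - apply cont_at_fst, H, Ht.
  - apply cont_at_snd, H, Ht.
Qed.

Lemma CI_plus (f g : R -> C) (a b : R) :
  exCI f a b -> exCI g a b -> CI (fun t => f t + g t)%C a b = (CI f a b + CI g a b)%C.
Proof.
  intros [F1 F2] [G1 G2]. apply injective_projections; simpl;
    apply (RInt_plus (V := R_CompleteNormedModule)); assumption.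
Qed.

Lemma exCI_scal (c : C) (f : R -> C) (a b : R) :
  exCI f a b -> exCI (fun t => c * f t)%C a b.
Proof.
  intros [F1 F2]. split.
  - apply (ex_RInt_minus (V := R_NormedModule) (fun t => fst c * fst (f t)) (fun t => snd c * snd (f t)));
      apply (ex_RInt_scal (V := R_NormedModule)); assumption.
  - apply (ex_RInt_plus (V := R_NormedModule) (fun t => fst c * snd (f t)) (fun t => snd c * fst (f t)));
      apply (ex_RInt_scal (V := R_NormedModule)); assumption.
Qed.

Lemma CI_scal (c : C) (f : R -> C) (a b : R) :
  exCI f a b -> CI (fun t => c * f t)%C a b = (c * CI f a b)%C.
Proof.
  intros [F1 F2]. apply injective_projections.
  - change (RInt (fun t => minus (scal (fst c) (fst (f t))) (scal (snd c) (snd (f t)))) a b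
            = fst c * fst (CI f a b) - snd c * snd (CI f a b)).
    rewrite (RInt_minus (V := R_CompleteNormedModule))
      by (apply (ex_RInt_scal (V := R_NormedModule)); assumption).
    rewrite !(RInt_scal (V := R_CompleteNormedModule)) by assumption. reflexivity.
  - change (RInt (fun t => plus (scal (fst c) (snd (f t))) (scal (snd c) (fst (f t)))) a b
            = fst c * snd (CI f a b) + snd c * fst (CI f a b)).
    rewrite (RInt_plus (V := R_CompleteNormedModule))
      by (apply (ex_RInt_scal (V := R_NormedModule)); assumption).
    rewrite !(RInt_scal (V := R_CompleteNormedModule)) by assumption. reflexivity.
Qed.

Lemma CI_ext (f g : R -> C) (a b : R) :
  a <= b -> (forall t, a < t < b -> f t = g t) -> CI f a b = CI g a b.
Proof.
  intros Hab H. apply injective_projections; simpl;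
    apply (RInt_ext (V := R_CompleteNormedModule)); intros t Ht;
    rewrite Rmin_left, Rmax_right in Ht by exact Hab; rewrite (H t Ht); reflexivity.
Qed.

Lemma CI_minus (f g : R -> C) (a b : R) :
  a <= b ->
  exCI f a b -> exCI g a b -> CI (fun t => f t - g t)%C a b = (CI f a b - CI g a b)%C.
Proof.
  intros Hab F G.
  transitivity (CI (fun t => f t + RtoC (-1) * g t)%C a b).
  - apply CI_ext; [exact Hab|]. intros t _. apply injective_projections; simpl; ring.
  - rewrite (CI_plus f (fun t => RtoC (-1) * g t)%C a b F (exCI_scal _ _ _ _ G)).
    rewrite (CI_scal _ g a b G).
    generalize (CI f a b) (CI g a b). intros p q.
    apply injective_projections; simpl; ring.
Qed.

Lemma exCI_minus (f g : R -> C) (a b : R) :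
  exCI f a b -> exCI g a b -> exCI (fun t => f t - g t)%C a b.
Proof.
  intros [F1 F2] [G1 G2].
  split; apply (ex_RInt_minus (V := R_NormedModule)); assumption.
Qed.

Lemma CI_Chasles (f : R -> C) (a b c : R) :
  exCI f a b -> exCI f b c -> (CI f a b + CI f b c)%C = CI f a c.
Proof.
  intros [F1 F2] [G1 G2]. apply injective_projections; simpl;
    apply (RInt_Chasles (V := R_CompleteNormedModule)); assumption.
Qed.

Lemma CI_bound_fun (f : R -> C) (g : R -> R) (a b : R) :
  a <= b -> exCI f a b -> ex_RInt g a b ->
  (forall t, a < t < b -> Cmod (f t) <= g t) -> Cmod (CI f a b) <= 2 * RInt g a b.
Proof.
  intros Hab [F1 F2] G H.
  assert (B : forall h : R -> R, ex_RInt h a b -> (forall t, a < t < b -> Rabs (h t) <= g t) ->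
    Rabs (RInt h a b) <= RInt g a b).
  { intros h Hh Hb. eapply Rle_trans; [apply abs_RInt_le; assumption|].
    apply RInt_le; try assumption. apply (ex_RInt_norm h); assumption. }
  assert (B1 := B _ F1). assert (B2 := B _ F2).
  replace (CI f a b) with (RtoC (fst (CI f a b)) + Ci * RtoC (snd (CI f a b)))%C
    by (apply injective_projections; simpl; ring).
  eapply Rle_trans; [apply Cmod_triangle|].
  rewrite Cmod_mult, Cmod_Ci, !Cmod_R.
  assert (Rabs (fst (CI f a b)) <= RInt g a b).
  { apply B1. intros t Ht. eapply Rle_trans; [|apply H, Ht].
    eapply Rle_trans; [|apply Rmax_Cmod]. apply Rmax_l. }
  assert (Rabs (snd (CI f a b)) <= RInt g a b).
  { apply B2. intros t Ht. eapply Rle_trans; [|apply H, Ht].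
    eapply Rle_trans; [|apply Rmax_Cmod]. apply Rmax_r. }
  lra.
Qed.

(** The factor [2] comes from estimating real and imaginary parts separately. *)
Lemma CI_bound (f : R -> C) (a b M : R) :
  a <= b -> exCI f a b -> (forall t, a < t < b -> Cmod (f t) <= M) ->
  Cmod (CI f a b) <= 2 * (M * (b - a)).
Proof.
  intros Hab F H. eapply Rle_trans; [apply (CI_bound_fun f (fun _ => M)); auto|].
  - apply ex_RInt_const.
  - rewrite RInt_const. unfold scal; simpl; unfold mult; simpl. lra.
Qed.

Lemma CI_shift (f : R -> C) (c a b : R) :
  exCI f (a + c) (b + c) -> CI (fun t => f (t + c)) a b = CI f (a + c) (b + c).
Proof.
  intros [F1 F2].
  assert (S : forall h : R -> R, ex_RInt h (a + c) (b + c) ->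
    RInt (fun t => h (t + c)) a b = RInt h (a + c) (b + c)).
  { intros h Hh. assert (L := RInt_comp_lin (V := R_CompleteNormedModule) h 1 c a b).
    rewrite !Rmult_1_l in L. rewrite <- L by exact Hh.
    apply (RInt_ext (V := R_CompleteNormedModule)). intros t _.
    unfold scal; simpl; unfold mult; simpl. rewrite !Rmult_1_l. reflexivity. }
  apply injective_projections; simpl.
  - apply (S (fun t => fst (f t))), F1.
  - apply (S (fun t => snd (f t))), F2.
Qed.

Definition is_pderiv (f : R -> C) (t : R) (l : C) : Prop :=
  is_derive (fun s => fst (f s)) t (fst l) /\ is_derive (fun s => snd (f s)) t (snd l).

Lemma is_derive_eq (f : R -> R) (t l l' : R) : is_derive f t l -> l = l' -> is_derive f t l'.
Proof. intros H <-. exact H. Qed.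

Lemma is_pderiv_const (c : C) (t : R) : is_pderiv (fun _ => c) t (RtoC 0).
Proof. split; apply (is_derive_const (K := R_AbsRing) (V := R_NormedModule)). Qed.

Lemma is_pderiv_plus (f g : R -> C) (t : R) (l m : C) :
  is_pderiv f t l -> is_pderiv g t m -> is_pderiv (fun s => f s + g s)%C t (l + m)%C.
Proof.
  intros [F1 F2] [G1 G2].
  split; apply (is_derive_plus (K := R_AbsRing) (V := R_NormedModule)); assumption.
Qed.

Lemma is_pderiv_mult (f g : R -> C) (t : R) (l m : C) :
  is_pderiv f t l -> is_pderiv g t m ->
  is_pderiv (fun s => f s * g s)%C t (l * g t + f t * m)%C.
Proof.
  intros [F1 F2] [G1 G2].
  assert (M : forall (p q : R -> R) (a b : R), is_derive p t a -> is_derive q t b ->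
    is_derive (fun s => p s * q s) t (a * q t + p t * b)).
  { intros p q a b Hp Hq. apply (is_derive_mult (K := R_AbsRing) p q t a b Hp Hq).
    intros; apply Rmult_comm. }
  split.
  - eapply is_derive_eq.
    + apply (is_derive_minus (K := R_AbsRing) (V := R_NormedModule)
        (fun s => fst (f s) * fst (g s)) (fun s => snd (f s) * snd (g s)));
        apply M; eassumption.
    + unfold minus, plus, opp; simpl. ring.
  - eapply is_derive_eq.
    + apply (is_derive_plus (K := R_AbsRing) (V := R_NormedModule)
        (fun s => fst (f s) * snd (g s)) (fun s => snd (f s) * fst (g s)));
        apply M; eassumption.
    + unfold plus; simpl. ring.
Qed.

Lemma is_pderiv_cont (f : R -> C) (t : R) (l : C) : is_pderiv f t l -> cont_at dist_R f t.
Proof.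
  intros [F1 F2].
  apply cont_at_pair; apply (ex_derive_continuous (K := R_AbsRing) (V := R_NormedModule));
    eexists; eassumption.
Qed.

Lemma CI_FTC (F f : R -> C) (a b : R) :
  a <= b -> (forall t, a <= t <= b -> is_pderiv F t (f t)) ->
  (forall t, a <= t <= b -> cont_at dist_R f t) ->
  CI f a b = (F b - F a)%C.
Proof.
  intros Hab HF Hf.
  assert (A : forall h k : R -> R, (forall t, a <= t <= b -> is_derive k t (h t)) ->
    (forall t, a <= t <= b -> continuous h t) -> RInt h a b = k b - k a).
  { intros h k H1 H2. apply is_RInt_unique.
    apply (is_RInt_derive (V := R_CompleteNormedModule) k h a b);
      intros t Ht; rewrite Rmin_left, Rmax_right in Ht by exact Hab; auto. }
  apply injective_projections.
  - apply (A (fun t => fst (f t)) (fun t => fst (F t))).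
    + intros t Ht. apply (HF t Ht).
    + intros t Ht. apply cont_at_fst, Hf, Ht.
  - apply (A (fun t => snd (f t)) (fun t => snd (F t))).
    + intros t Ht. apply (HF t Ht).
    + intros t Ht. apply cont_at_snd, Hf, Ht.
Qed.

(** * Goursat's theorem for parametrised rectangles *)

Lemma nested_dyadic (a : nat -> R) (w : R) :
  0 <= w -> (forall n, a n <= a (S n)) ->
  (forall n, a (S n) + w / 2 ^ S n <= a n + w / 2 ^ n) ->
  exists x, forall n, a n <= x <= a n + w / 2 ^ n.
Proof.
  intros Hw Hi Hd.
  assert (Hi' : forall n k, a n <= a (n + k)%nat).
  { intros n k. induction k as [|k IH].
    - rewrite Nat.add_0_r. lra.
    - rewrite Nat.add_succ_r. specialize (Hi (n + k)%nat). lra. }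
  assert (Hd' : forall n k, a (n + k)%nat + w / 2 ^ (n + k) <= a n + w / 2 ^ n).
  { intros n k. induction k as [|k IH].
    - rewrite Nat.add_0_r. lra.
    - rewrite Nat.add_succ_r. specialize (Hd (n + k)%nat). lra. }
  assert (Hp : forall n, 0 <= w / 2 ^ n).
  { intros n. assert (0 < 2 ^ n) by (apply pow_lt; lra).
    apply Rmult_le_pos; [exact Hw|]. left. apply Rinv_0_lt_compat. assumption. }
  assert (Hu : forall n m, a m <= a n + w / 2 ^ n).
  { intros n m. destruct (Nat.le_ge_cases n m) as [L|L].
    - replace m with (n + (m - n))%nat by lia. specialize (Hd' n (m - n)%nat).
      specialize (Hp (n + (m - n))%nat). lra.
    - replace n with (m + (n - m))%nat by lia. specialize (Hi' m (n - m)%nat).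
      specialize (Hp (m + (n - m))%nat). lra. }
  destruct (completeness (fun x => exists n, x = a n)) as [x [Hx1 Hx2]].
  - exists (a O + w / 2 ^ 0). intros y [n ->]. apply Hu.
  - exists (a O). exists O. reflexivity.
  - exists x. intros n. split.
    + apply Hx1. exists n. reflexivity.
    + apply Hx2. intros y [m ->]. apply Hu.
Qed.

Section Goursat.

Variables (Gam Gs Gt : R -> R -> C) (f : C -> C) (s0 s1 t0 t1 L : R).
Hypothesis (Hs : s0 < s1) (Ht : t0 < t1) (HL : 0 <= L).
Hypothesis (DGs : forall s t, is_pderiv (fun x => Gam x t) s (Gs s t)).
Hypothesis (DGt : forall s t, is_pderiv (fun x => Gam s x) t (Gt s t)).
Hypothesis (CGs : forall s t, cont_at dist_R (fun x => Gs x t) s).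
Hypothesis (CGt : forall s t, cont_at dist_R (fun x => Gt s x) t).
Hypothesis (BGs : forall s t, s0 <= s <= s1 -> t0 <= t <= t1 -> Cmod (Gs s t) <= L).
Hypothesis (BGt : forall s t, s0 <= s <= s1 -> t0 <= t <= t1 -> Cmod (Gt s t) <= L).
Hypothesis (Df : forall s t, s0 <= s <= s1 -> t0 <= t <= t1 -> Cdiff f (Gam s t)).

Let V (g : C -> C) (s c d : R) : C := CI (fun t => g (Gam s t) * Gt s t)%C c d.
Let H (g : C -> C) (t a b : R) : C := CI (fun s => g (Gam s t) * Gs s t)%C a b.

(* The integral of [g dz] along the image of the boundary of [[a,b] x [c,d]]. *)
Let J (g : C -> C) (a b c d : R) : C := (V g b c d - V g a c d - (H g d a b - H g c a b))%C.

Let Gcont_t (s t : R) : forall eps, 0 < eps -> exists del, 0 < del /\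
  forall y, dist_R y t < del -> dist_C (Gam s y) (Gam s t) < eps.
Proof. apply (is_pderiv_cont _ _ _ (DGt s t)). Qed.

Let Gcont_s (s t : R) : forall eps, 0 < eps -> exists del, 0 < del /\
  forall y, dist_R y s < del -> dist_C (Gam y t) (Gam s t) < eps.
Proof. apply (is_pderiv_cont _ _ _ (DGs s t)). Qed.

Let exV (g : C -> C) (s c d : R) : c <= d ->
  (forall t, c <= t <= d -> cont_at dist_C g (Gam s t)) ->
  exCI (fun t => g (Gam s t) * Gt s t)%C c d.
Proof.
  intros Hcd Hg. apply cont_exCI; [exact Hcd|]. intros t Hx.
  apply cont_at_mult; [|apply CGt].
  apply (cont_at_comp dist_R (fun t => Gam s t) g dist_C); [apply Hg, Hx|apply Gcont_t].
Qed.

Let exH (g : C -> C) (t a b : R) : a <= b ->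
  (forall s, a <= s <= b -> cont_at dist_C g (Gam s t)) ->
  exCI (fun s => g (Gam s t) * Gs s t)%C a b.
Proof.
  intros Hcd Hg. apply cont_exCI; [exact Hcd|]. intros s Hx.
  apply cont_at_mult; [|apply CGs].
  apply (cont_at_comp dist_R (fun s => Gam s t) g dist_C); [apply Hg, Hx|apply Gcont_s].
Qed.

Let exVf (s c d : R) : s0 <= s <= s1 -> t0 <= c -> c <= d -> d <= t1 ->
  exCI (fun t => f (Gam s t) * Gt s t)%C c d.
Proof. intros. apply exV; [lra|]. intros. apply Cdiff_cont, Df; lra. Qed.

Let exHf (t a b : R) : t0 <= t <= t1 -> s0 <= a -> a <= b -> b <= s1 ->
  exCI (fun s => f (Gam s t) * Gs s t)%C a b.
Proof. intros. apply exH; [lra|]. intros. apply Cdiff_cont, Df; lra. Qed.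

Let J_split_s (a m b c d : R) : s0 <= a -> a <= m -> m <= b -> b <= s1 ->
  t0 <= c -> c <= d -> d <= t1 -> J f a b c d = (J f a m c d + J f m b c d)%C.
Proof.
  intros. unfold J, H.
  rewrite <- (CI_Chasles (fun s => f (Gam s d) * Gs s d)%C a m b) by (apply exHf; lra).
  rewrite <- (CI_Chasles (fun s => f (Gam s c) * Gs s c)%C a m b) by (apply exHf; lra).
  ring.
Qed.

Let J_split_t (a b c m d : R) : s0 <= a -> a <= b -> b <= s1 ->
  t0 <= c -> c <= m -> m <= d -> d <= t1 -> J f a b c d = (J f a b c m + J f a b m d)%C.
Proof.
  intros. unfold J, V.
  rewrite <- (CI_Chasles (fun t => f (Gam b t) * Gt b t)%C c m d) by (apply exVf; lra).
  rewrite <- (CI_Chasles (fun t => f (Gam a t) * Gt a t)%C c m d) by (apply exVf; lra).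
  ring.
Qed.

(* An affine function has a primitive, so its boundary integral telescopes. *)
Let J_affine (al l : C) (a b c d : R) : a <= b -> c <= d ->
  J (fun z => al + l * z)%C a b c d = RtoC 0.
Proof.
  intros Hab Hcd.
  set (F := fun z : C => (al * z + l / 2 * (z * z))%C).
  assert (DF : forall (p : R -> C) (x : R) (q : C), is_pderiv p x q ->
    is_pderiv (fun y => F (p y)) x ((al + l * p x) * q)%C).
  { intros p x q Hp.
    assert (A := is_pderiv_plus _ _ _ _ _
       (is_pderiv_mult (fun _ => al) p x _ _ (is_pderiv_const al x) Hp)
       (is_pderiv_mult (fun _ => (l / 2)%C) _ x _ _ (is_pderiv_const (l / 2)%C x)
          (is_pderiv_mult p p x _ _ Hp Hp))).
    replace ((al + l * p x) * q)%C with
      (0 * p x + al * q + (0 * (p x * p x) + l / 2 * (q * p x + p x * q)))%C by (field; intros E; injection E; lra).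
    exact A. }
  assert (Caff : forall z, cont_at dist_C (fun z => al + l * z)%C z).
  { intros z. apply cont_at_plus; [apply cont_at_const|].
    apply cont_at_mult; [apply cont_at_const|apply cont_at_id]. }
  assert (EV : forall s, V (fun z => al + l * z)%C s c d = (F (Gam s d) - F (Gam s c))%C).
  { intros s. unfold V. apply (CI_FTC (fun t => F (Gam s t))); [exact Hcd| |].
    - intros t _. apply (DF (fun t => Gam s t)), DGt.
    - intros t _. apply cont_at_mult; [|apply CGt].
      apply (cont_at_comp dist_R (fun t => Gam s t) (fun z => al + l * z)%C dist_C);
        [apply Caff|apply Gcont_t]. }
  assert (EH : forall t, H (fun z => al + l * z)%C t a b = (F (Gam b t) - F (Gam a t))%C).
  { intros t. unfold H. apply (CI_FTC (fun s => F (Gam s t))); [exact Hab| |].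
    - intros s _. apply (DF (fun s => Gam s t)), DGs.
    - intros s _. apply cont_at_mult; [|apply CGs].
      apply (cont_at_comp dist_R (fun s => Gam s t) (fun z => al + l * z)%C dist_C);
        [apply Caff|apply Gcont_s]. }
  unfold J. rewrite !EV, !EH. ring.
Qed.

Let Gam_lip (s s' t t' : R) : s0 <= s <= s1 -> s0 <= s' <= s1 -> t0 <= t <= t1 -> t0 <= t' <= t1 ->
  Cmod (Gam s t - Gam s' t') <= 2 * L * (Rabs (s - s') + Rabs (t - t')).
Proof.
  intros A1 A2 A3 A4.
  assert (P : forall (p q : R -> C) (x y : R), x <= y ->
     (forall u, is_pderiv p u (q u)) -> (forall u, cont_at dist_R q u) ->
     (forall u, x <= u <= y -> Cmod (q u) <= L) -> Cmod (p y - p x) <= 2 * L * Rabs (y - x)).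
  { intros p q x y Hxy Dp Cq Bq.
    rewrite <- (CI_FTC p q x y) by auto.
    rewrite Rabs_pos_eq by lra. rewrite Rmult_assoc.
    apply CI_bound; [exact Hxy|apply cont_exCI; auto|]. intros; apply Bq; lra. }
  assert (P1 : Cmod (Gam s t - Gam s' t) <= 2 * L * Rabs (s - s')).
  { destruct (Rle_dec s' s).
    - apply (P (fun x => Gam x t) (fun x => Gs x t)); auto. intros; apply BGs; lra.
    - rewrite Cmod_minus_sym, Rabs_minus_sym.
      apply (P (fun x => Gam x t) (fun x => Gs x t)); auto; [lra|]. intros; apply BGs; lra. }
  assert (P2 : Cmod (Gam s' t - Gam s' t') <= 2 * L * Rabs (t - t')).
  { destruct (Rle_dec t' t).
    - apply (P (fun x => Gam s' x) (fun x => Gt s' x)); auto. intros; apply BGt; lra.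
    - rewrite Cmod_minus_sym, Rabs_minus_sym.
      apply (P (fun x => Gam s' x) (fun x => Gt s' x)); auto; [lra|]. intros; apply BGt; lra. }
  eapply Rle_trans; [apply (Cmod_tri3 _ (Gam s' t))|]. lra.
Qed.

(* Near a point of differentiability the boundary integral is [o(area)]: subtracting the
   affine part leaves an integrand of size [e * diam] on a path of length [O(diam)]. *)
Let J_local (x y eps : R) : s0 <= x <= s1 -> t0 <= y <= t1 -> 0 < eps ->
  exists del, 0 < del /\ forall a b c d r,
    s0 <= a <= x -> x <= b <= s1 -> t0 <= c <= y -> y <= d <= t1 ->
    b - a <= r -> d - c <= r -> r < del -> Cmod (J f a b c d) <= eps * (r * r).
Proof.
  intros Hx Hy He. destruct (Cdiff_eps f (Gam x y) (Df x y Hx Hy)) as [l Hl].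
  set (e := eps / (32 * L * L + 1)).
  assert (HLL : 0 < 32 * L * L + 1) by nra.
  assert (He0 : 0 < e) by (apply Rdiv_lt_0_compat; lra).
  destruct (Hl e He0) as [del [Hd Hw]].
  exists (del / (4 * L + 1)). split; [apply Rdiv_lt_0_compat; lra|].
  intros a b c d r Ha Hb Hc Hdd Hr1 Hr2 Hr.
  set (al := (f (Gam x y) - l * Gam x y)%C).
  set (g := fun z => (f z - (al + l * z))%C).
  assert (Hr0 : 0 <= r) by lra.
  assert (Hrd : 4 * L * r < del).
  { assert (r * (4 * L + 1) < del).
    { apply (Rmult_lt_reg_r (/ (4 * L + 1))); [apply Rinv_0_lt_compat; lra|].
      rewrite Rmult_assoc, Rinv_r, Rmult_1_r by lra. exact Hr. }
    lra. }
  assert (Bg : forall s t, a <= s <= b -> c <= t <= d -> Cmod (g (Gam s t)) <= e * (4 * L * r)).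
  { intros s t Hss Htt.
    assert (HG : Cmod (Gam s t - Gam x y) <= 4 * L * r).
    { eapply Rle_trans; [apply Gam_lip; lra|].
      assert (Rabs (s - x) <= r) by (apply Rabs_le; lra).
      assert (Rabs (t - y) <= r) by (apply Rabs_le; lra).
      replace (4 * L * r) with (2 * L * (r + r)) by ring.
      apply Rmult_le_compat_l; lra. }
    eapply Rle_trans; [|apply Rmult_le_compat_l; [lra|exact HG]].
    replace (g (Gam s t)) with (f (Gam s t) - (f (Gam x y) + l * (Gam s t - Gam x y)))%C
      by (unfold g, al; ring).
    apply Hw. lra. }
  assert (Cg : forall z, Cdiff f z -> cont_at dist_C g z).
  { intros z Hz. apply Cdiff_cont. apply Cdiff_minus; [exact Hz|].
    apply Cdiff_plus; [apply Cdiff_const|].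
    apply Cdiff_mult; [apply Cdiff_const|apply Cdiff_id]. }
  assert (Caff : forall z, cont_at dist_C (fun z => al + l * z)%C z).
  { intros z. apply cont_at_plus; [apply cont_at_const|].
    apply cont_at_mult; [apply cont_at_const|apply cont_at_id]. }
  assert (SV : forall s, a <= s <= b -> V f s c d = (V g s c d + V (fun z => al + l * z) s c d)%C).
  { intros s Hss. unfold V. rewrite <- CI_plus.
    - apply CI_ext; [lra|]. intros t _. unfold g. ring.
    - apply (exV g); [lra|]. intros. apply Cg, Df; lra.
    - apply (exV (fun z => al + l * z)%C); [lra|]. intros. apply Caff. }
  assert (SH : forall t, c <= t <= d -> H f t a b = (H g t a b + H (fun z => al + l * z) t a b)%C).
  { intros t Hss. unfold H. rewrite <- CI_plus.
    - apply CI_ext; [lra|]. intros s _. unfold g. ring.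
    - apply (exH g); [lra|]. intros. apply Cg, Df; lra.
    - apply (exH (fun z => al + l * z)%C); [lra|]. intros. apply Caff. }
  assert (SJ : J f a b c d = J g a b c d).
  { assert (E := J_affine al l a b c d ltac:(lra) ltac:(lra)).
    unfold J in *. rewrite !SV, !SH by lra.
    match goal with |- ?l = ?r => replace l with (r + 0)%C; [ring|rewrite <- E; ring] end. }
  rewrite SJ.
  set (B := 2 * (e * (4 * L * r) * L * r)).
  assert (HB0 : 0 <= e * (4 * L * r) * L).
  { apply Rmult_le_pos; [|exact HL]. apply Rmult_le_pos; [lra|].
    apply Rmult_le_pos; [lra|exact Hr0]. }
  assert (BV : forall s, a <= s <= b -> Cmod (V g s c d) <= B).
  { intros s Hss. eapply Rle_trans; [apply (CI_bound _ c d (e * (4 * L * r) * L)); [lra| |]|].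
    - apply (exV g); [lra|]. intros. apply Cg, Df; lra.
    - intros t Htt. rewrite Cmod_mult. apply Rmult_le_compat; try apply Cmod_ge_0.
      + apply Bg; lra.
      + apply BGt; lra.
    - unfold B. apply Rmult_le_compat_l; [lra|]. apply Rmult_le_compat_l; [exact HB0|lra]. }
  assert (BH : forall t, c <= t <= d -> Cmod (H g t a b) <= B).
  { intros s Hss. eapply Rle_trans; [apply (CI_bound _ a b (e * (4 * L * r) * L)); [lra| |]|].
    - apply (exH g); [lra|]. intros. apply Cg, Df; lra.
    - intros t Htt. rewrite Cmod_mult. apply Rmult_le_compat; try apply Cmod_ge_0.
      + apply Bg; lra.
      + apply BGs; lra.
    - unfold B. apply Rmult_le_compat_l; [lra|]. apply Rmult_le_compat_l; [exact HB0|lra]. }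
  assert (HJ : Cmod (J g a b c d) <= 4 * B).
  { unfold J. eapply Rle_trans; [apply Cmod_minus_le|].
    assert (T1 := Cmod_minus_le (V g b c d) (V g a c d)).
    assert (T2 := Cmod_minus_le (H g d a b) (H g c a b)).
    assert (Q1 := BV a ltac:(lra)). assert (Q2 := BV b ltac:(lra)).
    assert (Q3 := BH c ltac:(lra)). assert (Q4 := BH d ltac:(lra)). lra. }
  eapply Rle_trans; [exact HJ|]. unfold B.
  replace (4 * (2 * (e * (4 * L * r) * L * r))) with (e * (32 * L * L) * (r * r)) by ring.
  apply Rmult_le_compat_r; [nra|].
  apply Rle_trans with (e * (32 * L * L + 1)); [apply Rmult_le_compat_l; lra|].
  unfold e. right. field. lra.
Qed.

(** Bisection: if the boundary integral were nonzero, a nested sequence of dyadic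
    subrectangles would carry at least its share [4^-n] of it, contradicting
    the local estimate at the common point. *)
Lemma goursat_rect :
  (CI (fun t => f (Gam s1 t) * Gt s1 t)%C t0 t1 - CI (fun t => f (Gam s0 t) * Gt s0 t)%C t0 t1
   - (CI (fun s => f (Gam s t1) * Gs s t1)%C s0 s1 - CI (fun s => f (Gam s t0) * Gs s t0)%C s0 s1))%C
  = RtoC 0.
Proof.
  change (J f s0 s1 t0 t1 = RtoC 0). apply NNPP. intros HJ. apply Cmod_gt_0 in HJ.
  set (eps := Cmod (J f s0 s1 t0 t1)) in HJ.
  set (w := s1 - s0). set (h := t1 - t0).
  assert (Hp : forall n, 0 < 2 ^ n) by (intros; apply pow_lt; lra).
  assert (Hw2 : forall u n, 0 < u -> 0 < u / 2 ^ n).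
  { intros u n Hu. apply Rdiv_lt_0_compat; auto. }
  assert (Hhalf : forall u n, u / 2 ^ n = u / 2 ^ S n + u / 2 ^ S n).
  { intros u n. simpl. field. apply Rgt_not_eq, Hp. }
  set (Pr := fun (n : nat) (p : R * R) =>
     s0 <= fst p /\ fst p + w / 2 ^ n <= s1 /\ t0 <= snd p /\ snd p + h / 2 ^ n <= t1 /\
     eps / 2 ^ n / 2 ^ n
       <= Cmod (J f (fst p) (fst p + w / 2 ^ n) (snd p) (snd p + h / 2 ^ n))).
  assert (step : forall n p, Pr n p -> exists q, Pr (S n) q /\
     fst p <= fst q /\ fst q + w / 2 ^ S n <= fst p + w / 2 ^ n /\
     snd p <= snd q /\ snd q + h / 2 ^ S n <= snd p + h / 2 ^ n).
  { intros n [a c] [H1 [H2 [H3 [H4 H5]]]]. simpl fst in *. simpl snd in *.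
    set (w' := w / 2 ^ S n) in *. set (h' := h / 2 ^ S n) in *.
    assert (Ew : w / 2 ^ n = w' + w') by apply Hhalf.
    assert (Eh : h / 2 ^ n = h' + h') by apply Hhalf.
    assert (Ww : 0 < w') by (apply Hw2; unfold w; lra).
    assert (Hh' : 0 < h') by (apply Hw2; unfold h; lra).
    rewrite Ew, Eh in *.
    set (e' := eps / 2 ^ S n / 2 ^ S n).
    assert (Ee : eps / 2 ^ n / 2 ^ n = 4 * e').
    { unfold e'. simpl. field. apply Rgt_not_eq, Hp. }
    assert (S1 := J_split_s a (a + w') (a + (w' + w')) c (c + (h' + h'))
       ltac:(lra) ltac:(lra) ltac:(lra) ltac:(lra) ltac:(lra) ltac:(lra) ltac:(lra)).
    rewrite (J_split_t a (a + w') c (c + h') (c + (h' + h'))) in S1 by lra.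
    rewrite (J_split_t (a + w') (a + (w' + w')) c (c + h') (c + (h' + h'))) in S1 by lra.
    rewrite S1, Ee in H5.
    assert (Fin : forall a' c', (a' = a \/ a' = a + w') -> (c' = c \/ c' = c + h') ->
       e' <= Cmod (J f a' (a' + w') c' (c' + h')) ->
       exists q : R * R, Pr (S n) q /\
        a <= fst q /\ fst q + w' <= a + (w' + w') /\
        c <= snd q /\ snd q + h' <= c + (h' + h')).
    { intros a' c' Ea Ec Hq. exists (a', c'). unfold Pr. simpl fst; simpl snd.
      fold w' h' e'.
      assert (a <= a' /\ a' + w' <= a + (w' + w')) by (destruct Ea; lra).
      assert (c <= c' /\ c' + h' <= c + (h' + h')) by (destruct Ec; lra).
      repeat split; try lra. }
    destruct (Rle_dec e' (Cmod (J f a (a + w') c (c + h')))) as [Y|N1];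
      [apply (Fin a c); auto|].
    destruct (Rle_dec e' (Cmod (J f a (a + w') (c + h') (c + h' + h')))) as [Y|N2];
      [apply (Fin a (c + h')); auto|].
    destruct (Rle_dec e' (Cmod (J f (a + w') (a + w' + w') c (c + h')))) as [Y|N3];
      [apply (Fin (a + w') c); auto|].
    destruct (Rle_dec e' (Cmod (J f (a + w') (a + w' + w') (c + h') (c + h' + h')))) as [Y|N4];
      [apply (Fin (a + w') (c + h')); auto|].
    exfalso. rewrite <- !Rplus_assoc in H5.
    assert (T : Cmod (J f a (a + w') c (c + h') + J f a (a + w') (c + h') (c + h' + h') +
        (J f (a + w') (a + w' + w') c (c + h') + J f (a + w') (a + w' + w') (c + h') (c + h' + h')))%C
        < 4 * e').
    { eapply Rle_lt_trans; [apply Cmod_triangle|].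
      eapply Rle_lt_trans; [apply Rplus_le_compat; apply Cmod_triangle|]. lra. }
    lra. }
  assert (init : Pr O (s0, t0)).
  { unfold Pr. simpl fst; simpl snd. unfold w, h. simpl pow. unfold Rdiv. rewrite !Rinv_1, !Rmult_1_r.
    replace (s0 + (s1 - s0)) with s1 by ring. replace (t0 + (t1 - t0)) with t1 by ring.
    fold eps. repeat split; lra. }
  set (next := fun n (p : {p | Pr n p}) =>
     constructive_indefinite_description _ (step n (proj1_sig p) (proj2_sig p))).
  set (sq := fix sq n : {p | Pr n p} :=
     match n with
     | O => exist _ (s0, t0) init
     | S m => exist _ (proj1_sig (next m (sq m))) (proj1 (proj2_sig (next m (sq m))))
     end).
  assert (sqS : forall n, fst (proj1_sig (sq n)) <= fst (proj1_sig (sq (S n))) /\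
     fst (proj1_sig (sq (S n))) + w / 2 ^ S n <= fst (proj1_sig (sq n)) + w / 2 ^ n /\
     snd (proj1_sig (sq n)) <= snd (proj1_sig (sq (S n))) /\
     snd (proj1_sig (sq (S n))) + h / 2 ^ S n <= snd (proj1_sig (sq n)) + h / 2 ^ n).
  { intros n. apply (proj2 (proj2_sig (next n (sq n)))). }
  destruct (nested_dyadic (fun n => fst (proj1_sig (sq n))) w) as [x Hx];
    [unfold w; lra|intros n; apply sqS|intros n; apply sqS|].
  destruct (nested_dyadic (fun n => snd (proj1_sig (sq n))) h) as [y Hy];
    [unfold h; lra|intros n; apply sqS|intros n; apply sqS|].
  cbv beta in Hx, Hy.
  assert (Hx0 : s0 <= x <= s1).
  { destruct (proj2_sig (sq O)) as [A1 [A2 _]]. specialize (Hx O). lra. }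
  assert (Hy0 : t0 <= y <= t1).
  { destruct (proj2_sig (sq O)) as [_ [_ [A1 [A2 _]]]]. specialize (Hy O). lra. }
  set (W := w + h).
  assert (HW : 0 < W) by (unfold W, w, h; lra).
  assert (HWW : 0 < W * W) by (apply Rmult_lt_0_compat; exact HW).
  set (e := eps / (2 * (W * W))).
  assert (He : 0 < e) by (apply Rdiv_lt_0_compat; lra).
  destruct (J_local x y e Hx0 Hy0 He) as [del [Hdel Hloc]].
  destruct (pow_lt_1_zero (/ 2) ltac:(rewrite Rabs_pos_eq; lra) (del / W)) as [N HN];
    [apply Rdiv_lt_0_compat; lra|].
  specialize (HN N (le_n N)).
  assert (HN' : W / 2 ^ N < del).
  { rewrite Rabs_pos_eq in HN by (apply pow_le; lra). rewrite pow_inv in HN.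
    apply (Rmult_lt_compat_l W) in HN; [|exact HW].
    replace (W * (del / W)) with del in HN by (field; lra). exact HN. }
  destruct (proj2_sig (sq N)) as [A1 [A2 [A3 [A4 A5]]]].
  specialize (Hx N). specialize (Hy N).
  set (p := proj1_sig (sq N)) in *.
  assert (Q : Cmod (J f (fst p) (fst p + w / 2 ^ N) (snd p) (snd p + h / 2 ^ N))
     <= e * (W / 2 ^ N * (W / 2 ^ N))).
  { assert (EW : W / 2 ^ N = w / 2 ^ N + h / 2 ^ N) by (unfold W; field; apply Rgt_not_eq, Hp).
    assert (0 < w / 2 ^ N) by (apply Hw2; unfold w; lra).
    assert (0 < h / 2 ^ N) by (apply Hw2; unfold h; lra).
    apply Hloc; lra. }
  assert (E : e * (W / 2 ^ N * (W / 2 ^ N)) = (eps / 2 ^ N / 2 ^ N) / 2).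
  { unfold e. field. split; [apply Rgt_not_eq, Hp|lra]. }
  assert (0 < eps / 2 ^ N / 2 ^ N) by (apply Hw2, Hw2, HJ).
  rewrite E in Q. lra.
Qed.

End Goursat.

(** * Cauchy's formula and Taylor expansions *)

Definition eix (t : R) : C := (cos t, sin t).

Lemma Cmod_eix (t : R) : Cmod (eix t) = 1.
Proof.
  unfold Cmod, eix; simpl. rewrite !Rmult_1_r.
  replace (cos t * cos t + sin t * sin t) with 1.
  - apply sqrt_1.
  - assert (H := sin2_cos2 t). unfold Rsqr in H. lra.
Qed.

Lemma eix_deriv (t : R) : is_pderiv eix t (Ci * eix t)%C.
Proof.
  split; simpl.
  - eapply is_derive_eq; [apply is_derive_cos|]. ring.
  - eapply is_derive_eq; [apply is_derive_sin|]. ring.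
Qed.

Lemma eix_cont (t : R) : cont_at dist_R eix t.
Proof. eapply is_pderiv_cont, eix_deriv. Qed.

Lemma eix_2PI : eix (2 * PI) = eix 0.
Proof. unfold eix. rewrite cos_2PI, sin_2PI, cos_0, sin_0. reflexivity. Qed.

Lemma is_pderiv_eq (f : R -> C) (t : R) (l m : C) : is_pderiv f t l -> l = m -> is_pderiv f t m.
Proof. intros H <-. exact H. Qed.

Lemma RtoC_deriv (s : R) : is_pderiv (fun x => RtoC x) s (RtoC 1).
Proof.
  split; simpl.
  - apply (is_derive_id (K := R_AbsRing)).
  - apply (is_derive_const (K := R_AbsRing) (V := R_NormedModule)).
Qed.

Lemma Cmod_small (z : C) : (forall e, 0 < e -> Cmod z <= e) -> z = RtoC 0.
Proof.
  intros H. apply Cmod_eq_0. apply Rle_antisym; [|apply Cmod_ge_0].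
  apply Rnot_lt_le. intros L. specialize (H (Cmod z / 2)). lra.
Qed.

Lemma C_eq_minus (x y : C) : (x - y)%C = RtoC 0 -> x = y.
Proof. intros H. replace x with ((x - y) + y)%C by ring. rewrite H. ring. Qed.

Lemma two_PI_Ci_neq_0 : (RtoC (2 * PI) * Ci)%C <> RtoC 0.
Proof.
  assert (P := PI_RGT_0).
  apply Cmult_neq_0; intros E; injection E; lra.
Qed.

Lemma Cmod_two_PI_Ci : Cmod (RtoC (2 * PI) * Ci)%C = 2 * PI.
Proof.
  assert (P := PI_RGT_0).
  rewrite Cmod_mult, Cmod_Ci, Cmod_R, Rabs_pos_eq by lra. ring.
Qed.

(** Goursat's theorem for the map [(s, t) |-> p + s (c + r e^(it))]: the integral
    along the circle of scale [s] does not depend on [s]. *)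
Lemma circle_homotopy (f : C -> C) (p c : C) (r s0 s1 : R) :
  0 <= r -> 0 < s0 -> s0 < s1 ->
  (forall s t, s0 <= s <= s1 -> Cdiff f (p + RtoC s * (c + RtoC r * eix t))%C) ->
  CI (fun t => f (p + RtoC s1 * (c + RtoC r * eix t)) * (RtoC s1 * (RtoC r * (Ci * eix t))))%C 0 (2 * PI)
  = CI (fun t => f (p + RtoC s0 * (c + RtoC r * eix t)) * (RtoC s0 * (RtoC r * (Ci * eix t))))%C 0 (2 * PI).
Proof.
  intros Hr Hs0 Hs1 Df. assert (P := PI_RGT_0).
  assert (Mq : forall t, Cmod (c + RtoC r * eix t) <= Cmod c + r).
  { intros t. eapply Rle_trans; [apply Cmod_triangle|].
    rewrite Cmod_mult, Cmod_eix, Cmod_R, Rabs_pos_eq by lra. lra. }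
  assert (Hc := Cmod_ge_0 c).
  assert (G := goursat_rect (fun s t => p + RtoC s * (c + RtoC r * eix t))%C
    (fun s t => c + RtoC r * eix t)%C (fun s t => RtoC s * (RtoC r * (Ci * eix t)))%C f
    s0 s1 0 (2 * PI) ((1 + s1) * (Cmod c + r)) ltac:(lra) ltac:(lra) ltac:(nra)).
  cbv beta in G. rewrite eix_2PI in G.
  apply C_eq_minus.
  rewrite <- G; [ring| | | | | | |].
  - intros s t.
    assert (A := is_pderiv_plus _ _ s _ _ (is_pderiv_const p s)
      (is_pderiv_mult _ _ s _ _ (RtoC_deriv s) (is_pderiv_const (c + RtoC r * eix t)%C s))).
    eapply is_pderiv_eq; [exact A|cbv beta; ring].
  - intros s t.
    assert (A := is_pderiv_plus _ _ t _ _ (is_pderiv_const p t)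
      (is_pderiv_mult _ _ t _ _ (is_pderiv_const (RtoC s) t)
        (is_pderiv_plus _ _ t _ _ (is_pderiv_const c t)
          (is_pderiv_mult _ _ t _ _ (is_pderiv_const (RtoC r) t) (eix_deriv t))))).
    eapply is_pderiv_eq; [exact A|cbv beta; ring].
  - intros s t. apply cont_at_const.
  - intros s t. repeat (apply cont_at_mult; [apply cont_at_const|]). apply eix_cont.
  - intros s t Hs Ht. eapply Rle_trans; [apply Mq|]. nra.
  - intros s t Hs Ht. rewrite !Cmod_mult, Cmod_eix, Cmod_Ci, !Cmod_R, !Rabs_pos_eq by lra. nra.
  - intros s t Hs Ht. apply Df, Hs.
Qed.

Definition circ (z0 : C) (r t : R) : C := (z0 + RtoC r * eix t)%C.
Definition dcirc (r t : R) : C := (RtoC r * (Ci * eix t))%C.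

Lemma circ_cont (z0 : C) (r t : R) : cont_at dist_R (circ z0 r) t.
Proof.
  apply cont_at_plus; [apply cont_at_const|].
  apply cont_at_mult; [apply cont_at_const|apply eix_cont].
Qed.

Lemma dcirc_cont (r t : R) : cont_at dist_R (dcirc r) t.
Proof. repeat (apply cont_at_mult; [apply cont_at_const|]). apply eix_cont. Qed.

Lemma circ_dist (z0 : C) (r t : R) : 0 <= r -> Cmod (circ z0 r t - z0) = r.
Proof.
  intros Hr. unfold circ. replace (z0 + RtoC r * eix t - z0)%C with (RtoC r * eix t)%C by ring.
  rewrite Cmod_mult, Cmod_eix, Cmod_R, Rabs_pos_eq by lra. ring.
Qed.

Lemma Cmod_dcirc (r t : R) : 0 <= r -> Cmod (dcirc r t) = r.
Proof.
  intros Hr. unfold dcirc. rewrite !Cmod_mult, Cmod_eix, Cmod_Ci, Cmod_R, Rabs_pos_eq by lra. ring.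
Qed.

Lemma circ_far (z0 z : C) (r t : R) : 0 <= r ->
  r - Cmod (z - z0) <= Cmod (circ z0 r t - z).
Proof.
  intros Hr. rewrite <- (circ_dist z0 r t Hr) at 1.
  replace (circ z0 r t - z)%C with ((circ z0 r t - z0) - (z - z0))%C by ring.
  apply Cmod_tri_inv.
Qed.

(** Expanding the circle to infinity shows that the winding number of an
    off-centre point is the one of the centre. *)
Lemma circle_index (z0 z : C) (r : R) : Cmod (z - z0) < r ->
  CI (fun t => dcirc r t * / (circ z0 r t - z))%C 0 (2 * PI) = (RtoC (2 * PI) * Ci)%C.
Proof.
  intros Hz. assert (P := PI_RGT_0).
  assert (Hd := Cmod_ge_0 (z - z0)%C). set (d := Cmod (z - z0)) in *.
  set (h := fun w => ((z - z0) * / ((w - z) * (w - z0)))%C).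
  assert (Hnz : forall s t, r <= s -> (circ z0 s t - z)%C <> RtoC 0).
  { intros s t Hs. apply Cmod_gt_0. assert (A := circ_far z0 z s t ltac:(lra)). fold d in A. lra. }
  assert (Hnz0 : forall s t, r <= s -> (circ z0 s t - z0)%C <> RtoC 0).
  { intros s t Hs. apply Cmod_gt_0. rewrite circ_dist; lra. }
  set (I := fun s => CI (fun t => h (circ z0 s t) * dcirc s t)%C 0 (2 * PI)).
  assert (Hh : forall s t, r <= s -> Cdiff h (circ z0 s t)).
  { intros s t Hs. unfold h. apply Cdiff_mult; [apply Cdiff_const|].
    apply (Cdiff_inv (fun w => (w - z) * (w - z0))%C).
    - apply Cmult_neq_0; [apply Hnz|apply Hnz0]; exact Hs.
    - apply Cdiff_mult; apply Cdiff_minus; (apply Cdiff_id || apply Cdiff_const). }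
  assert (exI : forall s, r <= s -> exCI (fun t => h (circ z0 s t) * dcirc s t)%C 0 (2 * PI)).
  { intros s Hs. apply cont_exCI; [lra|]. intros t _. apply cont_at_mult; [|apply dcirc_cont].
    apply (cont_at_comp dist_R (circ z0 s) h dist_C); [apply Cdiff_cont, Hh, Hs|apply circ_cont]. }
  assert (HI : forall s, r < s -> I s = I r).
  { intros s Hs. unfold I.
    assert (E := circle_homotopy h z0 (RtoC 0) 1 r s ltac:(lra) ltac:(lra) Hs).
    assert (Ec : forall x t, (z0 + RtoC x * (0 + 1 * eix t))%C = circ z0 x t)
      by (intros; unfold circ; ring).
    assert (Ed : forall x t, (RtoC x * (1 * (Ci * eix t)))%C = dcirc x t)
      by (intros; unfold dcirc; ring).
    transitivity (CI (fun t => h (z0 + RtoC s * (0 + 1 * eix t)) * (RtoC s * (1 * (Ci * eix t))))%C 0 (2 * PI)).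
    - apply CI_ext; [lra|]. intros t _. rewrite Ec, Ed. reflexivity.
    - rewrite E.
      + apply CI_ext; [lra|]. intros t _. rewrite Ec, Ed. reflexivity.
      + intros x t Hx. rewrite Ec. apply Hh. lra. }
  assert (I0 : I r = RtoC 0).
  { apply Cmod_small. intros e He.
    set (s := r + d + 1 + 4 * PI * d / e).
    assert (Hq : 0 <= 4 * PI * d / e).
    { apply Rmult_le_pos; [apply Rmult_le_pos; lra|]. left. apply Rinv_0_lt_compat, He. }
    rewrite <- (HI s) by (unfold s; lra).
    eapply Rle_trans; [apply (CI_bound _ _ _ (d / (s - d))); [lra|apply exI; unfold s; lra|]|].
    - intros t _. unfold h. rewrite !Cmod_mult, Cmod_inv, Cmod_mult.
      + rewrite circ_dist, Cmod_dcirc by (unfold s; lra). fold d.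
        assert (A := circ_far z0 z s t ltac:(unfold s; lra)). fold d in A.
        assert (0 < s - d) by (unfold s; lra). assert (0 < s) by (unfold s; lra).
        replace (d * / (Cmod (circ z0 s t - z) * s) * s) with (d * / Cmod (circ z0 s t - z))
          by (field; lra).
        apply Rmult_le_compat_l; [exact Hd|]. apply Rinv_le_contravar; assumption.
      + apply Cmult_neq_0; [apply Hnz|apply Hnz0]; unfold s; lra.
    - assert (0 < s - d) by (unfold s; lra).
      apply (Rmult_le_reg_r (s - d)); [assumption|].
      replace (2 * (d / (s - d) * (2 * PI - 0)) * (s - d)) with (4 * PI * d) by (field; lra).
      apply Rle_trans with (e * (4 * PI * d / e)); [right; field; lra|].
      apply Rmult_le_compat_l; unfold s; lra. }
  transitivity (CI (fun t => h (circ z0 r t) * dcirc r t + Ci * 1)%C 0 (2 * PI)).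
  - apply CI_ext; [lra|]. intros t _. unfold h.
    assert (N1 := Hnz r t ltac:(lra)). assert (N2 := Hnz0 r t ltac:(lra)).
    assert (E : dcirc r t = (Ci * (circ z0 r t - z0))%C) by (unfold circ, dcirc; ring).
    rewrite E. field. split; assumption.
  - rewrite CI_plus.
    + fold (I r). rewrite I0. unfold CI. apply injective_projections; simpl.
      * rewrite RInt_const. unfold scal; simpl; unfold mult; simpl. ring.
      * rewrite RInt_const. unfold scal; simpl; unfold mult; simpl. ring.
    + apply exI; lra.
    + apply cont_exCI; [lra|]. intros; apply cont_at_const.
Qed.

(** [f] is represented by Cauchy's formula inside the circle.  Unlike
    differentiability this passes to uniform limits, and it yields Taylor expansions. *)
Definition cauchy_on (f : C -> C) (z0 : C) (r : R) : Prop :=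
  (forall t, cont_at dist_R (fun t => f (circ z0 r t)) t) /\
  forall z, Cmod (z - z0) < r ->
    CI (fun t => f (circ z0 r t) * (dcirc r t * / (circ z0 r t - z)))%C 0 (2 * PI)
    = (RtoC (2 * PI) * Ci * f z)%C.

Lemma cauchy_kernel_cont (z0 z : C) (r t : R) : Cmod (z - z0) < r ->
  cont_at dist_R (fun t => dcirc r t * / (circ z0 r t - z))%C t.
Proof.
  intros Hz. assert (Hd := Cmod_ge_0 (z - z0)%C).
  apply cont_at_mult; [apply dcirc_cont|].
  apply (cont_at_inv _ (fun t => circ z0 r t - z)%C).
  - apply Cmod_gt_0. assert (A := circ_far z0 z r t ltac:(lra)). lra.
  - apply cont_at_minus; [apply circ_cont|apply cont_at_const].
Qed.

Lemma cauchy_kernel_bound (z0 z : C) (r t : R) : Cmod (z - z0) < r ->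
  Cmod (dcirc r t * / (circ z0 r t - z))%C <= r / (r - Cmod (z - z0)).
Proof.
  intros Hz. assert (Hd := Cmod_ge_0 (z - z0)%C).
  assert (A := circ_far z0 z r t ltac:(lra)).
  rewrite Cmod_mult, Cmod_inv, Cmod_dcirc by (try (apply Cmod_gt_0); lra).
  apply Rmult_le_compat_l; [lra|]. apply Rinv_le_contravar; lra.
Qed.

(** Cauchy's formula: shrink the circle towards the point [z]. *)
Lemma Cdiff_cauchy_on (f : C -> C) (z0 : C) (r : R) : 0 < r ->
  (forall z, Cmod (z - z0) <= r -> Cdiff f z) -> cauchy_on f z0 r.
Proof.
  intros Hr Df. assert (P := PI_RGT_0).
  split.
  { intros t. apply (cont_at_comp dist_R (circ z0 r) f dist_C); [|apply circ_cont].
    apply Cdiff_cont, Df. rewrite circ_dist; lra. }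
  intros z Hz. assert (Hd := Cmod_ge_0 (z - z0)%C).
  set (k := r / (r - Cmod (z - z0))).
  assert (Hk : 0 < k) by (apply Rdiv_lt_0_compat; lra).
  set (q := fun t => (circ z0 r t - z)%C).
  assert (Hq : forall t, q t <> RtoC 0).
  { intros t. apply Cmod_gt_0. assert (A := circ_far z0 z r t ltac:(lra)). unfold q. lra. }
  assert (Hin : forall s t, 0 <= s <= 1 -> Cmod (z + RtoC s * q t - z0) <= r).
  { intros s t Hs.
    replace (z + RtoC s * q t - z0)%C with (RtoC (1 - s) * (z - z0) + RtoC s * (circ z0 r t - z0))%C
      by (unfold q; rewrite RtoC_minus; ring).
    eapply Rle_trans; [apply Cmod_triangle|].
    rewrite !Cmod_mult, !Cmod_R, !Rabs_pos_eq, circ_dist by lra. nra. }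
  set (A := fun s => CI (fun t => f (z + RtoC s * q t) * (dcirc r t * / q t))%C 0 (2 * PI)).
  assert (exA : forall s, 0 <= s <= 1 -> exCI (fun t => f (z + RtoC s * q t) * (dcirc r t * / q t))%C 0 (2 * PI)).
  { intros s Hs. apply cont_exCI; [lra|]. intros t _. apply cont_at_mult.
    - apply (cont_at_comp dist_R (fun t => z + RtoC s * q t)%C f dist_C).
      + apply Cdiff_cont, Df, Hin, Hs.
      + apply (cont_at_plus dist_R (fun _ => z) (fun t => RtoC s * q t)%C); [apply cont_at_const|].
        apply cont_at_mult; [apply cont_at_const|].
        apply cont_at_minus; [apply circ_cont|apply cont_at_const].
    - apply cauchy_kernel_cont, Hz. }
  assert (HA : forall s, 0 < s < 1 -> A 1 = A s).
  { intros s Hs.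
    set (h := fun w => (f w * / (w - z))%C).
    assert (E := circle_homotopy h z (z0 - z)%C r s 1 ltac:(lra) ltac:(lra) ltac:(lra)).
    assert (Eq : forall t, (z0 - z + RtoC r * eix t)%C = q t) by (intros; unfold q, circ; ring).
    assert (Eh : forall x t, 0 < x ->
       (h (z + RtoC x * (z0 - z + RtoC r * eix t)) * (RtoC x * (RtoC r * (Ci * eix t))))%C
       = (f (z + RtoC x * q t) * (dcirc r t * / q t))%C).
    { intros x t Hx. rewrite Eq. unfold h. fold (dcirc r t).
      assert (RtoC x <> RtoC 0) by (intros X; injection X; lra).
      assert (Hqt := Hq t).
      replace (z + RtoC x * q t - z)%C with (RtoC x * q t)%C by ring.
      field. split; assumption. }
    unfold A.
    transitivity (CI (fun t => h (z + 1 * (z0 - z + RtoC r * eix t)) * (1 * (RtoC r * (Ci * eix t))))%C 0 (2 * PI)).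
    { apply CI_ext; [lra|]. intros t _. symmetry. apply Eh. lra. }
    rewrite E.
    - apply CI_ext; [lra|]. intros t _. apply Eh. lra.
    - intros x t Hx. rewrite Eq. unfold h. apply Cdiff_mult.
      + apply Df, Hin. lra.
      + apply (Cdiff_inv (fun w => w - z)%C).
        * replace (z + RtoC x * q t - z)%C with (RtoC x * q t)%C by ring.
          apply Cmult_neq_0; [intros X; injection X; lra|apply Hq].
        * apply Cdiff_minus; [apply Cdiff_id|apply Cdiff_const]. }
  transitivity (A 1).
  { apply CI_ext; [lra|]. intros t _. fold (q t).
    replace (circ z0 r t) with (z + 1 * q t)%C at 1 by (unfold q; ring). reflexivity. }
  apply C_eq_minus, Cmod_small. intros e He.
  set (e1 := e / (4 * PI * k)).
  assert (Hpk : 0 < 4 * PI * k) by (apply Rmult_lt_0_compat; lra).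
  assert (He1 : 0 < e1) by (apply Rdiv_lt_0_compat; lra).
  destruct (Cdiff_cont f z (Df z ltac:(lra)) e1 He1) as [del [Hdel Hc]].
  set (s := Rmin (1 / 2) (del / (4 * r))).
  assert (Hs0 : 0 < s) by (apply Rmin_pos; [lra|apply Rdiv_lt_0_compat; lra]).
  assert (Hs1 : s <= 1 / 2) by apply Rmin_l.
  assert (Hs2 : s * (2 * r) < del).
  { assert (s <= del / (4 * r)) by apply Rmin_r.
    apply Rle_lt_trans with (del / (4 * r) * (2 * r)); [apply Rmult_le_compat_r; lra|].
    replace (del / (4 * r) * (2 * r)) with (del / 2) by (field; lra). lra. }
  rewrite (HA s) by lra.
  rewrite <- (circle_index z0 z r Hz).
  assert (exK : exCI (fun t => dcirc r t * / q t)%C 0 (2 * PI)).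
  { apply cont_exCI; [lra|]. intros t _. apply cauchy_kernel_cont, Hz. }
  fold q. change (CI (fun t => dcirc r t * / (circ z0 r t - z))%C 0 (2 * PI))
    with (CI (fun t => dcirc r t * / q t)%C 0 (2 * PI)).
  rewrite (Cmult_comm (CI (fun t => dcirc r t * / q t)%C 0 (2 * PI)) (f z)).
  rewrite <- (CI_scal (f z) _ 0 (2 * PI) exK).
  unfold A. rewrite <- CI_minus; [|lra|apply exA; lra|apply exCI_scal, exK].
  eapply Rle_trans; [apply (CI_bound _ _ _ (e1 * k)); [lra| |]|].
  - apply exCI_minus; [apply exA; lra|apply exCI_scal, exK].
  - intros t _.
    replace (f (z + RtoC s * q t) * (dcirc r t * / q t) - f z * (dcirc r t * / q t))%C
      with ((f (z + RtoC s * q t) - f z) * (dcirc r t * / q t))%C by ring.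
    rewrite Cmod_mult. apply Rmult_le_compat; try apply Cmod_ge_0.
    + left. apply Hc. unfold dist_C.
      replace (z + RtoC s * q t - z)%C with (RtoC s * q t)%C by ring.
      rewrite Cmod_mult, Cmod_R, Rabs_pos_eq by lra.
      assert (Cmod (q t) <= 2 * r).
      { unfold q. eapply Rle_trans; [apply (Cmod_tri3 _ z0)|].
        rewrite circ_dist, (Cmod_minus_sym z0 z) by lra. lra. }
      eapply Rle_lt_trans; [apply Rmult_le_compat_l; [lra|eassumption]|]. lra.
    + apply cauchy_kernel_bound, Hz.
  - right. unfold e1. field. split; lra.
Qed.

Lemma cauchy_on_limit (f : C -> C) (z0 : C) (r : R) : 0 < r ->
  (forall eps, 0 < eps -> exists g, cauchy_on g z0 r /\
     forall z, Cmod (z - z0) <= r -> Cmod (f z - g z) <= eps) -> cauchy_on f z0 r.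
Proof.
  intros Hr H. assert (P := PI_RGT_0).
  assert (Hc : forall t, cont_at dist_R (fun t => f (circ z0 r t)) t).
  { intros t eps He. destruct (H (eps / 4) ltac:(lra)) as [g [[Hg _] Hfg]].
    destruct (Hg t (eps / 4) ltac:(lra)) as [del [Hd Hdel]].
    exists del. split; [exact Hd|]. intros y Hy. specialize (Hdel y Hy).
    assert (A := Hfg (circ z0 r y) ltac:(rewrite circ_dist; lra)).
    assert (B := Hfg (circ z0 r t) ltac:(rewrite circ_dist; lra)).
    rewrite Cmod_minus_sym in B.
    eapply Rle_lt_trans; [apply (Cmod_tri3 _ (g (circ z0 r y)))|].
    eapply Rle_lt_trans; [apply Rplus_le_compat_l, (Cmod_tri3 _ (g (circ z0 r t)))|]. lra. }
  split; [exact Hc|]. intros z Hz.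
  assert (Hd := Cmod_ge_0 (z - z0)%C).
  set (k := r / (r - Cmod (z - z0))).
  assert (Hk : 0 < k) by (apply Rdiv_lt_0_compat; lra).
  assert (exF : forall h : C -> C, (forall t, cont_at dist_R (fun t => h (circ z0 r t)) t) ->
     exCI (fun t => h (circ z0 r t) * (dcirc r t * / (circ z0 r t - z)))%C 0 (2 * PI)).
  { intros h Hh. apply cont_exCI; [lra|]. intros t _.
    apply cont_at_mult; [apply Hh|apply cauchy_kernel_cont, Hz]. }
  apply C_eq_minus, Cmod_small. intros e He.
  assert (Hs : 0 < 4 * PI * k + 2 * PI) by (assert (0 < PI * k) by (apply Rmult_lt_0_compat; lra); lra).
  destruct (H (e / (4 * PI * k + 2 * PI))) as [g [[Hg1 Hg2] Hfg]]; [apply Rdiv_lt_0_compat; assumption|].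
  set (e1 := e / (4 * PI * k + 2 * PI)) in *.
  match goal with |- Cmod (?lh - ?rh) <= _ =>
    replace (lh - rh)%C with ((lh - CI (fun t => g (circ z0 r t) * (dcirc r t * / (circ z0 r t - z)))%C 0 (2 * PI))
      + (RtoC (2 * PI) * Ci) * (g z - f z))%C by (rewrite (Hg2 z Hz); ring) end.
  eapply Rle_trans; [apply Cmod_triangle|].
  rewrite Cmod_mult, Cmod_two_PI_Ci, <- CI_minus; [|lra|apply exF, Hc|apply exF, Hg1].
  assert (B1 : Cmod (g z - f z) <= e1) by (rewrite Cmod_minus_sym; apply Hfg; lra).
  assert (B2 : Cmod (CI (fun t => f (circ z0 r t) * (dcirc r t * / (circ z0 r t - z)) -
     g (circ z0 r t) * (dcirc r t * / (circ z0 r t - z)))%C 0 (2 * PI)) <= 2 * (e1 * k * (2 * PI - 0))).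
  { apply CI_bound; [lra|apply exCI_minus; apply exF; assumption|].
    intros t _. set (K := (dcirc r t * / (circ z0 r t - z))%C).
    replace (f (circ z0 r t) * K - g (circ z0 r t) * K)%C
      with ((f (circ z0 r t) - g (circ z0 r t)) * K)%C by ring.
    rewrite Cmod_mult. apply Rmult_le_compat; try apply Cmod_ge_0.
    - apply Hfg. rewrite circ_dist; lra.
    - apply cauchy_kernel_bound, Hz. }
  assert (E : 2 * (e1 * k * (2 * PI - 0)) + 2 * PI * e1 = e) by (unfold e1; field; lra).
  assert (2 * PI * Cmod (g z - f z) <= 2 * PI * e1) by (apply Rmult_le_compat_l; lra).
  lra.
Qed.

Fixpoint csum (c : nat -> C) (h : C) (N : nat) : C :=
  match N with O => RtoC 0 | S n => (csum c h n + c n * Cpow h n)%C end.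

Definition tcoef (f : C -> C) (z0 : C) (r : R) (n : nat) : C :=
  (/ (RtoC (2 * PI) * Ci) *
   CI (fun t => f (circ z0 r t) * (dcirc r t * / Cpow (circ z0 r t - z0) (S n))) 0 (2 * PI))%C.

Lemma tcoef_ex (f : C -> C) (z0 : C) (r : R) (n : nat) : 0 < r ->
  (forall t, cont_at dist_R (fun t => f (circ z0 r t)) t) ->
  exCI (fun t => f (circ z0 r t) * (dcirc r t * / Cpow (circ z0 r t - z0) n))%C 0 (2 * PI).
Proof.
  intros Hr Hc. assert (P := PI_RGT_0).
  apply cont_exCI; [lra|]. intros t _. apply cont_at_mult; [apply Hc|].
  apply cont_at_mult; [apply dcirc_cont|].
  apply (cont_at_inv _ (fun t => Cpow (circ z0 r t - z0) n)%C).
  - apply Cpow_nz, Cmod_gt_0. rewrite circ_dist; lra.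
  - induction n as [|n IH]; simpl; [apply cont_at_const|].
    apply cont_at_mult; [|exact IH]. apply cont_at_minus; [apply circ_cont|apply cont_at_const].
Qed.

Lemma tcoef_bound (f : C -> C) (z0 : C) (r M : R) (n : nat) : 0 < r ->
  (forall t, cont_at dist_R (fun t => f (circ z0 r t)) t) ->
  (forall z, Cmod (z - z0) = r -> Cmod (f z) <= M) ->
  Cmod (tcoef f z0 r n) <= 2 * M / r ^ n.
Proof.
  intros Hr Hc HM. assert (P := PI_RGT_0). unfold tcoef.
  rewrite Cmod_mult, Cmod_inv, Cmod_two_PI_Ci by apply two_PI_Ci_neq_0.
  assert (Hp : 0 < r ^ n) by (apply pow_lt; lra).
  assert (B : Cmod (CI (fun t => f (circ z0 r t) * (dcirc r t * / Cpow (circ z0 r t - z0) (S n)))%C 0 (2 * PI))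
     <= 2 * (M / r ^ n * (2 * PI - 0))).
  { apply CI_bound; [lra|apply tcoef_ex; assumption|].
    intros t _. assert (Hz := circ_dist z0 r t ltac:(lra)).
    rewrite !Cmod_mult, Cmod_inv, Cmod_pow, Hz, Cmod_dcirc
      by (try lra; apply Cpow_nz, Cmod_gt_0; lra).
    simpl. replace (r * / (r * r ^ n)) with (/ r ^ n) by (field; lra).
    apply Rmult_le_compat_r; [left; apply Rinv_0_lt_compat, Hp|apply HM, Hz]. }
  apply (Rmult_le_compat_l (/ (2 * PI))) in B; [|left; apply Rinv_0_lt_compat; lra].
  eapply Rle_trans; [exact B|]. right. field. split; lra.
Qed.

(** Geometric expansion of the Cauchy kernel, with remainder. *)
Lemma cauchy_taylor (f : C -> C) (z0 : C) (r M : R) : 0 < r -> cauchy_on f z0 r ->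
  (forall z, Cmod (z - z0) = r -> Cmod (f z) <= M) ->
  forall N z, Cmod (z - z0) < r ->
    Cmod (f z - csum (tcoef f z0 r) (z - z0) N)%C
      <= 2 * M * (Cmod (z - z0) / r) ^ N * (r / (r - Cmod (z - z0))).
Proof.
  intros Hr [Hc HC] HM N z Hz. assert (P := PI_RGT_0).
  set (h := (z - z0)%C) in *.
  assert (Hd := Cmod_ge_0 h).
  assert (N2 := two_PI_Ci_neq_0).
  assert (Hu : forall t, (circ z0 r t - z0)%C <> RtoC 0).
  { intros t. apply Cmod_gt_0. rewrite circ_dist; lra. }
  assert (Hv : forall t, (circ z0 r t - z)%C <> RtoC 0).
  { intros t. apply Cmod_gt_0. assert (A := circ_far z0 z r t ltac:(lra)). fold h in A. lra. }
  set (G := fun n t => (f (circ z0 r t) * (dcirc r t * / Cpow (circ z0 r t - z0) n) *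
     / (circ z0 r t - z))%C).
  assert (exG : forall n, exCI (G n) 0 (2 * PI)).
  { intros n. apply cont_exCI; [lra|]. intros t _. unfold G.
    apply cont_at_mult.
    - apply cont_at_mult; [apply Hc|]. apply cont_at_mult; [apply dcirc_cont|].
      apply (cont_at_inv _ (fun t => Cpow (circ z0 r t - z0) n)%C); [apply Cpow_nz, Hu|].
      induction n as [|n IH]; simpl; [apply cont_at_const|].
      apply cont_at_mult; [|exact IH]. apply cont_at_minus; [apply circ_cont|apply cont_at_const].
    - apply (cont_at_inv _ (fun t => circ z0 r t - z)%C); [apply Hv|].
      apply cont_at_minus; [apply circ_cont|apply cont_at_const]. }
  assert (R : forall n, (RtoC (2 * PI) * Ci * (f z - csum (tcoef f z0 r) h n))%C
     = (Cpow h n * CI (G n) 0 (2 * PI))%C).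
  { intros n. induction n as [|n IH].
    - simpl.
      transitivity (CI (fun t => f (circ z0 r t) * (dcirc r t * / (circ z0 r t - z)))%C 0 (2 * PI)).
      + rewrite (HC z Hz). ring.
      + rewrite Cmult_1_l. apply CI_ext; [lra|]. intros t _. unfold G. simpl.
        field. apply Hv.
    - simpl csum.
      replace (RtoC (2 * PI) * Ci * (f z - (csum (tcoef f z0 r) h n + tcoef f z0 r n * Cpow h n)))%C
        with (RtoC (2 * PI) * Ci * (f z - csum (tcoef f z0 r) h n) -
              Cpow h n * (RtoC (2 * PI) * Ci * tcoef f z0 r n))%C by ring.
      rewrite IH. unfold tcoef.
      assert (E : CI (G n) 0 (2 * PI) =
        (CI (fun t => f (circ z0 r t) * (dcirc r t * / Cpow (circ z0 r t - z0) (S n))) 0 (2 * PI)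
         + h * CI (G (S n)) 0 (2 * PI))%C).
      { rewrite <- (CI_scal h (G (S n)) 0 (2 * PI) (exG (S n))).
        rewrite <- CI_plus; [|apply tcoef_ex; assumption|apply exCI_scal, exG].
        apply CI_ext; [lra|]. intros t _. unfold G. simpl Cpow.
        assert (Hut := Hu t). assert (Hvt := Hv t).
        assert (Hp := Cpow_nz _ n (Hu t)).
        replace h with ((circ z0 r t - z0) - (circ z0 r t - z))%C by (unfold h; ring).
        field. repeat split; assumption. }
      rewrite E. simpl Cpow.
      generalize (CI (fun t => f (circ z0 r t) * (dcirc r t * / ((circ z0 r t - z0) * Cpow (circ z0 r t - z0) n)))%C 0 (2 * PI)).
      generalize (CI (G (S n)) 0 (2 * PI)) (Cpow h n). intros x y u.
      revert N2. generalize (RtoC (2 * PI) * Ci)%C. intros v N2. field. exact N2. }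
  assert (B : Cmod (CI (G N) 0 (2 * PI)) <= 2 * (M * / r ^ N * (r / (r - Cmod h)) * (2 * PI - 0))).
  { apply CI_bound; [lra|apply exG|]. intros t _. unfold G.
    assert (Hp : 0 < r ^ N) by (apply pow_lt; lra).
    assert (Hz' := circ_dist z0 r t ltac:(lra)).
    replace (f (circ z0 r t) * (dcirc r t * / Cpow (circ z0 r t - z0) N) * / (circ z0 r t - z))%C
      with ((f (circ z0 r t) * / Cpow (circ z0 r t - z0) N) * (dcirc r t * / (circ z0 r t - z)))%C by ring.
    rewrite Cmod_mult. apply Rmult_le_compat; try apply Cmod_ge_0.
    - rewrite Cmod_mult, Cmod_inv, Cmod_pow, Hz' by apply Cpow_nz, Hu.
      apply Rmult_le_compat_r; [left; apply Rinv_0_lt_compat, Hp|apply HM, Hz'].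
    - apply cauchy_kernel_bound, Hz. }
  assert (E : Cmod (f z - csum (tcoef f z0 r) h N)%C = Cmod h ^ N * Cmod (CI (G N) 0 (2 * PI)) / (2 * PI)).
  { rewrite <- Cmod_pow, <- Cmod_mult, <- R, Cmod_mult, Cmod_two_PI_Ci. field. lra. }
  rewrite E.
  assert (Hp : 0 < r ^ N) by (apply pow_lt; lra).
  assert (Hh : 0 <= Cmod h ^ N) by (apply pow_le; lra).
  apply Rle_trans with (Cmod h ^ N * (2 * (M * / r ^ N * (r / (r - Cmod h)) * (2 * PI - 0))) / (2 * PI)).
  - apply Rmult_le_compat_r; [left; apply Rinv_0_lt_compat; lra|].
    apply Rmult_le_compat_l; assumption.
  - assert (E2 : (Cmod h / r) ^ N = Cmod h ^ N * / r ^ N).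
    { unfold Rdiv. rewrite Rpow_mult_distr, pow_inv. reflexivity. }
    rewrite E2. right. field. repeat split; lra.
Qed.

(** * Consequences of the Taylor expansion *)

Lemma tcoef_radius (f : C -> C) (z0 : C) (r R : R) (n : nat) : 0 < r -> r <= R ->
  (forall z, Cmod (z - z0) <= R -> Cdiff f z) -> tcoef f z0 r n = tcoef f z0 R n.
Proof.
  intros Hr [HR| ->] Df; [|reflexivity]. assert (P := PI_RGT_0).
  unfold tcoef. f_equal.
  set (h := fun w => (f w * / Cpow (w - z0) (S n))%C).
  assert (E := circle_homotopy h z0 (RtoC 0) 1 r R ltac:(lra) Hr HR).
  assert (Ec : forall x t, (z0 + RtoC x * (0 + 1 * eix t))%C = circ z0 x t)
    by (intros; unfold circ; ring).
  assert (Ed : forall x t, (RtoC x * (1 * (Ci * eix t)))%C = dcirc x t)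
    by (intros; unfold dcirc; ring).
  assert (A : forall x, CI (fun t => f (circ z0 x t) * (dcirc x t * / Cpow (circ z0 x t - z0) (S n)))%C 0 (2 * PI)
    = CI (fun t => h (z0 + RtoC x * (0 + 1 * eix t)) * (RtoC x * (1 * (Ci * eix t))))%C 0 (2 * PI)).
  { intros x. apply CI_ext; [lra|]. intros t _. rewrite Ec, Ed. unfold h.
    generalize (/ Cpow (circ z0 x t - z0) (S n))%C. intros k. ring. }
  rewrite !A. symmetry. apply E. intros s t Hs. rewrite Ec. unfold h.
  apply Cdiff_mult; [apply Df; rewrite circ_dist; lra|].
  apply (Cdiff_inv (fun w => Cpow (w - z0) (S n))).
  - apply Cpow_nz, Cmod_gt_0. rewrite circ_dist; lra.
  - apply (Cdiff_pow (fun w => w - z0)%C). apply Cdiff_minus; [apply Cdiff_id|apply Cdiff_const].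
Qed.

(** The coefficients do not depend on the radius, so they can be estimated on any smaller
    circle on which [f] happens to be small. *)
Lemma taylor (f : C -> C) (z0 : C) (R : R) : 0 < R ->
  (forall z, Cmod (z - z0) <= R -> Cdiff f z) ->
  exists c : nat -> C, forall r M, 0 < r -> r <= R ->
    (forall z, Cmod (z - z0) = r -> Cmod (f z) <= M) ->
    (forall n, Cmod (c n) <= 2 * M / r ^ n) /\
    (forall N z, Cmod (z - z0) < r ->
       Cmod (f z - csum c (z - z0) N)%C
         <= 2 * M * (Cmod (z - z0) / r) ^ N * (r / (r - Cmod (z - z0)))).
Proof.
  intros HR Df. exists (tcoef f z0 R). intros r M Hr HrR HM.
  assert (Hc : cauchy_on f z0 r) by (apply Cdiff_cauchy_on; [exact Hr|]; intros z Hz; apply Df; lra).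
  assert (E : forall n, tcoef f z0 r n = tcoef f z0 R n)
    by (intros; apply tcoef_radius; assumption).
  split.
  - intros n. rewrite <- E. apply tcoef_bound; [exact Hr|apply Hc|exact HM].
  - intros N z Hz. assert (T := cauchy_taylor f z0 r M Hr Hc HM N z Hz).
    assert (Es : csum (tcoef f z0 r) (z - z0) N = csum (tcoef f z0 R) (z - z0) N).
    { clear T. induction N as [|N IH]; simpl; [reflexivity|]. rewrite IH, E. reflexivity. }
    rewrite <- Es. exact T.
Qed.

Lemma taylor_half (f : C -> C) (z0 : C) (R M : R) : 0 < R ->
  (forall z, Cmod (z - z0) <= R -> Cdiff f z) ->
  (forall z, Cmod (z - z0) = R -> Cmod (f z) <= M) ->
  exists c : nat -> C,
    (forall r m, 0 < r -> r <= R ->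
       (forall z, Cmod (z - z0) = r -> Cmod (f z) <= m) -> forall n, Cmod (c n) <= 2 * m / r ^ n) /\
    (forall N z, Cmod (z - z0) <= R / 2 ->
       Cmod (f z - csum c (z - z0) N)%C <= 4 * M * (Cmod (z - z0) / R) ^ N).
Proof.
  intros HR Df HM. destruct (taylor f z0 R HR Df) as [c Hc]. exists c. split.
  - intros r m Hr HrR Hm. apply (Hc r m); assumption.
  - intros N z Hz. destruct (Hc R M HR ltac:(lra) HM) as [B T].
    eapply Rle_trans; [apply T; lra|].
    assert (Hd := Cmod_ge_0 (z - z0)%C).
    assert (HM0 : 0 <= M).
    { eapply Rle_trans; [|apply (HM (z0 + RtoC R)%C)]; [apply Cmod_ge_0|].
      replace (z0 + RtoC R - z0)%C with (RtoC R) by ring. rewrite Cmod_R, Rabs_pos_eq; lra. }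
    assert (0 <= (Cmod (z - z0) / R) ^ N).
    { apply pow_le. apply Rmult_le_pos; [exact Hd|]. left. apply Rinv_0_lt_compat, HR. }
    replace (4 * M * (Cmod (z - z0) / R) ^ N) with (2 * M * (Cmod (z - z0) / R) ^ N * 2) by ring.
    apply Rmult_le_compat_l; [apply Rmult_le_pos; [lra|assumption]|].
    apply (Rmult_le_reg_r (R - Cmod (z - z0))); [lra|].
    replace (R / (R - Cmod (z - z0)) * (R - Cmod (z - z0))) with R by (field; lra). lra.
Qed.

Lemma csum_0 (c : nat -> C) (N : nat) : csum c (RtoC 0) (S N) = c O.
Proof.
  induction N as [|N IH].
  - simpl. ring.
  - change (csum c (RtoC 0) (S N) + c (S N) * Cpow (RtoC 0) (S N) = c O)%C.
    rewrite IH. simpl. ring.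
Qed.

(** The maximum principle up to a constant: the Taylor remainder of order zero. *)
Lemma disc_bound (f : C -> C) (z0 : C) (R M : R) : 0 < R ->
  (forall z, Cmod (z - z0) <= R -> Cdiff f z) ->
  (forall z, Cmod (z - z0) = R -> Cmod (f z) <= M) ->
  forall z, Cmod (z - z0) <= R / 2 -> Cmod (f z) <= 4 * M.
Proof.
  intros HR Df HM z Hz. destruct (taylor_half f z0 R M HR Df HM) as [c [_ T]].
  specialize (T O z Hz). simpl in T.
  replace (f z - 0)%C with (f z) in T by ring. lra.
Qed.

Lemma disc_lipschitz (f : C -> C) (z0 : C) (R M : R) : 0 < R ->
  (forall z, Cmod (z - z0) <= R -> Cdiff f z) ->
  (forall z, Cmod (z - z0) = R -> Cmod (f z) <= M) ->
  forall z, Cmod (z - z0) <= R / 2 -> Cmod (f z - f z0) <= 4 * M / R * Cmod (z - z0).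
Proof.
  intros HR Df HM z Hz. destruct (taylor_half f z0 R M HR Df HM) as [c [_ T]].
  assert (T0 := T 1%nat z0). specialize (T 1%nat z Hz).
  assert (E0 : f z0 = c O).
  { apply C_eq_minus. apply Cmod_eq_0. apply Rle_antisym; [|apply Cmod_ge_0].
    replace (z0 - z0)%C with (RtoC 0) in T0 by ring. rewrite Cmod_0, csum_0 in T0.
    eapply Rle_trans; [apply T0; lra|]. simpl. right. field. lra. }
  simpl in T. replace (f z - f z0)%C with (f z - (0 + c O * 1))%C by (rewrite E0; ring).
  eapply Rle_trans; [exact T|]. right. field. lra.
Qed.

Lemma cauchy_on_Cdiff (f : C -> C) (z0 : C) (r M : R) : 0 < r -> cauchy_on f z0 r ->
  (forall z, Cmod (z - z0) = r -> Cmod (f z) <= M) -> Cdiff f z0.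
Proof.
  intros Hr Hc HM. assert (T := cauchy_taylor f z0 r M Hr Hc HM).
  set (c := tcoef f z0 r) in *.
  assert (HM0 : 0 <= M).
  { eapply Rle_trans; [|apply (HM (z0 + RtoC r)%C)]; [apply Cmod_ge_0|].
    replace (z0 + RtoC r - z0)%C with (RtoC r) by ring. rewrite Cmod_R, Rabs_pos_eq; lra. }
  assert (E0 : f z0 = c O).
  { apply C_eq_minus. apply Cmod_eq_0. apply Rle_antisym; [|apply Cmod_ge_0].
    assert (T0 := T 1%nat z0). replace (z0 - z0)%C with (RtoC 0) in T0 by ring.
    rewrite Cmod_0, csum_0 in T0. eapply Rle_trans; [apply T0; lra|]. right. simpl. field. lra. }
  apply (eps_Cdiff f z0 (c 1%nat)). intros eps He.
  set (K := 4 * M / (r * r)).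
  assert (HK : 0 <= K).
  { apply Rmult_le_pos; [lra|]. left. apply Rinv_0_lt_compat. nra. }
  exists (Rmin (r / 2) (eps / (K + 1))).
  split; [apply Rmin_pos; [lra|apply Rdiv_lt_0_compat; lra]|].
  intros w Hw. set (h := (w - z0)%C) in *. assert (Hh := Cmod_ge_0 h).
  assert (H1 : Cmod h < r / 2) by (eapply Rlt_le_trans; [exact Hw|apply Rmin_l]).
  assert (H2 : Cmod h < eps / (K + 1)) by (eapply Rlt_le_trans; [exact Hw|apply Rmin_r]).
  specialize (T 2%nat w ltac:(fold h; lra)). fold h in T. simpl csum in T.
  replace (f w - (f z0 + c 1%nat * h))%C with (f w - (0 + c O * 1 + c 1%nat * (h * 1)))%C
    by (rewrite E0; ring).
  eapply Rle_trans; [exact T|].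
  assert (Hg : r / (r - Cmod h) <= 2).
  { apply (Rmult_le_reg_r (r - Cmod h)); [lra|].
    replace (r / (r - Cmod h) * (r - Cmod h)) with r by (field; lra). lra. }
  assert (Hp : 0 <= 2 * M * (Cmod h / r) ^ 2).
  { apply Rmult_le_pos; [lra|]. apply pow2_ge_0. }
  apply Rle_trans with (2 * M * (Cmod h / r) ^ 2 * 2); [apply Rmult_le_compat_l; assumption|].
  replace (2 * M * (Cmod h / r) ^ 2 * 2) with (K * Cmod h * Cmod h) by (unfold K; field; lra).
  apply Rmult_le_compat_r; [exact Hh|].
  apply Rle_trans with ((K + 1) * Cmod h); [nra|].
  apply Rle_trans with ((K + 1) * (eps / (K + 1))); [apply Rmult_le_compat_l; lra|].
  right. field. lra.
Qed.

Lemma circle_bounded (f : C -> C) (z0 : C) (r : R) : 0 < r ->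
  (forall z, Cmod (z - z0) <= r -> Cdiff f z) ->
  exists M, forall z, Cmod (z - z0) = r -> Cmod (f z) <= M.
Proof.
  intros Hr Df. assert (P := PI_RGT_0).
  destruct (continuity_ab_maj (fun t => Cmod (f (circ z0 r t))) (- PI) PI ltac:(lra)) as [x [Hx _]].
  - intros t _ eps He.
    assert (Hc : cont_at dist_R (fun t => f (circ z0 r t)) t).
    { apply (cont_at_comp dist_R (circ z0 r) f dist_C); [|apply circ_cont].
      apply Cdiff_cont, Df. rewrite circ_dist; lra. }
    destruct (Hc eps He) as [d [Hd Hs]]. exists d. split; [exact Hd|].
    intros y [_ Hy]. specialize (Hs y Hy).
    simpl. unfold Rdist. eapply Rle_lt_trans; [|exact Hs].
    apply Rabs_le. assert (A := Cmod_tri_inv (f (circ z0 r y)) (f (circ z0 r t))).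
    assert (B := Cmod_tri_inv (f (circ z0 r t)) (f (circ z0 r y))).
    rewrite Cmod_minus_sym in B. lra.
  - exists (Cmod (f (circ z0 r x))). intros z Hz.
    assert (E : exists t, - PI <= t <= PI /\ z = circ z0 r t).
    { set (p := (z - z0)%C) in *.
      assert (Ep : z = (z0 + p)%C) by (unfold p; ring). clearbody p. destruct p as [p1 p2].
      set (u := p1 / r). set (v := p2 / r).
      assert (Hp2 : p1 * p1 + p2 * p2 = r * r).
      { rewrite <- Hz. unfold Cmod. simpl fst. simpl snd. rewrite sqrt_sqrt; [ring|nra]. }
      assert (Huv : u * u + v * v = 1).
      { unfold u, v. replace (p1 / r * (p1 / r) + p2 / r * (p2 / r))
          with ((p1 * p1 + p2 * p2) / (r * r)) by (field; lra).
        rewrite Hp2. field. lra. }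
      assert (Hu : -1 <= u <= 1) by nra.
      assert (Hs : sin (acos u) = Rabs v).
      { rewrite sin_acos by exact Hu. replace (1 - u²) with (v²) by (unfold Rsqr; lra).
        apply sqrt_Rsqr_abs. }
      assert (Hz' : z = (z0 + RtoC r * (u, v))%C).
      { rewrite Ep. f_equal.
        apply injective_projections; simpl; unfold u, v; field; lra. }
      assert (Hb := acos_bound u).
      destruct (Rle_dec 0 v) as [Hv|Hv].
      - exists (acos u). split; [lra|]. rewrite Hz'. unfold circ, eix.
        rewrite cos_acos, Hs, Rabs_pos_eq by assumption. reflexivity.
      - exists (- acos u). split; [lra|]. rewrite Hz'. unfold circ, eix.
        rewrite cos_neg, sin_neg, cos_acos, Hs, Rabs_left, Ropp_involutive by lra. reflexivity. }
    destruct E as [t [Ht ->]]. apply Hx, Ht.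
Qed.

(** A zero can be divided out: the quotient is differentiable at the zero because
    of the second-order Taylor expansion. *)
Lemma divide_zero (G : C -> C) (z0 : C) (r : R) : 0 < r ->
  (forall z, Cmod (z - z0) <= r -> Cdiff G z) -> G z0 = RtoC 0 ->
  exists G1, (forall z, G z = ((z - z0) * G1 z)%C) /\
    forall z, Cmod (z - z0) <= r -> Cdiff G1 z.
Proof.
  intros Hr DG G0.
  destruct (circle_bounded G z0 r Hr DG) as [M HM].
  destruct (taylor_half G z0 r M Hr DG HM) as [c [_ T]].
  set (G1 := fun z => if excluded_middle_informative (z = z0) then c 1%nat
     else (G z * / (z - z0))%C).
  assert (Hnz : forall z, z <> z0 -> (z - z0)%C <> RtoC 0).
  { intros z H E. apply H, C_eq_minus, E. }
  assert (E1 : forall z, G z = ((z - z0) * G1 z)%C).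
  { intros z. unfold G1. destruct (excluded_middle_informative (z = z0)) as [->|N].
    - rewrite G0. ring.
    - field. apply Hnz, N. }
  exists G1. split; [exact E1|]. intros z Hz.
  destruct (excluded_middle_informative (z = z0)) as [->|N].
  - assert (E0 : c O = RtoC 0).
    { apply Cmod_eq_0. apply Rle_antisym; [|apply Cmod_ge_0].
      assert (T0 := T 1%nat z0). replace (z0 - z0)%C with (RtoC 0) in T0 by ring.
      rewrite Cmod_0, csum_0, G0 in T0.
      replace (0 - c O)%C with (- c O)%C in T0 by ring. rewrite Cmod_opp in T0.
      eapply Rle_trans; [apply T0; lra|]. right. simpl. field. lra. }
    assert (HM0 : 0 <= M).
    { eapply Rle_trans; [|apply (HM (z0 + RtoC r)%C)]; [apply Cmod_ge_0|].
      replace (z0 + RtoC r - z0)%C with (RtoC r) by ring. rewrite Cmod_R, Rabs_pos_eq; lra. }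
    apply (eps_Cdiff G1 z0 (c 2%nat)). intros eps He.
    set (K := 4 * M / (r * r * r)).
    assert (HK : 0 <= K).
    { apply Rmult_le_pos; [lra|]. left. apply Rinv_0_lt_compat.
      apply Rmult_lt_0_compat; [nra|exact Hr]. }
    exists (Rmin (r / 2) (eps / (K + 1))).
    split; [apply Rmin_pos; [lra|apply Rdiv_lt_0_compat; lra]|].
    intros w Hw.
    assert (EG : G1 z0 = c 1%nat).
    { unfold G1. destruct (excluded_middle_informative (z0 = z0)); [reflexivity|congruence]. }
    destruct (excluded_middle_informative (w = z0)) as [->|Nw].
    { rewrite EG. replace (c 1%nat - (c 1%nat + c 2%nat * (z0 - z0)))%C with (RtoC 0) by ring.
      rewrite Cmod_0. apply Rmult_le_pos; [lra|apply Cmod_ge_0]. }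
    assert (Hh := proj1 (Cmod_gt_0 _) (Hnz w Nw)).
    assert (Hh' := Hnz w Nw).
    assert (H1 : Cmod (w - z0) < r / 2) by (eapply Rlt_le_trans; [exact Hw|apply Rmin_l]).
    assert (H2 : Cmod (w - z0) < eps / (K + 1)) by (eapply Rlt_le_trans; [exact Hw|apply Rmin_r]).
    specialize (T 3%nat w ltac:(lra)). simpl csum in T. rewrite E0, E1 in T.
    rewrite EG. set (h := (w - z0)%C) in *.
    replace (h * G1 w - (0 + 0 * 1 + c 1%nat * (h * 1) + c 2%nat * (h * (h * 1))))%C
      with (h * (G1 w - (c 1%nat + c 2%nat * h)))%C in T by ring.
    rewrite Cmod_mult in T.
    apply (Rmult_le_reg_l (Cmod h)); [exact Hh|].
    eapply Rle_trans; [exact T|].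
    replace (4 * M * (Cmod h / r) ^ 3) with (Cmod h * (K * Cmod h * Cmod h)) by (unfold K; field; lra).
    apply Rmult_le_compat_l; [lra|]. apply Rmult_le_compat_r; [lra|].
    apply Rle_trans with ((K + 1) * Cmod h); [nra|].
    apply Rle_trans with ((K + 1) * (eps / (K + 1))); [apply Rmult_le_compat_l; lra|].
    right. field. lra.
  - assert (Hd := proj1 (Cmod_gt_0 _) (Hnz z N)).
    apply (Cdiff_local (fun w => G w * / (w - z0))%C G1 z (Cmod (z - z0))); [exact Hd| |].
    + intros w Hw. unfold G1.
      destruct (excluded_middle_informative (w = z0)) as [->|_]; [|reflexivity].
      rewrite Cmod_minus_sym in Hw. lra.
    + apply Cdiff_mult; [apply DG, Hz|].
      apply (Cdiff_inv (fun w => w - z0)%C); [apply Hnz, N|].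
      apply Cdiff_minus; [apply Cdiff_id|apply Cdiff_const].
Qed.

(** * Propagation of smallness *)

Fixpoint rsum (b : nat -> R) (N : nat) : R :=
  match N with O => 0 | S n => rsum b n + b n end.

Lemma rsum_ge0 (b : nat -> R) (N : nat) : (forall n, 0 <= b n) -> 0 <= rsum b N.
Proof. intros H. induction N as [|N IH]; simpl; [lra|]. specialize (H N). lra. Qed.

Lemma rsum_scal (a : R) (b : nat -> R) (N : nat) : rsum (fun n => a * b n) N = a * rsum b N.
Proof. induction N as [|N IH]; simpl; [ring|]. rewrite IH. ring. Qed.

Lemma csum_bound (c : nat -> C) (b : nat -> R) (h : C) (N : nat) :
  (forall n, (n < N)%nat -> Cmod (c n) * Cmod h ^ n <= b n) -> Cmod (csum c h N) <= rsum b N.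
Proof.
  induction N as [|N IH]; intros H; simpl.
  - rewrite Cmod_0. lra.
  - eapply Rle_trans; [apply Cmod_triangle|]. rewrite Cmod_mult, Cmod_pow.
    apply Rplus_le_compat; [apply IH; intros; apply H; lia|apply H; lia].
Qed.

Lemma pow_half_small (M eps : R) : 0 <= M -> 0 < eps -> exists N, M * (/ 2) ^ N <= eps.
Proof.
  intros HM He.
  destruct (pow_lt_1_zero (/ 2) ltac:(rewrite Rabs_pos_eq; lra) (eps / (M + 1))) as [N HN];
    [apply Rdiv_lt_0_compat; lra|].
  exists N. specialize (HN N (le_n N)). rewrite Rabs_pos_eq in HN by (apply pow_le; lra).
  apply Rle_trans with ((M + 1) * (eps / (M + 1))); [|right; field; lra].
  assert (0 <= (/ 2) ^ N) by (apply pow_le; lra). nra.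
Qed.

(** Small on a small disc and bounded on a large one imply small in between: the
    low Taylor coefficients are small and the tail is geometric. *)
Lemma two_constants (M R r eps : R) : 0 <= M -> 0 < r -> r <= R -> 0 < eps ->
  exists eta, 0 < eta /\ forall (f : C -> C) (z0 : C),
    (forall z, Cmod (z - z0) <= R -> Cdiff f z /\ Cmod (f z) <= M) ->
    (forall z, Cmod (z - z0) <= r -> Cmod (f z) <= eta) ->
    forall z, Cmod (z - z0) <= R / 2 -> Cmod (f z) <= eps.
Proof.
  intros HM Hr HrR He.
  destruct (pow_half_small (4 * M) (eps / 2) ltac:(lra) ltac:(lra)) as [N HN].
  set (b := fun n => 2 / r ^ n * (R / 2) ^ n).
  assert (Hb : forall n, 0 <= b n).
  { intros n. assert (0 < r ^ n) by (apply pow_lt; lra).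
    apply Rmult_le_pos; [|apply pow_le; lra]. apply Rmult_le_pos; [lra|].
    left; apply Rinv_0_lt_compat; lra. }
  assert (Hs := rsum_ge0 b N Hb).
  exists (eps / (2 * (rsum b N + 1))). split; [apply Rdiv_lt_0_compat; lra|].
  set (eta := eps / (2 * (rsum b N + 1))).
  intros f z0 Hf Hsm z Hz.
  destruct (taylor_half f z0 R M ltac:(lra)) as [c [B T]];
    [intros; apply Hf; lra|intros; apply Hf; lra|].
  assert (Hd := Cmod_ge_0 (z - z0)%C).
  assert (B' := B r eta Hr HrR ltac:(intros; apply Hsm; lra)).
  assert (S1 : Cmod (csum c (z - z0) N) <= eta * rsum b N).
  { rewrite <- rsum_scal. apply csum_bound. intros n _.
    assert (0 < r ^ n) by (apply pow_lt; lra).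
    apply Rle_trans with (2 * eta / r ^ n * (R / 2) ^ n); [|unfold b; right; field; lra].
    apply Rmult_le_compat; [apply Cmod_ge_0|apply pow_le; lra|apply B'|].
    apply pow_incr. lra. }
  assert (S2 : Cmod (f z - csum c (z - z0) N)%C <= eps / 2).
  { eapply Rle_trans; [apply T, Hz|]. eapply Rle_trans; [|exact HN].
    apply Rmult_le_compat_l; [lra|]. apply pow_incr. split.
    - apply Rmult_le_pos; [exact Hd|]. left. apply Rinv_0_lt_compat. lra.
    - apply (Rmult_le_reg_r R); [lra|].
      replace (Cmod (z - z0) / R * R) with (Cmod (z - z0)) by (field; lra). lra. }
  replace (f z) with ((f z - csum c (z - z0) N) + csum c (z - z0) N)%C by ring.
  eapply Rle_trans; [apply Cmod_triangle|].
  assert (eta * rsum b N <= eps / 2).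
  { apply Rle_trans with (eta * (rsum b N + 1)).
    - apply Rmult_le_compat_l; [|lra]. left. apply Rdiv_lt_0_compat; lra.
    - right. unfold eta. field. lra. }
  lra.
Qed.

Lemma Cmod_Im (z : C) : Rabs (Im z) <= Cmod z.
Proof. eapply Rle_trans; [|apply Rmax_Cmod]. apply Rmax_r. Qed.

Lemma Cmod_Re (z : C) : Rabs (Re z) <= Cmod z.
Proof. eapply Rle_trans; [|apply Rmax_Cmod]. apply Rmax_l. Qed.

Definition rstrip (a b : R) (z : C) : Prop := a < Im z < b.

Lemma rstrip_disc (a b r : R) (z w : C) : rstrip a b z -> Cmod (w - z) <= r ->
  rstrip (a - r) (b + r) w.
Proof.
  intros [H1 H2] Hw. assert (A := Cmod_Im (w - z)%C).
  assert (B : Rabs (Im w - Im z) <= r) by (eapply Rle_trans; [exact A|exact Hw]).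
  apply Rabs_le_between in B. unfold rstrip. lra.
Qed.

(** Chaining discs along a segment gives the same in a strip, with constants
    that do not depend on the function. *)
Lemma propagation (a b R M r D eps : R) : 0 <= M -> 0 < R -> 0 < r -> 0 < eps ->
  exists eta, 0 < eta /\ forall (f : C -> C),
    (forall z, rstrip (a - R) (b + R) z -> Cdiff f z /\ Cmod (f z) <= M) ->
    forall z1, rstrip a b z1 ->
    (forall z, Cmod (z - z1) <= r -> Cmod (f z) <= eta) ->
    forall z, rstrip a b z -> Cmod (z - z1) <= D -> Cmod (f z) <= eps.
Proof.
  intros HM HR Hr He.
  assert (K : forall k e, 0 < e -> exists eta, 0 < eta /\ forall (f : C -> C),
    (forall z, rstrip (a - R) (b + R) z -> Cdiff f z /\ Cmod (f z) <= M) ->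
    forall z1, rstrip a b z1 ->
    (forall z, Cmod (z - z1) <= r -> Cmod (f z) <= eta) ->
    forall z', rstrip a b z' -> Cmod (z' - z1) <= INR k * (R / 4) ->
    forall z, Cmod (z - z') <= R / 4 -> Cmod (f z) <= e).
  { induction k as [|k IH]; intros e He'.
    - destruct (two_constants M R (Rmin r R) e HM) as [eta [He1 Hw]];
        [apply Rmin_pos; lra|apply Rmin_r|exact He'|].
      exists eta. split; [exact He1|]. intros f Hf z1 Hz1 Hsm z' Hz' Hd z Hz.
      simpl in Hd. rewrite Rmult_0_l in Hd.
      assert (E : z' = z1).
      { apply C_eq_minus, Cmod_eq_0, Rle_antisym; [exact Hd|apply Cmod_ge_0]. }
      subst z'. apply (Hw f z1); [| |lra].
      + intros w Hww. apply Hf. apply (rstrip_disc a b R z1); assumption.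
      + intros w Hww. apply Hsm. eapply Rle_trans; [exact Hww|apply Rmin_l].
    - destruct (two_constants M R (R / 4) e HM) as [e1 [He1 Hw]]; try lra.
      destruct (IH e1 He1) as [eta [Heta Hk]].
      exists eta. split; [exact Heta|]. intros f Hf z1 Hz1 Hsm z' Hz' Hd z Hz.
      rewrite S_INR in Hd. set (x := INR k) in *.
      assert (Hx : 0 <= x) by apply pos_INR.
      set (z2 := (z1 + RtoC (x / (x + 1)) * (z' - z1))%C).
      assert (Hx1 : 0 <= x / (x + 1)) by (apply Rmult_le_pos; [lra|left; apply Rinv_0_lt_compat; lra]).
      assert (Hx2 : 1 - x / (x + 1) = / (x + 1)) by (field; lra).
      assert (Hx3 : 0 < / (x + 1)) by (apply Rinv_0_lt_compat; lra).
      assert (I2 : Im z2 = Im z1 + x / (x + 1) * (Im z' - Im z1)) by (unfold z2, Im; simpl; ring).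
      assert (S2 : rstrip a b z2).
      { destruct Hz1 as [A1 A2]. destruct Hz' as [B1 B2]. unfold rstrip. rewrite I2. nra. }
      assert (D2 : Cmod (z2 - z1) <= x * (R / 4)).
      { replace (z2 - z1)%C with (RtoC (x / (x + 1)) * (z' - z1))%C by (unfold z2; ring).
        rewrite Cmod_mult, Cmod_R, Rabs_pos_eq by exact Hx1.
        apply Rle_trans with (x / (x + 1) * ((x + 1) * (R / 4))); [apply Rmult_le_compat_l; lra|].
        right. field. lra. }
      assert (D3 : Cmod (z' - z2) <= R / 4).
      { replace (z' - z2)%C with (RtoC (1 - x / (x + 1)) * (z' - z1))%C
          by (unfold z2; rewrite RtoC_minus; ring).
        rewrite Cmod_mult, Cmod_R, Hx2, Rabs_pos_eq by lra.
        apply Rle_trans with (/ (x + 1) * ((x + 1) * (R / 4))); [apply Rmult_le_compat_l; lra|].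
        right. field. lra. }
      apply (Hw f z2).
      + intros w Hww. apply Hf. apply (rstrip_disc a b R z2); assumption.
      + apply (Hk f Hf z1 Hz1 Hsm z2 S2 D2).
      + eapply Rle_trans; [apply (Cmod_tri3 _ z')|]. lra. }
  destruct (INR_unbounded (D / (R / 4))) as [k Hk].
  destruct (K k eps He) as [eta [Heta H]]. exists eta. split; [exact Heta|].
  intros f Hf z1 Hz1 Hsm z Hz Hd. apply (H f Hf z1 Hz1 Hsm z Hz).
  - apply Rle_trans with (D / (R / 4) * (R / 4)); [|apply Rmult_le_compat_r; lra].
    eapply Rle_trans; [exact Hd|]. right. field. lra.
  - rewrite Cmod_diag. lra.
Qed.

(** * Minimum modulus on circles *)

(** If the coefficients below [N] are small, the [N]-th term dominates on a suitable
    circle; otherwise recurse on [N]. *)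
Lemma min_modulus_coef (M R : R) : 0 <= M -> 0 < R -> forall N r0 eta, 0 < r0 -> 0 < eta ->
  exists m, 0 < m /\ forall (f : C -> C) (z0 : C) (c : nat -> C),
    (forall K z, Cmod (z - z0) <= R / 2 ->
       Cmod (f z - csum c (z - z0) K)%C <= 4 * M * (Cmod (z - z0) / R) ^ K) ->
    (exists n, (n <= N)%nat /\ eta <= Cmod (c n)) ->
    exists rho, 0 < rho /\ rho <= r0 /\ forall z, Cmod (z - z0) = rho -> m <= Cmod (f z).
Proof.
  intros HM HR N. induction N as [N IH] using Wf_nat.lt_wf_ind. intros r0 eta Hr0 Heta.
  assert (HRN : 0 < R ^ S N) by (apply pow_lt; lra).
  set (rho := Rmin (Rmin r0 (R / 2)) (eta * R ^ S N / (16 * M + 1))).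
  assert (Hrho : 0 < rho).
  { repeat apply Rmin_pos; try lra. apply Rdiv_lt_0_compat; [nra|lra]. }
  assert (Hrho1 : rho <= r0) by (Rmin_le).
  assert (Hrho2 : rho <= R / 2) by (Rmin_le).
  assert (Hrho3 : rho <= eta * R ^ S N / (16 * M + 1)) by apply Rmin_r.
  assert (HrN : 0 < rho ^ N) by (apply pow_lt; exact Hrho).
  set (kap := eta * rho ^ N / 4).
  assert (Hkap : 0 < kap) by (unfold kap; nra).
  assert (Htail : 4 * M * (rho / R) ^ S N <= kap).
  { assert (E : 4 * M * (rho / R) ^ S N = 4 * M * rho / R ^ S N * rho ^ N).
    { unfold Rdiv. rewrite Rpow_mult_distr, pow_inv. simpl. ring. }
    rewrite E. unfold kap.
    replace (eta * rho ^ N / 4) with (eta / 4 * rho ^ N) by field.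
    apply Rmult_le_compat_r; [lra|].
    apply (Rmult_le_reg_r (R ^ S N)); [exact HRN|].
    replace (4 * M * rho / R ^ S N * R ^ S N) with (4 * M * rho) by (field; lra).
    assert ((16 * M + 1) * rho <= eta * R ^ S N).
    { apply Rle_trans with ((16 * M + 1) * (eta * R ^ S N / (16 * M + 1)));
        [apply Rmult_le_compat_l; lra|right; field; lra]. }
    lra. }
  set (S0 := rsum (fun n => rho ^ n) N).
  assert (HS0 : 0 <= S0) by (apply rsum_ge0; intros; apply pow_le; lra).
  set (eta' := Rmin eta (kap / (S0 + 1))).
  assert (Heta' : 0 < eta') by (apply Rmin_pos; [lra|apply Rdiv_lt_0_compat; lra]).
  assert (Hlow : eta' * S0 <= kap).
  { apply Rle_trans with (kap / (S0 + 1) * (S0 + 1)); [|right; field; lra].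
    apply Rmult_le_compat; try lra. apply Rmin_r. }
  assert (Dom : forall (f : C -> C) (z0 : C) (c : nat -> C),
    (forall K z, Cmod (z - z0) <= R / 2 ->
       Cmod (f z - csum c (z - z0) K)%C <= 4 * M * (Cmod (z - z0) / R) ^ K) ->
    (forall n, (n < N)%nat -> Cmod (c n) <= eta') -> eta <= Cmod (c N) ->
    forall z, Cmod (z - z0) = rho -> 2 * kap <= Cmod (f z)).
  { intros f z0 c T Hc HcN z Hz. specialize (T (S N) z ltac:(lra)). rewrite Hz in T.
    simpl csum in T.
    assert (B : Cmod (csum c (z - z0) N) <= eta' * S0).
    { unfold S0. rewrite <- rsum_scal. apply csum_bound. intros n Hn. rewrite Hz.
      apply Rmult_le_compat_r; [apply pow_le; lra|apply Hc, Hn]. }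
    assert (A : Cmod (c N * Cpow (z - z0) N)%C <= Cmod (f z) + Cmod (csum c (z - z0) N)
       + Cmod (f z - (csum c (z - z0) N + c N * Cpow (z - z0) N))%C).
    { replace (c N * Cpow (z - z0) N)%C with
        ((f z - csum c (z - z0) N) - (f z - (csum c (z - z0) N + c N * Cpow (z - z0) N)))%C at 1 by ring.
      eapply Rle_trans; [apply Cmod_minus_le|]. apply Rplus_le_compat_r, Cmod_minus_le. }
    rewrite Cmod_mult, Cmod_pow, Hz in A.
    assert (eta * rho ^ N <= Cmod (c N) * rho ^ N) by (apply Rmult_le_compat_r; lra).
    unfold kap in *. lra. }
  destruct N as [|N].
  - exists (2 * kap). split; [lra|]. intros f z0 c T [n [Hn Hc]].
    exists rho. split; [exact Hrho|]. split; [exact Hrho1|].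
    apply (Dom f z0 c T); [intros; lia|]. replace 0%nat with n by lia. exact Hc.
  - destruct (IH N ltac:(lia) r0 eta' Hr0 Heta') as [m [Hm Hrec]].
    exists (Rmin m (2 * kap)). split; [apply Rmin_pos; lra|].
    intros f z0 c T [n [Hn Hc]].
    destruct (classic (exists k, (k <= N)%nat /\ eta' <= Cmod (c k))) as [Y|No].
    + destruct (Hrec f z0 c T Y) as [rho' [P1 [P2 P3]]].
      exists rho'. split; [exact P1|]. split; [exact P2|]. intros z Hz.
      eapply Rle_trans; [apply Rmin_l|apply P3, Hz].
    + exists rho. split; [exact Hrho|]. split; [exact Hrho1|]. intros z Hz.
      eapply Rle_trans; [apply Rmin_r|].
      assert (Hlt : forall k, (k < S N)%nat -> Cmod (c k) <= eta').
      { intros k Hk. apply Rnot_lt_le. intros L. apply No. exists k. split; [lia|lra]. }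
      apply (Dom f z0 c T Hlt); [|exact Hz].
      destruct (Nat.eq_dec n (S N)) as [->|Hne]; [exact Hc|].
      exfalso. apply No. exists n. split; [lia|].
      eapply Rle_trans; [apply Rmin_l|exact Hc].
Qed.

(** If [f] is not small near [z0], one of its low Taylor coefficients is not small.  The point is
    that [m] depends only on the bounds, not on [f] and [z0]. *)
Lemma min_modulus (M R r0 eta : R) : 0 <= M -> 0 < R -> 0 < r0 -> 0 < eta ->
  exists m, 0 < m /\ forall (f : C -> C) (z0 : C),
    (forall z, Cmod (z - z0) <= R -> Cdiff f z /\ Cmod (f z) <= M) ->
    (exists z, Cmod (z - z0) <= R / 2 /\ eta <= Cmod (f z)) ->
    exists rho, 0 < rho /\ rho <= r0 /\ forall z, Cmod (z - z0) = rho -> m <= Cmod (f z).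
Proof.
  intros HM HR Hr0 Heta.
  destruct (pow_half_small (4 * M) (eta / 4) ltac:(lra) ltac:(lra)) as [N HN].
  set (S0 := rsum (fun n => (R / 2) ^ n) N).
  assert (HS0 : 0 <= S0) by (apply rsum_ge0; intros; apply pow_le; lra).
  set (e := eta / (4 * (S0 + 1))).
  assert (He : 0 < e) by (apply Rdiv_lt_0_compat; lra).
  destruct (min_modulus_coef M R HM HR N r0 e Hr0 He) as [m [Hm H]].
  exists m. split; [exact Hm|]. intros f z0 Hf [z [Hz Hfz]].
  destruct (taylor_half f z0 R M HR) as [c [_ T]];
    [intros; apply Hf; lra|intros; apply Hf; lra|].
  apply (H f z0 c T). apply NNPP. intros No.
  assert (B : Cmod (csum c (z - z0) N) <= e * S0).
  { unfold S0. rewrite <- rsum_scal. apply csum_bound. intros n Hn.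
    apply Rmult_le_compat; [apply Cmod_ge_0|apply pow_le, Cmod_ge_0| |].
    - apply Rnot_lt_le. intros L. apply No. exists n. split; [lia|lra].
    - apply pow_incr. split; [apply Cmod_ge_0|exact Hz]. }
  assert (B2 : Cmod (f z - csum c (z - z0) N)%C <= eta / 4).
  { eapply Rle_trans; [apply T, Hz|]. eapply Rle_trans; [|exact HN].
    apply Rmult_le_compat_l; [lra|]. apply pow_incr. split.
    - apply Rmult_le_pos; [apply Cmod_ge_0|]. left. apply Rinv_0_lt_compat. lra.
    - apply (Rmult_le_reg_r R); [lra|].
      replace (Cmod (z - z0) / R * R) with (Cmod (z - z0)) by (field; lra). lra. }
  assert (A := Cmod_tri_inv (f z) (csum c (z - z0) N)).
  assert (e * S0 <= eta / 4).
  { apply Rle_trans with (e * (S0 + 1)); [apply Rmult_le_compat_l; lra|].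
    right. unfold e. field. lra. }
  lra.
Qed.

(** * Bohr neighbourhoods of zero *)

(** Since [|exp(i x) - 1| = 2 |sin(x/2)|], these are the neighbourhoods of [0] for the
    coarsest topology on [R] making all characters continuous, written with
    halved frequencies. *)
Definition bohr (Lam : list R) (d tau : R) : Prop :=
  forall lam, In lam Lam -> Rabs (sin (lam * tau)) <= d.

Definition near0 (P : R -> Prop) : Prop :=
  exists Lam d, 0 < d /\ forall tau, bohr Lam d tau -> P tau.

Lemma near0_imp (P Q : R -> Prop) : (forall t, P t -> Q t) -> near0 P -> near0 Q.
Proof. intros H [Lam [d [Hd HP]]]. exists Lam, d. auto. Qed.

Lemma near0_and (P Q : R -> Prop) : near0 P -> near0 Q -> near0 (fun t => P t /\ Q t).
Proof.
  intros [L1 [d1 [H1 P1]]] [L2 [d2 [H2 P2]]].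
  exists (L1 ++ L2), (Rmin d1 d2). split; [apply Rmin_pos; assumption|].
  intros t Ht. split.
  - apply P1. intros l Hl. eapply Rle_trans; [apply Ht, in_or_app; auto|apply Rmin_l].
  - apply P2. intros l Hl. eapply Rle_trans; [apply Ht, in_or_app; auto|apply Rmin_r].
Qed.

Lemma near0_all (P : R -> Prop) : (forall t, P t) -> near0 P.
Proof. intros H. exists nil, 1. split; [lra|auto]. Qed.

Lemma near0_forall_le (P : nat -> R -> Prop) (N : nat) :
  (forall j, (j <= N)%nat -> near0 (P j)) -> near0 (fun t => forall j, (j <= N)%nat -> P j t).
Proof.
  induction N as [|N IH]; intros H.
  - apply (near0_imp (P O)); [|apply H; lia]. intros t Ht j Hj. replace j with O by lia. exact Ht.
  - apply (near0_imp (fun t => (forall j, (j <= N)%nat -> P j t) /\ P (S N) t)).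
    + intros t [H1 H2] j Hj. destruct (Nat.eq_dec j (S N)) as [->|Hne]; [exact H2|apply H1; lia].
    + apply near0_and; [apply IH; intros; apply H; lia|apply H; lia].
Qed.

(** Dilations are Bohr-continuous in both directions: [R] is divisible, so it
    suffices to divide the frequencies. *)
Lemma near0_scale (k : R) (P : R -> Prop) : near0 P -> near0 (fun t => P (k * t)).
Proof.
  intros [Lam [d [Hd HP]]]. exists (map (fun l => l * k) Lam), d. split; [exact Hd|].
  intros t Ht. apply HP. intros l Hl. rewrite <- Rmult_assoc. apply Ht.
  apply (in_map (fun l => l * k)), Hl.
Qed.

(** Total boundedness with respect to [E], in the form to which the pigeonhole principle applies. *)
Definition cov {T : Type} (E : T -> T -> Prop) : Prop :=
  exists cs : list (T -> Prop), (forall t, exists c, In c cs /\ c t) /\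
    forall c, In c cs -> forall s t, c s -> c t -> E s t.

Lemma cov_and {T : Type} (E F : T -> T -> Prop) : cov E -> cov F -> cov (fun s t => E s t /\ F s t).
Proof.
  intros [cs [C1 C2]] [ds [D1 D2]].
  exists (map (fun p => fun t => fst p t /\ snd p t) (list_prod cs ds)). split.
  - intros t. destruct (C1 t) as [c [Hc Hct]]. destruct (D1 t) as [d [Hd Hdt]].
    exists (fun t => c t /\ d t). split; [|split; assumption].
    apply (in_map (fun p => fun t => fst p t /\ snd p t) _ (c, d)), in_prod; assumption.
  - intros c Hc s t Hs Ht. apply in_map_iff in Hc. destruct Hc as [[c1 d1] [<- Hin]].
    apply in_prod_iff in Hin. destruct Hin as [Hc1 Hd1]. simpl in Hs, Ht.
    split; [apply (C2 c1)|apply (D2 d1)]; tauto.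
Qed.

Lemma cov_imp {T : Type} (E F : T -> T -> Prop) : (forall s t, E s t -> F s t) -> cov E -> cov F.
Proof. intros H [cs [C1 C2]]. exists cs. split; [exact C1|]. intros; eapply H, C2; eassumption. Qed.

Lemma cov_bounded {T : Type} (phi : T -> R) (d : R) : 0 < d -> (forall t, -1 <= phi t <= 1) ->
  cov (fun s t => Rabs (phi t - phi s) <= d).
Proof.
  intros Hd Hphi.
  assert (K : forall n, exists cs : list (T -> Prop),
    (forall t, phi t <= -1 + INR n * d -> exists c, In c cs /\ c t) /\
    forall c, In c cs -> forall s t, c s -> c t -> Rabs (phi t - phi s) <= d).
  { induction n as [|n [cs [C1 C2]]].
    - exists ((fun t => phi t = -1) :: nil). split.
      + intros t Ht. simpl in Ht. exists (fun t => phi t = -1). split; [left; reflexivity|].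
        specialize (Hphi t). lra.
      + intros c [<-|[]] s t Hs Ht. rewrite Hs, Ht, Rminus_diag, Rabs_R0. lra.
    - exists ((fun t => -1 + INR n * d <= phi t <= -1 + INR n * d + d) :: cs). split.
      + intros t Ht. rewrite S_INR in Ht. destruct (Rle_dec (phi t) (-1 + INR n * d)) as [Y|N].
        * destruct (C1 t Y) as [c [Hc Hct]]. exists c. split; [right; exact Hc|exact Hct].
        * eexists. split; [left; reflexivity|]. simpl. lra.
      + intros c [<-|Hc] s t Hs Ht.
        * apply Rabs_le. lra.
        * apply (C2 c Hc s t Hs Ht). }
  destruct (INR_unbounded (2 / d)) as [n Hn]. destruct (K n) as [cs [C1 C2]].
  exists cs. split; [|exact C2]. intros t. apply C1.
  assert (2 <= INR n * d).
  { apply Rle_trans with (2 / d * d); [right; field; lra|apply Rmult_le_compat_r; lra]. }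
  specialize (Hphi t). lra.
Qed.

Lemma cov_pigeonhole {T : Type} (E : T -> T -> Prop) : cov E ->
  exists N, forall f : nat -> T, exists i j, (i < j <= N)%nat /\ E (f i) (f j).
Proof.
  intros [cs [C1 C2]]. exists (length cs). intros f.
  set (cell := fun j => proj1_sig (constructive_indefinite_description _ (C1 (f j)))).
  assert (Hcell : forall j, In (cell j) cs /\ cell j (f j))
    by (intros j; apply (proj2_sig (constructive_indefinite_description _ (C1 (f j))))).
  apply NNPP. intros No.
  assert (Hinj : forall i j, In i (seq 0 (S (length cs))) -> In j (seq 0 (S (length cs))) ->
    cell i = cell j -> i = j).
  { intros i j Hi Hj E0. apply in_seq in Hi. apply in_seq in Hj.
    destruct (Nat.lt_trichotomy i j) as [L|[L|L]]; [|exact L|]; exfalso; apply No.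
    - exists i, j. split; [lia|]. apply (C2 (cell i)); [apply Hcell|apply Hcell|rewrite E0; apply Hcell].
    - exists j, i. split; [lia|]. apply (C2 (cell j)); [apply Hcell|apply Hcell|rewrite <- E0; apply Hcell]. }
  assert (ND := FinFun.Injective_map_NoDup_in cell Hinj (seq_NoDup (S (length cs)) 0)).
  assert (Inc : incl (map cell (seq 0 (S (length cs)))) cs).
  { intros c Hc. apply in_map_iff in Hc. destruct Hc as [j [<- _]]. apply Hcell. }
  assert (Hl := NoDup_incl_length ND Inc). rewrite length_map, length_seq in Hl. lia.
Qed.

Lemma cov_bohr (Lam : list R) (d : R) : 0 < d -> cov (fun s t => bohr Lam d (t - s)).
Proof.
  intros Hd. induction Lam as [|l Lam IH].
  - exists ((fun _ : R => True) :: nil). split.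
    + intros t. exists (fun _ => True). split; [left; reflexivity|exact I].
    + intros c _ s t _ _ l [].
  - apply (cov_imp (fun s t => bohr Lam d (t - s) /\
      (Rabs (sin (l * t) - sin (l * s)) <= d / 2 /\ Rabs (cos (l * t) - cos (l * s)) <= d / 2))).
    + intros s t [H1 [H2 H3]] x [<-|Hx]; [|apply H1, Hx].
      replace (l * (t - s)) with (l * t - l * s) by ring. rewrite sin_minus.
      replace (sin (l * t) * cos (l * s) - cos (l * t) * sin (l * s))
        with ((sin (l * t) - sin (l * s)) * cos (l * s) - (cos (l * t) - cos (l * s)) * sin (l * s)) by ring.
      eapply Rle_trans; [apply Rabs_triang|]. rewrite Rabs_Ropp, !Rabs_mult.
      assert (A : Rabs (cos (l * s)) <= 1) by (apply Rabs_le, COS_bound).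
      assert (B : Rabs (sin (l * s)) <= 1) by (apply Rabs_le, SIN_bound).
      assert (Rabs (sin (l * t) - sin (l * s)) * Rabs (cos (l * s)) <= d / 2 * 1)
        by (apply Rmult_le_compat; auto using Rabs_pos).
      assert (Rabs (cos (l * t) - cos (l * s)) * Rabs (sin (l * s)) <= d / 2 * 1)
        by (apply Rmult_le_compat; auto using Rabs_pos).
      lra.
    + apply cov_and; [exact IH|]. apply cov_and.
      * apply (cov_bounded (fun t => sin (l * t))); [lra|intros; apply SIN_bound].
      * apply (cov_bounded (fun t => cos (l * t))); [lra|intros; apply COS_bound].
Qed.

Lemma list_bound (l : list R) : exists L, 0 < L /\ forall s, In s l -> Rabs s <= L.
Proof.
  induction l as [|x l [L [HL H]]].
  - exists 1. split; [lra|intros s []].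
  - exists (L + Rabs x). assert (A := Rabs_pos x). split; [lra|].
    intros s [<-|Hs]; [lra|]. specialize (H s Hs). lra.
Qed.

(** Bohr neighbourhoods are relatively dense: choose a representative in each of finitely
    many cells, and subtract from [x] the representative of its cell. *)
Lemma near0_dense (P : R -> Prop) : near0 P ->
  exists L, 0 < L /\ forall x, exists tau, Rabs (tau - x) <= L /\ P tau.
Proof.
  intros [Lam [d [Hd HP]]]. destruct (cov_bohr Lam d Hd) as [cs [C1 C2]].
  assert (Hrep : exists l : list R, forall c, In c cs -> forall t, c t ->
     exists s, In s l /\ c s).
  { clear C1 C2. induction cs as [|c cs [l Hl]].
    - exists nil. intros c [].
    - destruct (classic (exists s, c s)) as [[s Hs]|N].
      + exists (s :: l). intros c' [<-|Hc] t Ht.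
        * exists s. split; [left; reflexivity|exact Hs].
        * destruct (Hl c' Hc t Ht) as [u [Hu Hcu]]. exists u. split; [right; exact Hu|exact Hcu].
      + exists l. intros c' [<-|Hc] t Ht; [exfalso; apply N; exists t; exact Ht|].
        apply (Hl c' Hc t Ht). }
  destruct Hrep as [l Hl]. destruct (list_bound l) as [L [HL HLb]].
  exists L. split; [exact HL|]. intros x. destruct (C1 x) as [c [Hc Hcx]].
  destruct (Hl c Hc x Hcx) as [s [Hs Hcs]]. exists (x - s). split.
  - replace (x - s - x) with (- s) by ring. rewrite Rabs_Ropp. apply HLb, Hs.
  - apply HP, (C2 c Hc s x Hcs Hcx).
Qed.

(** * Almost periodic functions through Bohr neighbourhoods *)

Lemma Rbar_lt_margin_l (a : Rbar) (x : R) : Rbar_lt a x -> exists r, 0 < r /\ Rbar_lt a (x - r).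
Proof.
  destruct a as [a| |]; simpl; intros H.
  - exists ((x - a) / 2). split; lra.
  - contradiction.
  - exists 1. split; [lra|exact I].
Qed.

Lemma Rbar_lt_margin_r (b : Rbar) (x : R) : Rbar_lt x b -> exists r, 0 < r /\ Rbar_lt (x + r) b.
Proof.
  destruct b as [b| |]; simpl; intros H.
  - exists ((b - x) / 2). split; lra.
  - exists 1. split; [lra|exact I].
  - contradiction.
Qed.

Lemma Rbar_lt_down (a : Rbar) (x y : R) : Rbar_lt a x -> x <= y -> Rbar_lt a y.
Proof. destruct a as [a| |]; simpl; intros; auto; lra. Qed.

Lemma Rbar_lt_up (b : Rbar) (x y : R) : Rbar_lt x b -> y <= x -> Rbar_lt y b.
Proof. destruct b as [b| |]; simpl; intros; auto; lra. Qed.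

Lemma substrip_margin (a' b' : R) (a b : Rbar) : substrip a' b' a b ->
  exists r, 0 < r /\ substrip (a' - r) (b' + r) a b.
Proof.
  intros [H1 [H2 H3]].
  destruct (Rbar_lt_margin_l a a' H1) as [r1 [R1 Q1]].
  destruct (Rbar_lt_margin_r b b' H3) as [r2 [R2 Q2]].
  exists (Rmin r1 r2). assert (P := Rmin_pos _ _ R1 R2).
  assert (A1 := Rmin_l r1 r2). assert (A2 := Rmin_r r1 r2).
  split; [exact P|]. split; [|split].
  - apply (Rbar_lt_down a (a' - r1)); [exact Q1|lra].
  - lra.
  - apply (Rbar_lt_up b (b' + r2)); [exact Q2|lra].
Qed.

Lemma substrip_point (a b : Rbar) (z : C) : strip a b z ->
  exists a' b', substrip a' b' a b /\ rstrip a' b' z.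
Proof.
  intros [H1 H2].
  destruct (Rbar_lt_margin_l a _ H1) as [r1 [R1 Q1]].
  destruct (Rbar_lt_margin_r b _ H2) as [r2 [R2 Q2]].
  exists (Im z - r1), (Im z + r2). split; [|unfold rstrip; lra].
  split; [exact Q1|]. split; [lra|exact Q2].
Qed.

Lemma substrip_union (a1 b1 a2 b2 : R) (a b : Rbar) :
  substrip a1 b1 a b -> substrip a2 b2 a b -> substrip (Rmin a1 a2) (Rmax b1 b2) a b.
Proof.
  intros [H1 [H2 H3]] [K1 [K2 K3]]. split; [|split].
  - unfold Rmin. destruct (Rle_dec a1 a2); assumption.
  - eapply Rle_lt_trans; [apply Rmin_l|]. eapply Rlt_le_trans; [exact H2|apply Rmax_l].
  - unfold Rmax. destruct (Rle_dec b1 b2); assumption.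
Qed.

Lemma rstrip_union_l (a1 b1 a2 b2 : R) (z : C) : rstrip a1 b1 z -> rstrip (Rmin a1 a2) (Rmax b1 b2) z.
Proof.
  intros [H1 H2]. assert (A := Rmin_l a1 a2). assert (B := Rmax_l b1 b2). unfold rstrip. lra.
Qed.

Lemma rstrip_union_r (a1 b1 a2 b2 : R) (z : C) : rstrip a2 b2 z -> rstrip (Rmin a1 a2) (Rmax b1 b2) z.
Proof.
  intros [H1 H2]. assert (A := Rmin_r a1 a2). assert (B := Rmax_r b1 b2). unfold rstrip. lra.
Qed.

Lemma rstrip_strip (a' b' : R) (a b : Rbar) (z : C) : substrip a' b' a b -> rstrip a' b' z -> strip a b z.
Proof.
  intros [H1 [H2 H3]] [K1 K2]. split.
  - apply (Rbar_lt_down a a'); [exact H1|lra].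
  - apply (Rbar_lt_up b b'); [exact H3|lra].
Qed.

Lemma rstrip_shift (a b : R) (z : C) (t : R) : rstrip a b z -> rstrip a b (z + RtoC t)%C.
Proof. unfold rstrip, Im. simpl. rewrite Rplus_0_r. auto. Qed.

Lemma rstrip_widen (a b r : R) (z : C) : 0 <= r -> rstrip a b z -> rstrip (a - r) (b + r) z.
Proof. unfold rstrip. lra. Qed.

Definition holo (a b : Rbar) (f : C -> C) : Prop := forall z, strip a b z -> Cdiff f z.

Definition bdd (a b : Rbar) (f : C -> C) : Prop :=
  forall a' b', substrip a' b' a b ->
  exists M, 0 < M /\ forall z, rstrip a' b' z -> Cmod (f z) <= M.

Definition bap (a b : Rbar) (f : C -> C) : Prop :=
  forall a' b', substrip a' b' a b -> forall eps, 0 < eps ->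
  near0 (fun tau => forall z, rstrip a' b' z -> Cmod (f (z + RtoC tau) - f z)%C <= eps).

Definition HB (a b : Rbar) (f : C -> C) : Prop := holo a b f /\ bdd a b f.

(** Bohr's description of [AP]; the two are equivalent by [AP_APH] and [APH_AP]. *)
Definition APH (a b : Rbar) (f : C -> C) : Prop := HB a b f /\ bap a b f.

Lemma HB_plus (a b : Rbar) (f g : C -> C) : HB a b f -> HB a b g -> HB a b (fun z => f z + g z)%C.
Proof.
  intros [F1 F2] [G1 G2]. split.
  - intros z Hz. apply Cdiff_plus; auto.
  - intros a' b' Hs. destruct (F2 a' b' Hs) as [M [HM H]]. destruct (G2 a' b' Hs) as [N [HN K]].
    exists (M + N). split; [lra|]. intros z Hz. eapply Rle_trans; [apply Cmod_triangle|].
    specialize (H z Hz). specialize (K z Hz). lra.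
Qed.

Lemma HB_mult (a b : Rbar) (f g : C -> C) : HB a b f -> HB a b g -> HB a b (fun z => f z * g z)%C.
Proof.
  intros [F1 F2] [G1 G2]. split.
  - intros z Hz. apply Cdiff_mult; auto.
  - intros a' b' Hs. destruct (F2 a' b' Hs) as [M [HM H]]. destruct (G2 a' b' Hs) as [N [HN K]].
    exists (M * N). split; [apply Rmult_lt_0_compat; assumption|]. intros z Hz. rewrite Cmod_mult.
    apply Rmult_le_compat; auto using Cmod_ge_0.
Qed.

Lemma HB_const (a b : Rbar) (c : C) : HB a b (fun _ => c).
Proof.
  split.
  - intros z _. apply Cdiff_const.
  - intros a' b' _. exists (Cmod c + 1). assert (H := Cmod_ge_0 c). split; [lra|]. intros; lra.
Qed.

Lemma APH_const (a b : Rbar) (c : C) : APH a b (fun _ => c).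
Proof.
  split; [apply HB_const|]. intros a' b' _ eps He. apply near0_all. intros t z _.
  rewrite Cmod_diag. lra.
Qed.

Lemma APH_plus (a b : Rbar) (f g : C -> C) : APH a b f -> APH a b g -> APH a b (fun z => f z + g z)%C.
Proof.
  intros [F1 F2] [G1 G2]. split; [apply HB_plus; assumption|].
  intros a' b' Hs eps He.
  apply (near0_imp (fun t => (forall z, rstrip a' b' z -> Cmod (f (z + RtoC t) - f z)%C <= eps / 2) /\
     (forall z, rstrip a' b' z -> Cmod (g (z + RtoC t) - g z)%C <= eps / 2))).
  - intros t [H1 H2] z Hz.
    replace (f (z + RtoC t) + g (z + RtoC t) - (f z + g z))%C
      with ((f (z + RtoC t) - f z) + (g (z + RtoC t) - g z))%C by ring.
    eapply Rle_trans; [apply Cmod_triangle|]. specialize (H1 z Hz). specialize (H2 z Hz). lra.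
  - apply near0_and; [apply F2|apply G2]; auto; lra.
Qed.

Lemma APH_mult (a b : Rbar) (f g : C -> C) : APH a b f -> APH a b g -> APH a b (fun z => f z * g z)%C.
Proof.
  intros [F1 F2] [G1 G2]. split; [apply HB_mult; assumption|].
  intros a' b' Hs eps He.
  destruct (proj2 F1 a' b' Hs) as [M [HM H]]. destruct (proj2 G1 a' b' Hs) as [N [HN K]].
  set (e := eps / (M + N)).
  assert (He' : 0 < e) by (apply Rdiv_lt_0_compat; lra).
  apply (near0_imp (fun t => (forall z, rstrip a' b' z -> Cmod (f (z + RtoC t) - f z)%C <= e) /\
     (forall z, rstrip a' b' z -> Cmod (g (z + RtoC t) - g z)%C <= e))).
  - intros t [H1 H2] z Hz.
    replace (f (z + RtoC t) * g (z + RtoC t) - (f z * g z))%C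
      with ((f (z + RtoC t) - f z) * g (z + RtoC t) + f z * (g (z + RtoC t) - g z))%C by ring.
    eapply Rle_trans; [apply Cmod_triangle|]. rewrite !Cmod_mult.
    assert (Cmod (f (z + RtoC t) - f z)%C * Cmod (g (z + RtoC t)%C) <= e * N).
    { apply Rmult_le_compat; auto using Cmod_ge_0. apply K, rstrip_shift, Hz. }
    assert (Cmod (f z) * Cmod (g (z + RtoC t) - g z)%C <= M * e).
    { apply Rmult_le_compat; auto using Cmod_ge_0. }
    assert (e * N + M * e = eps) by (unfold e; field; lra). lra.
  - apply near0_and; [apply F2|apply G2]; auto.
Qed.

Lemma APH_ext (a b : Rbar) (f g : C -> C) : (forall z, f z = g z) -> APH a b f -> APH a b g.
Proof.
  intros H [[F1 F2] F3]. split; [split|].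
  - intros z Hz. apply (Cdiff_ext f); auto.
  - intros a' b' Hs. destruct (F2 a' b' Hs) as [M [HM K]]. exists M. split; [exact HM|].
    intros z Hz. rewrite <- H. auto.
  - intros a' b' Hs eps He. apply near0_imp with (2 := F3 a' b' Hs eps He).
    intros t Ht z Hz. rewrite <- !H. apply Ht, Hz.
Qed.

(** * Exponentials *)

Definition cexpi (lam : R) (z : C) : C := Cexp (Cmult (Cmult Ci (RtoC lam)) z).

Lemma Cexp_plus (z w : C) : Cexp (z + w)%C = (Cexp z * Cexp w)%C.
Proof.
  unfold Cexp. destruct z as [x y], w as [u v]. simpl.
  rewrite exp_plus, cos_plus, sin_plus. apply injective_projections; simpl; ring.
Qed.

Lemma Cmod_Cexp (z : C) : Cmod (Cexp z) = exp (Re z).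
Proof.
  replace (Cexp z) with (RtoC (exp (Re z)) * eix (Im z))%C
    by (apply injective_projections; simpl; ring).
  rewrite Cmod_mult, Cmod_eix, Cmod_R, Rabs_pos_eq by (left; apply exp_pos). ring.
Qed.

Lemma cexpi_real (lam t : R) : cexpi lam (RtoC t) = eix (lam * t).
Proof.
  unfold cexpi, Cexp, eix. apply injective_projections; simpl.
  - replace ((0 * lam - 1 * 0) * t - (0 * 0 + 1 * lam) * 0) with 0 by ring.
    replace ((0 * lam - 1 * 0) * 0 + (0 * 0 + 1 * lam) * t) with (lam * t) by ring.
    rewrite exp_0. ring.
  - replace ((0 * lam - 1 * 0) * t - (0 * 0 + 1 * lam) * 0) with 0 by ring.
    replace ((0 * lam - 1 * 0) * 0 + (0 * 0 + 1 * lam) * t) with (lam * t) by ring.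
    rewrite exp_0. ring.
Qed.

Lemma cexpi_plus (lam : R) (z w : C) : cexpi lam (z + w)%C = (cexpi lam z * cexpi lam w)%C.
Proof. unfold cexpi. rewrite <- Cexp_plus. f_equal. ring. Qed.

Lemma cexpi_freq (l m : R) (z : C) : cexpi (l + m) z = (cexpi l z * cexpi m z)%C.
Proof. unfold cexpi. rewrite <- Cexp_plus. f_equal. rewrite RtoC_plus. ring. Qed.

Lemma cexpi_0 (z : C) : cexpi 0 z = RtoC 1.
Proof.
  unfold cexpi. replace (Ci * RtoC 0 * z)%C with (RtoC 0) by ring.
  unfold Cexp. simpl. rewrite exp_0, cos_0, sin_0. apply injective_projections; simpl; ring.
Qed.

Lemma Cmod_cexpi (lam : R) (z : C) : Cmod (cexpi lam z) = exp (- (lam * Im z)).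
Proof. unfold cexpi. rewrite Cmod_Cexp. f_equal. unfold Re, Im. simpl. ring. Qed.

Lemma Cmod_eix_minus_1 (x : R) : Cmod (eix x - 1) = 2 * Rabs (sin (x / 2)).
Proof.
  unfold Cmod. simpl.
  replace ((cos x + - (1)) * ((cos x + - (1)) * 1) + (sin x + - 0) * ((sin x + - 0) * 1))
    with (Rsqr (2 * sin (x / 2))).
  - rewrite sqrt_Rsqr_abs, Rabs_mult, (Rabs_pos_eq 2) by lra. reflexivity.
  - assert (E : cos x = 1 - 2 * (sin (x / 2) * sin (x / 2))).
    { replace x with (2 * (x / 2)) at 1 by field. rewrite cos_2a_sin. ring. }
    assert (E2 := sin2_cos2 x). unfold Rsqr in *.
    replace (2 * sin (x / 2) * (2 * sin (x / 2))) with (2 * (2 * (sin (x / 2) * sin (x / 2)))) by ring.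
    replace (2 * (sin (x / 2) * sin (x / 2))) with (1 - cos x) by (rewrite E; ring). nra.
Qed.

Lemma Cexp_first_order (eps : R) : 0 < eps -> exists del, 0 < del /\
  forall h, Cmod h < del -> Cmod (Cexp h - (1 + h))%C <= eps * Cmod h.
Proof.
  intros He.
  set (e := Rmin 1 (eps / 10)).
  assert (He0 : 0 < e) by (apply Rmin_pos; lra).
  assert (He1 : e <= 1) by apply Rmin_l. assert (He2 : e <= eps / 10) by apply Rmin_r.
  assert (D : forall (f : R -> R) l, derivable_pt_lim f 0 l -> exists d, 0 < d /\
    forall h, Rabs h < d -> Rabs (f h - f 0 - l * h) <= e * Rabs h).
  { intros f l Hf. destruct (Hf e He0) as [[d Hd] H]. exists d. split; [exact Hd|].
    intros h Hh. destruct (Req_dec h 0) as [->|N].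
    - replace (f 0 - f 0 - l * 0) with 0 by ring. rewrite Rabs_R0. lra.
    - specialize (H h N Hh). rewrite Rplus_0_l in H.
      replace (f h - f 0 - l * h) with (((f h - f 0) / h - l) * h) by (field; exact N).
      rewrite Rabs_mult. apply Rmult_le_compat_r; [apply Rabs_pos|lra]. }
  destruct (D exp 1) as [d1 [Hd1 H1]]; [rewrite <- exp_0; apply derivable_pt_lim_exp|].
  destruct (D cos 0) as [d2 [Hd2 H2]].
  { replace 0 with (- sin 0) at 2 by (rewrite sin_0; ring). apply derivable_pt_lim_cos. }
  destruct (D sin 1) as [d3 [Hd3 H3]]; [rewrite <- cos_0; apply derivable_pt_lim_sin|].
  rewrite exp_0 in H1. rewrite cos_0 in H2. rewrite sin_0 in H3.
  set (del := Rmin (Rmin d1 d2) (Rmin d3 e)).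
  assert (Hdel : 0 < del) by (apply Rmin_pos; apply Rmin_pos; assumption).
  assert (del <= d1) by (Rmin_le).
  assert (del <= d2) by (Rmin_le).
  assert (del <= d3) by (Rmin_le).
  assert (del <= e) by (Rmin_le).
  exists del. split; [exact Hdel|]. intros [x y] Hh.
  assert (Hx := Cmod_Re (x, y)). assert (Hy := Cmod_Im (x, y)). simpl in Hx, Hy.
  set (m := Cmod (x, y)) in *.
  assert (E1 := H1 x ltac:(lra)). assert (E2 := H2 y ltac:(lra)). assert (E3 := H3 y ltac:(lra)).
  assert (Ax := Rabs_pos x). assert (Ay := Rabs_pos y).
  rewrite Rmult_1_l in E1, E3. rewrite Rmult_0_l, Rminus_0_r in E2. rewrite Rminus_0_r in E3.
  assert (B1 : Rabs (exp x - 1) <= 2 * m).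
  { replace (exp x - 1) with ((exp x - 1 - x) + x) by ring.
    eapply Rle_trans; [apply Rabs_triang|]. nra. }
  assert (B2 : Rabs (exp x) <= 3).
  { replace (exp x) with ((exp x - 1) + 1) by ring.
    eapply Rle_trans; [apply Rabs_triang|]. rewrite Rabs_R1. lra. }
  replace (Cexp (x, y) - (1 + (x, y)))%C
    with (RtoC (exp x - 1 - x + exp x * (cos y - 1)) + Ci * RtoC (exp x * (sin y - y) + y * (exp x - 1)))%C
    by (apply injective_projections; simpl; ring).
  eapply Rle_trans; [apply Cmod_triangle|]. rewrite Cmod_mult, Cmod_Ci, !Cmod_R.
  assert (Ex : e * Rabs x <= e * m) by (apply Rmult_le_compat_l; lra).
  assert (Ey : e * Rabs y <= e * m) by (apply Rmult_le_compat_l; lra).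
  assert (C1 : Rabs (exp x - 1 - x + exp x * (cos y - 1)) <= e * m + 3 * (e * m)).
  { eapply Rle_trans; [apply Rabs_triang|]. rewrite Rabs_mult.
    apply Rplus_le_compat; [lra|]. apply Rmult_le_compat; try apply Rabs_pos; lra. }
  assert (C2 : Rabs (exp x * (sin y - y) + y * (exp x - 1)) <= 3 * (e * m) + m * (2 * e)).
  { eapply Rle_trans; [apply Rabs_triang|]. rewrite !Rabs_mult.
    apply Rplus_le_compat; apply Rmult_le_compat; try apply Rabs_pos; lra. }
  assert (0 <= m) by apply Cmod_ge_0.
  assert (e * m <= eps / 10 * m) by (apply Rmult_le_compat_r; assumption).
  assert (0 <= eps * m) by (apply Rmult_le_pos; lra). lra.
Qed.

Lemma Cdiff_cexpi (lam : R) (z : C) : Cdiff (cexpi lam) z.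
Proof.
  set (c := (Ci * RtoC lam)%C).
  apply (eps_Cdiff _ z (cexpi lam z * c)%C). intros eps He.
  assert (P1 := Cmod_ge_0 (cexpi lam z)). assert (P2 := Cmod_ge_0 c).
  set (K := Cmod (cexpi lam z) * Cmod c).
  assert (HK : 0 <= K) by (apply Rmult_le_pos; assumption).
  destruct (Cexp_first_order (eps / (K + 1))) as [d [Hd H]]; [apply Rdiv_lt_0_compat; lra|].
  exists (d / (Cmod c + 1)). split; [apply Rdiv_lt_0_compat; lra|].
  intros w Hw. set (h := (w - z)%C) in *. assert (Hh := Cmod_ge_0 h).
  replace w with (z + h)%C by (unfold h; ring). rewrite cexpi_plus.
  replace (cexpi lam z * cexpi lam h - (cexpi lam z + cexpi lam z * c * h))%C
    with (cexpi lam z * (Cexp (c * h) - (1 + c * h)))%C by (unfold cexpi; fold c; ring).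
  rewrite Cmod_mult.
  assert (Hch : Cmod (c * h) < d).
  { rewrite Cmod_mult. apply Rle_lt_trans with ((Cmod c + 1) * Cmod h); [nra|].
    replace d with ((Cmod c + 1) * (d / (Cmod c + 1))) by (field; lra).
    apply Rmult_lt_compat_l; lra. }
  specialize (H _ Hch). rewrite Cmod_mult in H.
  apply Rle_trans with (Cmod (cexpi lam z) * (eps / (K + 1) * (Cmod c * Cmod h)));
    [apply Rmult_le_compat_l; assumption|].
  replace (Cmod (cexpi lam z) * (eps / (K + 1) * (Cmod c * Cmod h)))
    with (K * (eps / (K + 1)) * Cmod h) by (unfold K; ring).
  apply Rmult_le_compat_r; [exact Hh|].
  apply Rle_trans with ((K + 1) * (eps / (K + 1))); [|right; field; lra].
  apply Rmult_le_compat_r; [|lra]. left. apply Rdiv_lt_0_compat; lra.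
Qed.

Lemma cexpi_strip_bound (a' b' lam : R) : a' < b' -> forall z, rstrip a' b' z ->
  Cmod (cexpi lam z) <= exp (Rabs lam * (Rabs a' + Rabs b')).
Proof.
  intros Hab z [H1 H2]. rewrite Cmod_cexpi.
  assert (E : - (lam * Im z) <= Rabs lam * (Rabs a' + Rabs b')).
  { eapply Rle_trans; [apply Rle_abs|]. rewrite Rabs_Ropp, Rabs_mult.
    apply Rmult_le_compat_l; [apply Rabs_pos|]. apply Rabs_le.
    assert (A := Rle_abs b'). assert (B := Rle_abs (- a')). rewrite Rabs_Ropp in B.
    assert (C1 := Rabs_pos a'). assert (C2 := Rabs_pos b'). lra. }
  destruct E as [E|E]; [left; apply exp_increasing, E|right; f_equal; exact E].
Qed.

Lemma APH_cexpi (a b : Rbar) (lam : R) : APH a b (cexpi lam).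
Proof.
  split; [split|].
  - intros z _. apply Cdiff_cexpi.
  - intros a' b' [_ [Hab _]]. eexists. split; [|apply cexpi_strip_bound, Hab]. apply exp_pos.
  - intros a' b' [_ [Hab _]] eps He.
    set (E := exp (Rabs lam * (Rabs a' + Rabs b'))).
    assert (HE : 0 < E) by apply exp_pos.
    exists (lam / 2 :: nil), (eps / (2 * E)).
    split; [apply Rdiv_lt_0_compat; lra|]. intros t Ht z Hz.
    specialize (Ht (lam / 2) (or_introl eq_refl)).
    rewrite cexpi_plus, cexpi_real.
    replace (cexpi lam z * eix (lam * t) - cexpi lam z)%C with (cexpi lam z * (eix (lam * t) - 1))%C by ring.
    rewrite Cmod_mult, Cmod_eix_minus_1.
    replace (lam * t / 2) with (lam / 2 * t) by field.
    assert (B := cexpi_strip_bound a' b' lam Hab z Hz). fold E in B.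
    apply Rle_trans with (E * (2 * (eps / (2 * E)))); [|right; field; lra].
    apply Rmult_le_compat; [apply Cmod_ge_0| |exact B|lra].
    assert (X := Rabs_pos (sin (lam / 2 * t))). lra.
Qed.

Lemma exp_sum_0 (c : nat -> C) (lam : nat -> R) (z : C) :
  exp_sum 0 c lam z = (c O * cexpi (lam O) z)%C.
Proof. unfold exp_sum. rewrite sum_O. reflexivity. Qed.

Lemma exp_sum_S (N : nat) (c : nat -> C) (lam : nat -> R) (z : C) :
  exp_sum (S N) c lam z = (exp_sum N c lam z + c (S N) * cexpi (lam (S N)) z)%C.
Proof. unfold exp_sum. rewrite sum_Sn. reflexivity. Qed.

Lemma APH_exp_sum (a b : Rbar) (N : nat) (c : nat -> C) (lam : nat -> R) :
  APH a b (exp_sum N c lam).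
Proof.
  induction N as [|N IH].
  - apply (APH_ext a b (fun z => c O * cexpi (lam O) z)%C);
      [intros; symmetry; apply exp_sum_0|].
    apply APH_mult; [apply APH_const|apply APH_cexpi].
  - apply (APH_ext a b (fun z => exp_sum N c lam z + c (S N) * cexpi (lam (S N)) z)%C);
      [intros; symmetry; apply exp_sum_S|].
    apply APH_plus; [exact IH|]. apply APH_mult; [apply APH_const|apply APH_cexpi].
Qed.

(** Boundedness and almost periods pass to uniform limits trivially, differentiability
    does because Cauchy's formula does. *)
Lemma AP_APH (a b : Rbar) (f : C -> C) : AP a b f -> APH a b f.
Proof.
  intros Hf.
  assert (Hb : bdd a b f).
  { intros a' b' Hs. destruct (Hf a' b' Hs 1 ltac:(lra)) as [N [c [lam H]]].
    destruct (proj2 (proj1 (APH_exp_sum a b N c lam)) a' b' Hs) as [M [HM B]].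
    exists (M + 1). split; [lra|]. intros z Hz. specialize (H z Hz). specialize (B z Hz).
    assert (T := Cmod_tri_inv (f z) (exp_sum N c lam z)).
    change (Cminus (f z) (exp_sum N c lam z)) with (f z - exp_sum N c lam z)%C in H. lra. }
  split; [split; [|exact Hb]|].
  - intros z Hz. destruct (substrip_point a b z Hz) as [a' [b' [Hs Hz']]].
    destruct (substrip_margin a' b' a b Hs) as [r [Hr Hs']].
    destruct (Hb _ _ Hs') as [M [HM B]].
    assert (Hin : forall w, Cmod (w - z) <= r -> rstrip (a' - r) (b' + r) w).
    { intros w Hw. apply (rstrip_disc a' b' r z); assumption. }
    apply (cauchy_on_Cdiff f z r M Hr).
    + apply cauchy_on_limit; [exact Hr|]. intros eps He.
      destruct (Hf _ _ Hs' eps He) as [N [c [lam H]]].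
      exists (exp_sum N c lam). split.
      * apply Cdiff_cauchy_on; [exact Hr|]. intros w Hw.
        apply (proj1 (proj1 (APH_exp_sum a b N c lam))).
        apply (rstrip_strip _ _ a b w Hs'), Hin, Hw.
      * intros w Hw. apply H. apply Hin, Hw.
    + intros w Hw. apply B, Hin. lra.
  - intros a' b' Hs eps He. destruct (Hf a' b' Hs (eps / 3) ltac:(lra)) as [N [c [lam H]]].
    apply near0_imp with (2 := proj2 (APH_exp_sum a b N c lam) a' b' Hs (eps / 3) ltac:(lra)).
    intros t Ht z Hz. specialize (Ht z Hz).
    assert (H1 := H z Hz). assert (H2 := H (z + RtoC t)%C (rstrip_shift a' b' z t Hz)).
    change (Cmod (f z - exp_sum N c lam z) <= eps / 3) in H1.
    change (Cmod (f (z + RtoC t) - exp_sum N c lam (z + RtoC t))%C <= eps / 3) in H2.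
    rewrite Cmod_minus_sym in H1.
    eapply Rle_trans; [apply (Cmod_tri3 _ (exp_sum N c lam (z + RtoC t)%C))|].
    eapply Rle_trans; [apply Rplus_le_compat_l, (Cmod_tri3 _ (exp_sum N c lam z))|]. lra.
Qed.

(** * The integral domain of bounded holomorphic functions *)

Lemma strip_open (a b : Rbar) (z : C) : strip a b z ->
  exists r, 0 < r /\ forall w, Cmod (w - z) <= r -> strip a b w.
Proof.
  intros Hz. destruct (substrip_point a b z Hz) as [a' [b' [Hs Hz']]].
  destruct (substrip_margin a' b' a b Hs) as [r [Hr Hs']].
  exists r. split; [exact Hr|]. intros w Hw. apply (rstrip_strip _ _ a b w Hs').
  apply (rstrip_disc a' b' r z); assumption.
Qed.

Lemma nonzero_disc (f : C -> C) (z : C) : Cdiff f z -> f z <> RtoC 0 ->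
  exists r, 0 < r /\ forall w, Cmod (w - z) <= r -> Cmod (f z) / 2 <= Cmod (f w).
Proof.
  intros Df Hz. apply Cmod_gt_0 in Hz.
  destruct (Cdiff_cont f z Df (Cmod (f z) / 2) ltac:(lra)) as [d [Hd H]].
  exists (d / 2). split; [lra|]. intros w Hw.
  specialize (H w ltac:(unfold dist_C; lra)). rewrite Cmod_minus_sym in H.
  assert (T := Cmod_tri_inv (f z) (f w)). lra.
Qed.

(** Zero on a disc is arbitrarily small on it, and smallness propagates. *)
Lemma HB_identity (a b : Rbar) (f : C -> C) (z1 : C) (r : R) : HB a b f -> strip a b z1 -> 0 < r ->
  (forall z, Cmod (z - z1) <= r -> f z = RtoC 0) -> forall z, strip a b z -> f z = RtoC 0.
Proof.
  intros [Hf Hb] Hz1 Hr H0 z Hz.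
  destruct (substrip_point a b z1 Hz1) as [a1 [b1 [S1 Q1]]].
  destruct (substrip_point a b z Hz) as [a2 [b2 [S2 Q2]]].
  assert (S3 := substrip_union _ _ _ _ _ _ S1 S2).
  assert (Q3 := rstrip_union_l a1 b1 a2 b2 z1 Q1). assert (Q4 := rstrip_union_r a1 b1 a2 b2 z Q2).
  revert S3 Q3 Q4. generalize (Rmin a1 a2) (Rmax b1 b2). intros a' b' Hs P1 P2.
  destruct (substrip_margin a' b' a b Hs) as [R [HR Hs']].
  destruct (Hb _ _ Hs') as [M [HM B]].
  apply Cmod_small. intros e He.
  destruct (propagation a' b' R M r (Cmod (z - z1)) e ltac:(lra) HR Hr He) as [eta [Heta H]].
  apply (H f) with (z1 := z1); try assumption; [| |lra].
  - intros w Hw. split; [|apply B, Hw]. apply Hf, (rstrip_strip _ _ a b w Hs'), Hw.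
  - intros w Hw. rewrite (H0 w Hw), Cmod_0. lra.
Qed.

Lemma HB_integral (a b : Rbar) (f g : C -> C) : HB a b f -> HB a b g ->
  (forall z, strip a b z -> (f z * g z)%C = RtoC 0) ->
  (forall z, strip a b z -> f z = RtoC 0) \/ (forall z, strip a b z -> g z = RtoC 0).
Proof.
  intros Hf Hg H. apply NNPP. intros No. apply No. right. intros z1 Hz1. apply NNPP. intros Hne.
  apply No. left.
  destruct (strip_open a b z1 Hz1) as [r1 [R1 O1]].
  destruct (nonzero_disc g z1 (proj1 Hg z1 Hz1) Hne) as [r2 [R2 O2]].
  apply (HB_identity a b f z1 (Rmin r1 r2) Hf Hz1); [apply Rmin_pos; assumption|].
  intros z Hz.
  assert (A1 : Cmod (z - z1) <= r1) by (eapply Rle_trans; [exact Hz|apply Rmin_l]).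
  assert (A2 : Cmod (z - z1) <= r2) by (eapply Rle_trans; [exact Hz|apply Rmin_r]).
  assert (Hgz : g z <> RtoC 0).
  { apply Cmod_gt_0. apply Cmod_gt_0 in Hne. specialize (O2 z A2). lra. }
  apply NNPP. intros Hfz. apply (Cmult_neq_0 _ _ Hfz Hgz). apply H, O1, A1.
Qed.

Definition non_null (a b : Rbar) (f : C -> C) : Prop := exists z, strip a b z /\ f z <> RtoC 0.

Lemma not_non_null (a b : Rbar) (f : C -> C) : ~ non_null a b f -> forall z, strip a b z -> f z = RtoC 0.
Proof. intros H z Hz. apply NNPP. intros N. apply H. exists z. auto. Qed.

Lemma APH_pow (a b : Rbar) (f : C -> C) (n : nat) : APH a b f -> APH a b (fun z => Cpow (f z) n).
Proof.
  intros H. induction n as [|n IH]; simpl; [apply APH_const|].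
  apply (APH_mult a b f (fun z => Cpow (f z) n)); assumption.
Qed.

Lemma non_null_pow (a b : Rbar) (f : C -> C) (n : nat) :
  non_null a b f -> non_null a b (fun z => Cpow (f z) n).
Proof. intros [z [S N]]. exists z. split; [exact S|]. apply Cpow_nz, N. Qed.

(** * Polynomials with almost periodic coefficients *)

Fixpoint psum (p : nat -> C -> C) (z v : C) (n : nat) : C :=
  match n with
  | O => p O z
  | S k => (psum p z v k + p (S k) z * Cpow v (S k))%C
  end.

(** The formal derivative of [psum] in [v]. *)
Fixpoint dpsum (p : nat -> C -> C) (z v : C) (n : nat) : C :=
  match n with
  | O => RtoC 0
  | S k => (dpsum p z v k + RtoC (INR (S k)) * p (S k) z * Cpow v k)%C
  end.

(** Polynomials of degree at most [n] as functions of two variables, so that polynomial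
    identities are checked pointwise. *)
Definition APpoly (a b : Rbar) (n : nat) (F : C -> C -> C) : Prop :=
  exists p : nat -> C -> C, (forall k, APH a b (p k)) /\
    forall z v, strip a b z -> F z v = psum p z v n.

Lemma psum_ext (p q : nat -> C -> C) (z v : C) (n : nat) :
  (forall k, (k <= n)%nat -> p k z = q k z) -> psum p z v n = psum q z v n.
Proof.
  induction n as [|n IH]; intros H; simpl.
  - apply H; lia.
  - rewrite IH by (intros; apply H; lia). rewrite (H (S n)) by lia. reflexivity.
Qed.

Section Polynomials.

Variables (a b : Rbar).

Lemma APpoly_ext (n : nat) (F G : C -> C -> C) :
  (forall z v, strip a b z -> F z v = G z v) -> APpoly a b n F -> APpoly a b n G.
Proof. intros H [p [Hp E]]. exists p. split; [exact Hp|]. intros z v Hz. rewrite <- H; auto. Qed.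

Lemma APpoly_0 (f : C -> C) : APH a b f -> APpoly a b 0 (fun z _ => f z).
Proof. intros H. exists (fun _ => f). split; auto. Qed.

Lemma APpoly_S (n : nat) (F : C -> C -> C) (f : C -> C) : APpoly a b n F -> APH a b f ->
  APpoly a b (S n) (fun z v => F z v + f z * Cpow v (S n))%C.
Proof.
  intros [p [Hp E]] Hf. exists (fun k => if Nat.eq_dec k (S n) then f else p k). split.
  - intros k. destruct (Nat.eq_dec k (S n)); auto.
  - intros z v Hz. cbn [psum]. destruct (Nat.eq_dec (S n) (S n)) as [_|N]; [|congruence].
    rewrite E by exact Hz. f_equal. apply psum_ext. intros k Hk.
    destruct (Nat.eq_dec k (S n)); [lia|reflexivity].
Qed.

Lemma APpoly_inv (n : nat) (F : C -> C -> C) : APpoly a b (S n) F ->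
  exists F' f, APpoly a b n F' /\ APH a b f /\
    forall z v, strip a b z -> F z v = (F' z v + f z * Cpow v (S n))%C.
Proof.
  intros [p [Hp E]]. exists (fun z v => psum p z v n), (p (S n)).
  split; [exists p; auto|]. split; [apply Hp|exact E].
Qed.

Lemma APpoly_plus (n : nat) (F G : C -> C -> C) : APpoly a b n F -> APpoly a b n G ->
  APpoly a b n (fun z v => F z v + G z v)%C.
Proof.
  intros [p [Hp E]] [q [Hq K]]. exists (fun k z => p k z + q k z)%C. split.
  - intros k. apply APH_plus; auto.
  - intros z v Hz. rewrite E, K by exact Hz. clear E K.
    induction n as [|n IH]; simpl; [reflexivity|]. rewrite <- IH. ring.
Qed.

Lemma APpoly_weaken (n : nat) (F : C -> C -> C) : APpoly a b n F -> APpoly a b (S n) F.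
Proof.
  intros H. apply (APpoly_ext (S n) (fun z v => F z v + RtoC 0 * Cpow v (S n))%C).
  - intros. ring.
  - apply (APpoly_S n F (fun _ => RtoC 0) H), APH_const.
Qed.

Lemma APpoly_le (n m : nat) (F : C -> C -> C) : (n <= m)%nat -> APpoly a b n F -> APpoly a b m F.
Proof. intros L H. induction L; [exact H|apply APpoly_weaken; assumption]. Qed.

Lemma APpoly_scal (n : nat) (f : C -> C) (F : C -> C -> C) : APH a b f -> APpoly a b n F ->
  APpoly a b n (fun z v => f z * F z v)%C.
Proof.
  intros Hf [p [Hp E]]. exists (fun k z => f z * p k z)%C. split.
  - intros k. apply APH_mult; auto.
  - intros z v Hz. rewrite E by exact Hz. clear E.
    induction n as [|n IH]; simpl; [reflexivity|]. rewrite <- IH. ring.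
Qed.

Lemma APpoly_shift (n : nat) (F : C -> C -> C) : APpoly a b n F ->
  APpoly a b (S n) (fun z v => v * F z v)%C.
Proof.
  revert F. induction n as [|n IH]; intros F H.
  - destruct H as [p [Hp E]].
    apply (APpoly_ext 1 (fun z v => RtoC 0 + p O z * Cpow v 1)%C).
    + intros z v Hz. rewrite E by exact Hz. simpl. ring.
    + apply (APpoly_S 0 (fun _ _ => RtoC 0)); [|apply Hp].
      apply (APpoly_0 (fun _ => RtoC 0)), APH_const.
  - destruct (APpoly_inv n F H) as [F' [f [HF' [Hf E]]]].
    apply (APpoly_ext (S (S n)) (fun z v => v * F' z v + f z * Cpow v (S (S n)))%C).
    + intros z v Hz. rewrite E by exact Hz. simpl. ring.
    + apply (APpoly_S (S n) (fun z v => v * F' z v)%C); [apply IH, HF'|exact Hf].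
Qed.

Lemma APpoly_shift_pow (n k : nat) (F : C -> C -> C) : APpoly a b n F ->
  APpoly a b (k + n) (fun z v => Cpow v k * F z v)%C.
Proof.
  intros H. induction k as [|k IH]; simpl.
  - apply (APpoly_ext n F); [intros; ring|exact H].
  - apply (APpoly_ext (S (k + n)) (fun z v => v * (Cpow v k * F z v))%C); [intros; ring|].
    apply (APpoly_shift (k + n) (fun z v => Cpow v k * F z v)%C), IH.
Qed.

Lemma APpoly_mult (n m : nat) (F G : C -> C -> C) : APpoly a b n F -> APpoly a b m G ->
  APpoly a b (n + m) (fun z v => F z v * G z v)%C.
Proof.
  revert F. induction n as [|n IH]; intros F HF HG.
  - destruct HF as [p [Hp E]].
    apply (APpoly_ext m (fun z v => p O z * G z v)%C).
    + intros z v Hz. rewrite E by exact Hz. reflexivity.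
    + apply APpoly_scal; auto.
  - destruct (APpoly_inv n F HF) as [F' [f [HF' [Hf E]]]].
    apply (APpoly_ext (S n + m) (fun z v => F' z v * G z v + f z * (Cpow v (S n) * G z v))%C).
    + intros z v Hz. rewrite E by exact Hz. ring.
    + apply (APpoly_plus (S n + m) (fun z v => F' z v * G z v)%C (fun z v => f z * (Cpow v (S n) * G z v))%C).
      * apply (APpoly_le (n + m)); [lia|]. apply IH; assumption.
      * apply (APpoly_scal (S n + m) f (fun z v => Cpow v (S n) * G z v)%C Hf).
        apply APpoly_shift_pow, HG.
Qed.

Lemma APpoly_opp (n : nat) (F : C -> C -> C) : APpoly a b n F -> APpoly a b n (fun z v => - F z v)%C.
Proof.
  intros H. apply (APpoly_ext n (fun z v => RtoC (-1) * F z v)%C).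
  - intros. apply injective_projections; simpl; ring.
  - apply (APpoly_scal n (fun _ => RtoC (-1))); [apply APH_const|exact H].
Qed.

Lemma psum_HB (p : nat -> C -> C) (u : C -> C) (n : nat) : (forall k, HB a b (p k)) -> HB a b u ->
  HB a b (fun z => psum p z (u z) n).
Proof.
  intros Hp Hu. induction n as [|n IH]; simpl; [apply Hp|].
  apply (HB_plus a b (fun z => psum p z (u z) n) (fun z => p (S n) z * (u z * Cpow (u z) n))%C IH).
  apply HB_mult; [apply Hp|]. apply (HB_mult a b u (fun z => Cpow (u z) n) Hu).
  clear IH. induction n as [|n IH]; simpl; [apply HB_const|].
  apply (HB_mult a b u (fun z => Cpow (u z) n)); assumption.
Qed.

Lemma HB_ext_strip_zero (f g : C -> C) : (forall z, strip a b z -> f z = g z) -> HB a b f -> HB a b g.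
Proof.
  intros H [F1 F2]. split.
  - intros z Hz. destruct (strip_open a b z Hz) as [r [Hr O]].
    apply (Cdiff_local f g z r Hr); [|apply F1, Hz]. intros w Hw. apply H, O. lra.
  - intros a' b' Hs. destruct (F2 a' b' Hs) as [M [HM B]]. exists M. split; [exact HM|].
    intros z Hz. rewrite <- H; [apply B, Hz|]. apply (rstrip_strip a' b'); assumption.
Qed.

Lemma APpoly_HB (n : nat) (F : C -> C -> C) (u : C -> C) : APpoly a b n F -> HB a b u ->
  HB a b (fun z => F z (u z)).
Proof.
  intros [p [Hp E]] Hu. apply (HB_ext_strip_zero (fun z => psum p z (u z) n)).
  - intros z Hz. symmetry. apply E, Hz.
  - apply psum_HB; [intros k; apply Hp|exact Hu].
Qed.

(** The coefficients form a ring, not a field: a leading coefficient may have zeros, but it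
    is not the zero function. *)
Definition exact_degree (n : nat) (F : C -> C -> C) : Prop :=
  match n with
  | O => exists f, APH a b f /\ non_null a b f /\ forall z v, strip a b z -> F z v = f z
  | S k => exists F' f, APpoly a b k F' /\ APH a b f /\ non_null a b f /\
       forall z v, strip a b z -> F z v = (F' z v + f z * Cpow v (S k))%C
  end.

Lemma degree_or_zero (n : nat) (F : C -> C -> C) : APpoly a b n F ->
  (forall z v, strip a b z -> F z v = RtoC 0) \/ exists e, (e <= n)%nat /\ exact_degree e F.
Proof.
  revert F. induction n as [|n IH]; intros F H.
  - destruct H as [p [Hp E]].
    destruct (classic (non_null a b (p O))) as [N|N].
    + right. exists O. split; [lia|]. exists (p O). auto.
    + left. intros z v Hz. rewrite E by exact Hz. apply (not_non_null a b _ N z Hz).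
  - destruct (APpoly_inv n F H) as [F' [f [HF' [Hf E]]]].
    destruct (classic (non_null a b f)) as [N|N].
    + right. exists (S n). split; [lia|]. exists F', f. auto.
    + assert (HF : APpoly a b n F).
      { apply (APpoly_ext n F' F); [|exact HF'].
        intros z v Hz. rewrite E, (not_non_null a b f N z Hz) by exact Hz. ring. }
      destruct (IH F HF) as [Z|[e [He X]]]; [left; exact Z|].
      right. exists e. split; [lia|exact X].
Qed.

Lemma exact_degree_APpoly (n : nat) (F : C -> C -> C) : exact_degree n F -> APpoly a b n F.
Proof.
  destruct n as [|n].
  - intros [f [Hf [_ E]]]. apply (APpoly_ext 0 (fun z _ => f z)); [|apply APpoly_0, Hf].
    intros z v Hz. symmetry. apply E, Hz.
  - intros [F' [f [HF' [Hf [_ E]]]]].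
    apply (APpoly_ext (S n) (fun z v => F' z v + f z * Cpow v (S n))%C).
    + intros z v Hz. symmetry. apply E, Hz.
    + apply APpoly_S; assumption.
Qed.

(** The leading coefficient [g] of the divisor need not be invertible, so the dividend is
    multiplied by a power of [g] before leading terms are cancelled. *)
Lemma pseudo_division (d : nat) (G G' : C -> C -> C) (g : C -> C) : APpoly a b d G' -> APH a b g ->
  (forall z v, strip a b z -> G z v = (G' z v + g z * Cpow v (S d))%C) ->
  forall k F, APpoly a b (S k + d) F -> exists Q R, APpoly a b k Q /\ APpoly a b d R /\
    forall z v, strip a b z -> (Cpow (g z) (S k) * F z v = Q z v * G z v + R z v)%C.
Proof.
  intros HG' Hg EG. induction k as [|k IH]; intros F HF.
  - destruct (APpoly_inv d F HF) as [F' [f [HF' [Hf E]]]].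
    exists (fun z _ => f z), (fun z v => g z * F' z v + - (f z * G' z v))%C.
    split; [apply APpoly_0, Hf|]. split.
    + apply (APpoly_plus d (fun z v => g z * F' z v)%C (fun z v => - (f z * G' z v))%C).
      * apply APpoly_scal; assumption.
      * apply (APpoly_opp d (fun z v => f z * G' z v)%C), APpoly_scal; assumption.
    + intros z v Hz. rewrite E, EG by exact Hz. simpl. ring.
  - destruct (APpoly_inv (S k + d) F HF) as [F' [f [HF' [Hf E]]]].
    set (F1 := fun z v => (g z * F' z v + - (f z * (Cpow v (S k) * G' z v)))%C).
    assert (HF1 : APpoly a b (S k + d) F1).
    { apply (APpoly_plus (S k + d) (fun z v => g z * F' z v)%C
        (fun z v => - (f z * (Cpow v (S k) * G' z v)))%C).
      - apply APpoly_scal; assumption.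
      - apply (APpoly_opp (S k + d) (fun z v => f z * (Cpow v (S k) * G' z v))%C).
        apply (APpoly_scal (S k + d) f (fun z v => Cpow v (S k) * G' z v)%C Hf).
        apply APpoly_shift_pow, HG'. }
    destruct (IH F1 HF1) as [Q [R [HQ [HR EQ]]]].
    exists (fun z v => Q z v + Cpow (g z) (S k) * f z * Cpow v (S k))%C, R.
    split; [|split; [exact HR|]].
    + apply (APpoly_S k Q (fun z => Cpow (g z) (S k) * f z)%C HQ).
      apply (APH_mult a b (fun z => Cpow (g z) (S k)) f); [apply APH_pow, Hg|exact Hf].
    + intros z v Hz. rewrite E by exact Hz.
      assert (EE : (Cpow (g z) (S (S k)) * (F' z v + f z * Cpow v (S (S k + d))))%C
        = (Cpow (g z) (S k) * F1 z v + Cpow (g z) (S k) * f z * Cpow v (S k) * G z v)%C).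
      { unfold F1. rewrite EG by exact Hz.
        replace (S (S k + d)) with (S k + S d)%nat by lia. rewrite Cpow_add_r.
        change (Cpow (g z) (S (S k))) with (g z * Cpow (g z) (S k))%C.
        generalize (Cpow (g z) (S k)) (Cpow v (S k)) (Cpow v (S d)). intros x y w. ring. }
      rewrite EE, EQ by exact Hz. ring.
Qed.

Definition minimal (u : C -> C) (m : nat) (P : C -> C -> C) : Prop :=
  APpoly a b m P /\ (forall z, strip a b z -> P z (u z) = RtoC 0) /\
  (exists z v, strip a b z /\ P z v <> RtoC 0) /\
  forall n F, (n < m)%nat -> APpoly a b n F -> (forall z, strip a b z -> F z (u z) = RtoC 0) ->
    forall z v, strip a b z -> F z v = RtoC 0.

Lemma minimal_exists (u : C -> C) (n : nat) (F : C -> C -> C) : APpoly a b n F ->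
  (forall z, strip a b z -> F z (u z) = RtoC 0) -> (exists z v, strip a b z /\ F z v <> RtoC 0) ->
  exists m P, minimal u m P.
Proof.
  revert F. induction n as [n IH] using lt_wf_ind. intros F HF E N.
  destruct (classic (exists k G, (k < n)%nat /\ APpoly a b k G /\
    (forall z, strip a b z -> G z (u z) = RtoC 0) /\ (exists z v, strip a b z /\ G z v <> RtoC 0)))
    as [[k [G [Hk [H1 [H2 H3]]]]]|No].
  - apply (IH k Hk G); assumption.
  - exists n, F. split; [exact HF|]. split; [exact E|]. split; [exact N|].
    intros k G Hk HG EG z v Hz. apply NNPP. intros Hne. apply No.
    exists k, G. repeat split; auto. exists z, v. auto.
Qed.

(** The minimal polynomial is coprime to every polynomial of smaller degree: Euclid's
    algorithm cannot stop at a zero remainder, as [P] would factor up to a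
    scalar and [u] would be a root of a factor. *)
Lemma minimal_bezout (u : C -> C) (m : nat) (P : C -> C -> C) : HB a b u -> minimal u m P ->
  forall n G, (n < m)%nat -> exact_degree n G ->
  exists X Y N D, APpoly a b N X /\ APpoly a b N Y /\ APH a b D /\ non_null a b D /\
    forall z v, strip a b z -> (X z v * P z v + Y z v * G z v = D z)%C.
Proof.
  intros Hu [HP [EP [NP Min]]]. induction n as [n IH] using lt_wf_ind. intros G Hn HG.
  destruct n as [|d].
  - destruct HG as [f [Hf [Nf E]]].
    exists (fun _ _ => RtoC 0), (fun _ _ => RtoC 1), O, f.
    split; [apply (APpoly_0 (fun _ => RtoC 0)), APH_const|].
    split; [apply (APpoly_0 (fun _ => RtoC 1)), APH_const|].
    split; [exact Hf|]. split; [exact Nf|]. intros z v Hz. rewrite E by exact Hz. ring.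
  - assert (HGp := exact_degree_APpoly _ _ HG).
    destruct HG as [G' [g [HG' [Hg [Ng EG]]]]].
    set (k := (m - S d)%nat).
    destruct (pseudo_division d G G' g HG' Hg EG k P) as [Q [R [HQ [HR E]]]].
    { apply (APpoly_le m); [unfold k; lia|exact HP]. }
    destruct (degree_or_zero d R HR) as [Z|[e [He XR]]].
    + exfalso. destruct NP as [z0 [v0 [Hz0 N0]]].
      assert (HgP : HB a b (fun z => Cpow (g z) (S k))) by (apply APH_pow, Hg).
      assert (QG : (forall z v, strip a b z -> Q z v = RtoC 0) \/ (forall z v, strip a b z -> G z v = RtoC 0)).
      { destruct (HB_integral a b (fun z => Q z (u z)) (fun z => G z (u z))) as [A|A].
        - apply (APpoly_HB k); assumption.
        - apply (APpoly_HB (S d)); assumption.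
        - intros z Hz. assert (X := E z (u z) Hz). rewrite EP, Z in X by exact Hz.
          replace (Q z (u z) * G z (u z))%C with (Q z (u z) * G z (u z) + 0)%C by ring.
          rewrite <- X. ring.
        - left. apply (Min k); [unfold k; lia|exact HQ|exact A].
        - right. apply (Min (S d)); [lia|exact HGp|exact A]. }
      destruct (HB_integral a b (fun z => Cpow (g z) (S k)) (fun z => P z v0) HgP) as [A|A].
      * apply (APpoly_HB m P (fun _ => v0) HP), HB_const.
      * intros z Hz. rewrite E, Z by exact Hz.
        destruct QG as [W|W]; rewrite W by exact Hz; ring.
      * destruct (non_null_pow a b g (S k) Ng) as [z1 [Hz1 N1]]. apply N1, A, Hz1.
      * apply N0, A, Hz0.
    + destruct (IH e ltac:(lia) R ltac:(lia) XR) as [X [Y [N [D [HX [HY [HD [ND EX]]]]]]]].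
      exists (fun z v => X z v + Cpow (g z) (S k) * Y z v)%C, (fun z v => - (Y z v * Q z v))%C,
        (N + k)%nat, D.
      split; [|split; [|split; [exact HD|split; [exact ND|]]]].
      * apply (APpoly_le N); [lia|].
        apply (APpoly_plus N X (fun z v => Cpow (g z) (S k) * Y z v)%C HX).
        apply (APpoly_scal N (fun z => Cpow (g z) (S k))); [apply APH_pow, Hg|exact HY].
      * apply (APpoly_opp (N + k) (fun z v => Y z v * Q z v)%C), APpoly_mult; assumption.
      * intros z v Hz. rewrite <- (EX z v Hz).
        replace (R z v) with (Cpow (g z) (S k) * P z v - Q z v * G z v)%C by (rewrite E by exact Hz; ring).
        ring.
Qed.

Lemma dpsum_APpoly (p : nat -> C -> C) (n : nat) : (forall k, APH a b (p k)) ->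
  APpoly a b n (fun z v => dpsum p z v (S n)).
Proof.
  intros Hp. induction n as [|n IH].
  - apply (APpoly_ext 0 (fun z _ => p 1%nat z)); [|apply APpoly_0, Hp].
    intros z v _. simpl. ring.
  - apply (APpoly_S n (fun z v => dpsum p z v (S n)) (fun z => RtoC (INR (S (S n))) * p (S (S n)) z)%C IH).
    apply APH_mult; [apply APH_const|apply Hp].
Qed.

(** Hence a root of some nonzero polynomial is, for its minimal polynomial, simple
    wherever a certain nonzero almost periodic function [D] does not vanish. *)
Lemma separable_equation (u : C -> C) (n : nat) (F : C -> C -> C) : HB a b u -> APpoly a b n F ->
  (forall z, strip a b z -> F z (u z) = RtoC 0) -> (exists z v, strip a b z /\ F z v <> RtoC 0) ->
  exists m p y D, (forall k, APH a b (p k)) /\ (forall z, strip a b z -> psum p z (u z) m = RtoC 0) /\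
    bdd a b y /\ APH a b D /\ non_null a b D /\
    forall z, strip a b z -> (y z * dpsum p z (u z) m = D z)%C.
Proof.
  intros Hu HF EF NF. destruct (minimal_exists u n F HF EF NF) as [m [P HP]].
  assert (HP' := HP). destruct HP as [[p [Hp EP]] [RP [NP Min]]].
  assert (Rp : forall z, strip a b z -> psum p z (u z) m = RtoC 0).
  { intros z Hz. rewrite <- EP by exact Hz. apply RP, Hz. }
  destruct m as [|d].
  - exfalso. destruct NP as [z [v [Hz N]]]. apply N. rewrite EP by exact Hz. apply (Rp z Hz).
  - assert (Np : non_null a b (p (S d))).
    { apply NNPP. intros No. destruct NP as [z0 [v0 [Hz0 N0]]].
      assert (E : forall z v, strip a b z -> P z v = psum p z v d).
      { intros z v Hz. rewrite EP by exact Hz. simpl psum.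
        rewrite (not_non_null a b _ No z Hz). ring. }
      apply N0. apply (Min d P); [lia| |exact RP|exact Hz0].
      exists p. split; assumption. }
    assert (Ex : exact_degree d (fun z v => dpsum p z v (S d))).
    { assert (Nl : non_null a b (fun z => RtoC (INR (S d)) * p (S d) z)%C).
      { destruct Np as [z [Hz N]]. exists z. split; [exact Hz|]. apply Cmult_neq_0; [|exact N].
        intros E. injection E. intros E'. apply (not_0_INR (S d)); [lia|exact E']. }
      assert (Hl : APH a b (fun z => RtoC (INR (S d)) * p (S d) z)%C)
        by (apply APH_mult; [apply APH_const|apply Hp]).
      destruct d as [|e].
      - exists (fun z => RtoC (INR 1) * p 1%nat z)%C. split; [exact Hl|]. split; [exact Nl|].
        intros z v _. simpl. ring.
      - exists (fun z v => dpsum p z v (S e)), (fun z => RtoC (INR (S (S e))) * p (S (S e)) z)%C.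
        split; [apply dpsum_APpoly, Hp|]. split; [exact Hl|]. split; [exact Nl|].
        intros z v _. reflexivity. }
    destruct (minimal_bezout u (S d) P Hu HP' d _ ltac:(lia) Ex)
      as [X [Y [N [D [HX [HY [HD [ND E]]]]]]]].
    exists (S d), p, (fun z => Y z (u z)), D.
    split; [exact Hp|]. split; [exact Rp|].
    split; [apply (APpoly_HB N); assumption|].
    split; [exact HD|]. split; [exact ND|].
    intros z Hz. rewrite <- (E z (u z) Hz), RP by exact Hz. ring.
Qed.

End Polynomials.

(** * Estimates for polynomials in [v] *)

Lemma Cpow_taylor (M : R) (k : nat) : 0 <= M -> exists K, 0 <= K /\ forall u v,
  Cmod u <= M -> Cmod v <= M ->
  Cmod (Cpow v (S k) - Cpow u (S k) - RtoC (INR (S k)) * Cpow u k * (v - u))%C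
    <= K * (Cmod (v - u) * Cmod (v - u)).
Proof.
  intros HM. induction k as [|k [K [HK IH]]].
  - exists 0. split; [lra|]. intros u v _ _. simpl.
    replace (v * 1 - u * 1 - 1 * 1 * (v - u))%C with (RtoC 0) by ring. rewrite Cmod_0. lra.
  - exists (M * K + INR (S k) * M ^ k). assert (HI := pos_INR (S k)).
    assert (HMk : 0 <= M ^ k) by (apply pow_le; exact HM).
    split; [apply Rplus_le_le_0_compat; apply Rmult_le_pos; assumption|].
    intros u v Hu Hv. specialize (IH u v Hu Hv).
    set (t := Cmod (v - u)) in *.
    replace (Cpow v (S (S k)) - Cpow u (S (S k)) - RtoC (INR (S (S k))) * Cpow u (S k) * (v - u))%C
      with (v * (Cpow v (S k) - Cpow u (S k) - RtoC (INR (S k)) * Cpow u k * (v - u))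
            + RtoC (INR (S k)) * Cpow u k * ((v - u) * (v - u)))%C.
    + eapply Rle_trans; [apply Cmod_triangle|]. rewrite !Cmod_mult, Cmod_R, Cmod_pow.
      rewrite (Rabs_pos_eq (INR (S k))) by exact HI. fold t. rewrite Rmult_plus_distr_r.
      assert (Ht : 0 <= t * t) by (apply Rmult_le_pos; apply Cmod_ge_0).
      apply Rplus_le_compat.
      * rewrite Rmult_assoc. apply Rmult_le_compat; auto using Cmod_ge_0.
      * apply Rmult_le_compat_r; [exact Ht|]. apply Rmult_le_compat_l; [exact HI|].
        apply pow_incr. split; [apply Cmod_ge_0|exact Hu].
    + rewrite (S_INR (S k)), RtoC_plus. simpl Cpow. generalize (RtoC (INR (S k))). intros x. ring.
Qed.

Lemma psum_taylor (B M : R) (n : nat) : 0 <= B -> 0 <= M -> exists K, 0 <= K /\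
  forall (p : nat -> C -> C) z u v, (forall k, (k <= n)%nat -> Cmod (p k z) <= B) ->
  Cmod u <= M -> Cmod v <= M ->
  Cmod (psum p z v n - psum p z u n - dpsum p z u n * (v - u))%C
    <= K * (Cmod (v - u) * Cmod (v - u)).
Proof.
  intros HB HM. induction n as [|n [K [HK IH]]].
  - exists 0. split; [lra|]. intros p z u v _ _ _. simpl.
    replace (p O z - p O z - 0 * (v - u))%C with (RtoC 0) by ring. rewrite Cmod_0. lra.
  - destruct (Cpow_taylor M n HM) as [L [HL HT]].
    exists (K + B * L). split; [apply Rplus_le_le_0_compat; [exact HK|apply Rmult_le_pos; assumption]|].
    intros p z u v Hp Hu Hv.
    specialize (IH p z u v ltac:(intros; apply Hp; lia) Hu Hv). specialize (HT u v Hu Hv).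
    set (t := Cmod (v - u)) in *.
    change (psum p z v (S n)) with (psum p z v n + p (S n) z * Cpow v (S n))%C.
    change (psum p z u (S n)) with (psum p z u n + p (S n) z * Cpow u (S n))%C.
    change (dpsum p z u (S n)) with (dpsum p z u n + RtoC (INR (S n)) * p (S n) z * Cpow u n)%C.
    replace (psum p z v n + p (S n) z * Cpow v (S n) - (psum p z u n + p (S n) z * Cpow u (S n))
       - (dpsum p z u n + RtoC (INR (S n)) * p (S n) z * Cpow u n) * (v - u))%C
      with ((psum p z v n - psum p z u n - dpsum p z u n * (v - u)) +
        p (S n) z * (Cpow v (S n) - Cpow u (S n) - RtoC (INR (S n)) * Cpow u n * (v - u)))%C by ring.
    eapply Rle_trans; [apply Cmod_triangle|]. rewrite Cmod_mult, Rmult_plus_distr_r.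
    apply Rplus_le_compat; [exact IH|]. rewrite Rmult_assoc.
    apply Rmult_le_compat; auto using Cmod_ge_0.
Qed.

Lemma psum_coef_close (M e : R) (p q : nat -> C -> C) (z w v : C) (n : nat) : 1 <= M -> 0 <= e ->
  (forall k, (k <= n)%nat -> Cmod (p k z - q k w) <= e) -> Cmod v <= M ->
  Cmod (psum p z v n - psum q w v n) <= INR (S n) * (e * M ^ n).
Proof.
  intros HM He H Hv. induction n as [|n IH].
  - simpl. specialize (H O (le_n O)). lra.
  - change (psum p z v (S n)) with (psum p z v n + p (S n) z * Cpow v (S n))%C.
    change (psum q w v (S n)) with (psum q w v n + q (S n) w * Cpow v (S n))%C.
    replace (psum p z v n + p (S n) z * Cpow v (S n) - (psum q w v n + q (S n) w * Cpow v (S n)))%C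
      with ((psum p z v n - psum q w v n) + (p (S n) z - q (S n) w) * Cpow v (S n))%C by ring.
    eapply Rle_trans; [apply Cmod_triangle|]. rewrite Cmod_mult, Cmod_pow.
    specialize (IH ltac:(intros; apply H; lia)).
    assert (A : Cmod (p (S n) z - q (S n) w)%C * Cmod v ^ S n <= e * M ^ S n).
    { apply Rmult_le_compat; [apply Cmod_ge_0|apply pow_le, Cmod_ge_0|apply H; lia|].
      apply pow_incr. split; [apply Cmod_ge_0|exact Hv]. }
    assert (Mn : 0 < M ^ n) by (apply pow_lt; lra).
    assert (Mle : M ^ n <= M ^ S n) by (simpl; nra).
    rewrite (S_INR (S n)).
    assert (INR (S n) * (e * M ^ n) <= INR (S n) * (e * M ^ S n)).
    { apply Rmult_le_compat_l; [apply pos_INR|]. apply Rmult_le_compat_l; assumption. }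
    lra.
Qed.

(** * Holomorphic bounded roots are almost periodic *)

Definition clip (x : R) : R := Rmax (-1) (Rmin 1 x).

Lemma clip_bounds (x : R) : -1 <= clip x <= 1.
Proof.
  unfold clip. split; [apply Rmax_l|]. apply Rmax_lub; [lra|apply Rmin_l].
Qed.

Lemma clip_id (x : R) : Rabs x <= 1 -> clip x = x.
Proof.
  intros H. apply Rabs_le_between in H. unfold clip.
  rewrite Rmin_right, Rmax_right; lra.
Qed.

(** The disc is totally bounded; clipping turns the coordinates into bounded functions
    on all of [C]. *)
Lemma disc_pigeonhole (M d : R) : 0 < M -> 0 < d -> exists N, forall f : nat -> C,
  (forall j, Cmod (f j) <= M) -> exists i j, (i < j <= N)%nat /\ Cmod (f i - f j) <= d.
Proof.
  intros HM Hd.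
  set (e := d / (2 * M)). assert (He : 0 < e) by (apply Rdiv_lt_0_compat; lra).
  destruct (cov_pigeonhole (fun s t : C =>
     Rabs (clip (Re t / M) - clip (Re s / M)) <= e /\ Rabs (clip (Im t / M) - clip (Im s / M)) <= e))
    as [N HN].
  { apply cov_and.
    - apply (cov_bounded (fun t => clip (Re t / M))); [exact He|intros; apply clip_bounds].
    - apply (cov_bounded (fun t => clip (Im t / M))); [exact He|intros; apply clip_bounds]. }
  exists N. intros f Hf. destruct (HN f) as [i [j [Hij [E1 E2]]]].
  exists i, j. split; [exact Hij|].
  assert (Hq : forall x, Rabs x <= M -> Rabs (x / M) <= 1).
  { intros x Hx. unfold Rdiv. rewrite Rabs_mult, (Rabs_pos_eq (/ M)) by (left; apply Rinv_0_lt_compat, HM).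
    apply (Rmult_le_reg_r M); [exact HM|]. rewrite Rmult_assoc, Rinv_l, Rmult_1_r, Rmult_1_l by lra. exact Hx. }
  assert (Hc : forall x y, Rabs x <= M -> Rabs y <= M -> Rabs (clip (x / M) - clip (y / M)) <= e ->
     Rabs (y - x) <= d / 2).
  { intros x y Hx Hy. rewrite !clip_id by (apply Hq; assumption). intros H.
    replace (y - x) with (M * - (x / M - y / M)) by (field; lra).
    rewrite Rabs_mult, Rabs_Ropp, (Rabs_pos_eq M) by lra.
    apply Rle_trans with (M * e); [apply Rmult_le_compat_l; lra|]. right. unfold e. field. lra. }
  assert (R1 : forall j, Rabs (Re (f j)) <= M) by (intros; eapply Rle_trans; [apply Cmod_Re|apply Hf]).
  assert (R2 : forall j, Rabs (Im (f j)) <= M) by (intros; eapply Rle_trans; [apply Cmod_Im|apply Hf]).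
  specialize (Hc _ _ (R1 j) (R1 i) E1) as D1. specialize (Hc _ _ (R2 j) (R2 i) E2) as D2.
  replace (f i - f j)%C with (RtoC (Re (f i) - Re (f j)) + Ci * RtoC (Im (f i) - Im (f j)))%C
    by (apply injective_projections; unfold Re, Im; simpl; ring).
  eapply Rle_trans; [apply Cmod_triangle|]. rewrite Cmod_mult, Cmod_Ci, !Cmod_R. lra.
Qed.

Lemma Cmod_le_parts (z : C) : Cmod z <= Rabs (Re z) + Rabs (Im z).
Proof.
  replace z with (RtoC (Re z) + Ci * RtoC (Im z))%C at 1
    by (apply injective_projections; unfold Re, Im; simpl; ring).
  eapply Rle_trans; [apply Cmod_triangle|]. rewrite Cmod_mult, Cmod_Ci, !Cmod_R. lra.
Qed.

Lemma family_bound (a b : Rbar) (p : nat -> C -> C) (m : nat) (a' b' : R) :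
  (forall k, bdd a b (p k)) -> substrip a' b' a b ->
  exists B, 0 < B /\ forall k z, (k <= m)%nat -> rstrip a' b' z -> Cmod (p k z) <= B.
Proof.
  intros Hp Hs. induction m as [|m [B [HB H]]].
  - destruct (Hp O a' b' Hs) as [B [HB H]]. exists B. split; [exact HB|].
    intros k z Hk Hz. replace k with O by lia. apply H, Hz.
  - destruct (Hp (S m) a' b' Hs) as [B2 [HB2 H2]]. exists (B + B2). split; [lra|].
    intros k z Hk Hz. destruct (Nat.eq_dec k (S m)) as [->|Ne].
    + specialize (H2 z Hz). lra.
    + specialize (H k z ltac:(lia) Hz). lra.
Qed.

(** At a point where the root [u] is simple in a quantitative sense, an approximate root
    near [u] is very near to [u]. *)
Lemma root_dichotomy (B M kap : R) (m : nat) : 0 <= B -> 0 <= M -> 0 < kap ->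
  exists gam, 0 < gam /\ forall (p : nat -> C -> C) z u v,
    (forall k, (k <= m)%nat -> Cmod (p k z) <= B) -> Cmod u <= M -> Cmod v <= M ->
    psum p z u m = RtoC 0 -> kap <= Cmod (dpsum p z u m) -> Cmod (v - u) <= gam ->
    Cmod (v - u) <= 2 / kap * Cmod (psum p z v m).
Proof.
  intros HB HM Hk. destruct (psum_taylor B M m HB HM) as [K [HK H]].
  exists (kap / (2 * (K + 1))). split; [apply Rdiv_lt_0_compat; lra|].
  intros p z u v Hp Hu Hv E Hd Hg. specialize (H p z u v Hp Hu Hv).
  rewrite E in H. set (t := Cmod (v - u)) in *. assert (Ht : 0 <= t) by apply Cmod_ge_0.
  set (P := psum p z v m) in *. set (Q := dpsum p z u m) in *.
  assert (T := Cmod_tri_inv (Q * (v - u))%C P).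
  rewrite Cmod_minus_sym in T. rewrite Cmod_mult in T. fold t in T.
  replace (P - 0 - Q * (v - u))%C with (P - Q * (v - u))%C in H by ring.
  assert (H1 : kap * t <= Cmod Q * t) by (apply Rmult_le_compat_r; assumption).
  assert (H2 : K * t <= kap / 2).
  { apply Rle_trans with ((K + 1) * (kap / (2 * (K + 1)))); [|right; field; lra].
    apply Rmult_le_compat; lra. }
  assert (H3 : K * (t * t) <= kap / 2 * t).
  { rewrite <- Rmult_assoc. apply Rmult_le_compat_r; assumption. }
  apply (Rmult_le_reg_l (kap / 2)); [lra|].
  replace (kap / 2 * (2 / kap * Cmod P)) with (Cmod P) by (field; lra). lra.
Qed.

Section Root.

Variables (a b : Rbar) (m : nat) (p : nat -> C -> C) (u y D : C -> C).
Hypothesis (Hp : forall k, APH a b (p k)).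
Hypothesis (Hroot : forall z, strip a b z -> psum p z (u z) m = RtoC 0).
Hypothesis (Hu : HB a b u) (Hy : bdd a b y) (HD : APH a b D).
Hypothesis (HyD : forall z, strip a b z -> (y z * dpsum p z (u z) m)%C = D z).

(** The key step.  Fix [zs] with [D zs <> 0]; [al, be] bound a strip around [zs].
    If [tau] is a Bohr-small translation for which [u (z + tau)] and [u z] agree roughly at one
    good point [zs + g], they agree closely on the whole strip.  The dichotomy makes rough
    agreement near a good point very close, propagation carries it to the next good point,
    and good points are relatively dense. *)
Lemma agreement_spreads (zs : C) (al be : R) : substrip al be a b -> rstrip al be zs ->
  D zs <> RtoC 0 -> exists gam (G : R -> Prop), 0 < gam /\ near0 G /\
  forall eps, 0 < eps -> near0 (fun tau => forall g, G g ->
    Cmod (u (zs + RtoC g + RtoC tau) - u (zs + RtoC g))%C <= gam ->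
    forall z, rstrip al be z -> Cmod (u (z + RtoC tau) - u z)%C <= eps).
Proof.
  intros Hs Hzs HDz.
  destruct (substrip_margin al be a b Hs) as [R [HR Hs']].
  destruct (proj2 Hu _ _ Hs') as [M0 [HM0 BM0]].
  set (M := M0 + 1).
  assert (BM : forall z, rstrip (al - R) (be + R) z -> Cmod (u z) <= M)
    by (intros z Hz; specialize (BM0 z Hz); unfold M; lra).
  assert (HM : 1 <= M) by (unfold M; lra).
  destruct (Hy _ _ Hs') as [My [HMy BMy]].
  destruct (family_bound a b p m (al - R) (be + R)) as [B [HB BB]];
    [intros k; apply (Hp k)|exact Hs'|].
  assert (Inst : forall z, rstrip (al - R) (be + R) z -> strip a b z)
    by (intros; eapply rstrip_strip; eassumption).
  assert (Wid : forall z, rstrip al be z -> rstrip (al - R) (be + R) z)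
    by (intros; apply rstrip_widen; [lra|assumption]).
  assert (Sh : forall z t, rstrip al be z -> rstrip al be (z + RtoC t)%C)
    by (intros; apply rstrip_shift; assumption).
  assert (Dzs : 0 < Cmod (D zs)) by (apply Cmod_gt_0, HDz).
  set (c := Cmod (D zs) / 4).
  assert (Hc : 0 < c) by (unfold c; lra).
  destruct (nonzero_disc D zs (proj1 (proj1 HD) zs (Inst _ (Wid _ Hzs))) HDz) as [r1 [Hr1 N1]].
  set (r2 := Rmin (Im zs - al) (be - Im zs)).
  assert (Hr2 : 0 < r2) by (destruct Hzs; apply Rmin_pos; lra).
  assert (Hdisc : forall z, Cmod (z - zs) <= r2 / 2 -> rstrip al be z).
  { intros z Hz. assert (A := Cmod_Im (z - zs)%C).
    assert (E : Im (z - zs)%C = Im z - Im zs) by reflexivity. rewrite E in A.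
    assert (A' : Rabs (Im z - Im zs) <= r2 / 2) by lra. apply Rabs_le_between in A'.
    assert (r2 <= Im zs - al) by apply Rmin_l. assert (r2 <= be - Im zs) by apply Rmin_r.
    unfold rstrip. lra. }
  set (kap := c / My).
  assert (Hkap : 0 < kap) by (apply Rdiv_lt_0_compat; assumption).
  destruct (root_dichotomy B M kap m ltac:(lra) ltac:(lra) Hkap) as [gam [Hgam Dich]].
  set (G := fun g => forall z, rstrip al be z -> Cmod (D (z + RtoC g) - D z)%C <= c).
  assert (HG : near0 G) by (apply (proj2 HD); assumption).
  exists (gam / 2), G. split; [lra|]. split; [exact HG|].
  intros eps0 Heps0.
  set (eps := Rmin eps0 (gam / 2)).
  assert (Heps : 0 < eps) by (apply Rmin_pos; lra).
  assert (He1 : eps <= eps0) by apply Rmin_l. assert (He2 : eps <= gam / 2) by apply Rmin_r.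
  destruct (near0_dense G HG) as [L [HL Dense]].
  set (Lam := 4 * (2 * M) / R).
  assert (HLam : 0 < Lam) by (apply Rdiv_lt_0_compat; lra).
  set (rho := Rmin (Rmin r1 (r2 / 2)) (Rmin (R / 2) (gam / (2 * Lam)))).
  assert (Hrho : 0 < rho).
  { apply Rmin_pos; apply Rmin_pos; try lra. apply Rdiv_lt_0_compat; lra. }
  assert (Q1 : rho <= r1) by (Rmin_le).
  assert (Q2 : rho <= r2 / 2) by (Rmin_le).
  assert (Q3 : rho <= R / 2) by (Rmin_le).
  assert (Q4 : Lam * rho <= gam / 2).
  { apply Rle_trans with (Lam * (gam / (2 * Lam))); [|right; field; lra].
    apply Rmult_le_compat_l; [lra|]. Rmin_le. }
  set (Dst := 2 * L + 2 + (be - al)).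
  destruct (propagation al be R (2 * M) rho Dst eps ltac:(lra) HR Hrho Heps) as [eta [Heta Carry]].
  set (e := eta * kap / 2 / (INR (S m) * M ^ m)).
  assert (HMm : 0 < M ^ m) by (apply pow_lt; lra).
  assert (HSm : 0 < INR (S m)) by (apply lt_0_INR; lia).
  assert (HIM : 0 < INR (S m) * M ^ m) by (apply Rmult_lt_0_compat; assumption).
  assert (He : 0 < e).
  { apply Rdiv_lt_0_compat; [|exact HIM]. assert (0 < eta * kap) by (apply Rmult_lt_0_compat; assumption). lra. }
  apply near0_imp with (2 := near0_forall_le
     (fun k t => forall z, rstrip al be z -> Cmod (p k (z + RtoC t) - p k z)%C <= e) m
     (fun k _ => proj2 (Hp k) al be Hs e He)).
  intros tau Htau g0 Hg0 Hstart.
  set (d := fun z => (u (z + RtoC tau) - u z)%C).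
  assert (Hd : forall z, rstrip (al - R) (be + R) z -> Cdiff d z /\ Cmod (d z) <= 2 * M).
  { intros z Hz. assert (Hz' := rstrip_shift _ _ z tau Hz). split.
    - apply Cdiff_minus; [|apply (proj1 Hu), Inst, Hz].
      apply Cdiff_comp_shift. apply (proj1 Hu), Inst, Hz'.
    - unfold d. eapply Rle_trans; [apply Cmod_minus_le|].
      assert (A1 := BM z Hz). assert (A2 := BM _ Hz'). lra. }
  assert (Close : forall z, rstrip al be z -> c <= Cmod (D z) -> Cmod (d z) <= gam -> Cmod (d z) <= eta).
  { intros z Hz Hcz Hgz.
    assert (Hz1 := Wid z Hz). assert (Hz2 := Wid _ (Sh z tau Hz)).
    assert (Hpz : Cmod (psum p z (u (z + RtoC tau)) m) <= eta * kap / 2).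
    { assert (E := Hroot _ (Inst _ Hz2)).
      replace (psum p z (u (z + RtoC tau)%C) m)
        with (- (psum p (z + RtoC tau) (u (z + RtoC tau)%C) m - psum p z (u (z + RtoC tau)%C) m))%C
        by (rewrite E; ring).
      rewrite Cmod_opp.
      eapply Rle_trans; [apply (psum_coef_close M e p p); [lra|lra| |apply BM, Hz2]|].
      - intros k Hk. apply (Htau k Hk z Hz).
      - unfold e. right. field. split; apply Rgt_not_eq; assumption. }
    assert (Hdp : kap <= Cmod (dpsum p z (u z) m)).
    { assert (E := HyD z (Inst z Hz1)). assert (EC := f_equal Cmod E). rewrite Cmod_mult in EC.
      assert (A := BMy z Hz1). unfold kap. apply (Rmult_le_reg_l My); [exact HMy|].
      replace (My * (c / My)) with c by (field; lra).
      eapply Rle_trans; [exact Hcz|]. rewrite <- EC. apply Rmult_le_compat_r; [apply Cmod_ge_0|exact A]. }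
    assert (A := Dich p z (u z) (u (z + RtoC tau)%C)
      ltac:(intros k Hk; apply BB; assumption) (BM z Hz1) (BM _ Hz2) (Hroot z (Inst z Hz1)) Hdp Hgz).
    unfold d. eapply Rle_trans; [exact A|].
    apply Rle_trans with (2 / kap * (eta * kap / 2)); [|right; field; lra].
    apply Rmult_le_compat_l; [|exact Hpz]. left. apply Rdiv_lt_0_compat; lra. }
  assert (Step : forall g, G g -> Cmod (d (zs + RtoC g)%C) <= gam / 2 ->
     forall z, rstrip al be z -> Rabs (Re z - Re zs - g) <= 2 * L + 2 -> Cmod (d z) <= eps).
  { intros g Hg Hdg z Hz HRe.
    assert (Hzg : rstrip al be (zs + RtoC g)%C) by (apply Sh, Hzs).
    apply (Carry d Hd (zs + RtoC g)%C Hzg); [|exact Hz|].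
    - intros w Hw.
      assert (Hw' : Cmod (w - RtoC g - zs) <= rho).
      { replace (w - RtoC g - zs)%C with (w - (zs + RtoC g))%C by ring. exact Hw. }
      assert (Hwi : rstrip al be (w - RtoC g)%C) by (apply Hdisc; lra).
      assert (Ew : w = (w - RtoC g + RtoC g)%C) by ring.
      assert (Hw0 : rstrip al be w) by (rewrite Ew; apply Sh, Hwi).
      apply Close; [exact Hw0| |].
      + assert (A := N1 (w - RtoC g)%C ltac:(lra)). assert (A2 := Hg _ Hwi).
        rewrite <- Ew in A2. rewrite Cmod_minus_sym in A2.
        assert (T := Cmod_tri_inv (D (w - RtoC g)%C) (D w)). unfold c in *. lra.
      + assert (Hin : forall x, Cmod (x - (zs + RtoC g))%C <= R -> rstrip (al - R) (be + R) x)
          by (intros x Hx; apply (rstrip_disc al be R (zs + RtoC g)%C); assumption).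
        assert (Lip := disc_lipschitz d (zs + RtoC g)%C R (2 * M) HR
          (fun x Hx => proj1 (Hd x (Hin x Hx)))
          (fun x Hx => proj2 (Hd x (Hin x ltac:(lra)))) w ltac:(lra)).
        fold Lam in Lip.
        assert (Lam * Cmod (w - (zs + RtoC g))%C <= Lam * rho) by (apply Rmult_le_compat_l; lra).
        assert (T := Cmod_tri_inv (d w) (d (zs + RtoC g)%C)). lra.
    - eapply Rle_trans; [apply Cmod_le_parts|].
      assert (E1 : Re (z - (zs + RtoC g))%C = Re z - Re zs - g) by (unfold Re; simpl; ring).
      assert (E2 : Im (z - (zs + RtoC g))%C = Im z - Im zs) by (unfold Im; simpl; ring).
      rewrite E1, E2.
      assert (Rabs (Im z - Im zs) <= be - al) by (destruct Hz, Hzs; apply Rabs_le; lra).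
      unfold Dst. lra. }
  assert (Chain : forall n x, Rabs (x - g0) <= INR n ->
     exists g, G g /\ Rabs (g - x) <= L /\ Cmod (d (zs + RtoC g)%C) <= gam / 2).
  { induction n as [|n IH]; intros x Hx.
    - exists g0. split; [exact Hg0|]. split; [|exact Hstart].
      rewrite Rabs_minus_sym. simpl in Hx. lra.
    - rewrite S_INR in Hx. set (k := INR n) in *. assert (Hk : 0 <= k) by apply pos_INR.
      assert (Hk1 : 0 < / (k + 1)) by (apply Rinv_0_lt_compat; lra).
      destruct (IH (g0 + k / (k + 1) * (x - g0))) as [g' [Hg' [Hx' Hdg']]].
      { replace (g0 + k / (k + 1) * (x - g0) - g0) with (k * / (k + 1) * (x - g0)) by (field; lra).
        rewrite Rabs_mult, (Rabs_pos_eq (k * / (k + 1))) by (apply Rmult_le_pos; lra).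
        apply Rle_trans with (k * / (k + 1) * (k + 1)); [|right; field; lra].
        apply Rmult_le_compat_l; [apply Rmult_le_pos; lra|exact Hx]. }
      destruct (Dense x) as [g [Hgx Hg]].
      exists g. split; [exact Hg|]. split; [exact Hgx|].
      eapply Rle_trans; [|exact He2].
      apply (Step g' Hg' Hdg'); [apply Sh, Hzs|].
      replace (Re (zs + RtoC g)%C - Re zs - g') with
        ((g - x) + (x - (g0 + k / (k + 1) * (x - g0))) + (g0 + k / (k + 1) * (x - g0) - g'))
        by (unfold Re; simpl; ring).
      eapply Rle_trans; [apply Rabs_triang|].
      eapply Rle_trans; [apply Rplus_le_compat_r, Rabs_triang|].
      rewrite (Rabs_minus_sym (g0 + k / (k + 1) * (x - g0)) g').
      assert (Rabs (x - (g0 + k / (k + 1) * (x - g0))) <= 1).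
      { replace (x - (g0 + k / (k + 1) * (x - g0))) with (/ (k + 1) * (x - g0)) by (field; lra).
        rewrite Rabs_mult, (Rabs_pos_eq (/ (k + 1))) by lra.
        apply Rle_trans with (/ (k + 1) * (k + 1)); [apply Rmult_le_compat_l; lra|right; field; lra]. }
      lra. }
  intros z Hz.
  destruct (INR_unbounded (Rabs (Re z - Re zs - g0))) as [n Hn].
  destruct (Chain n (Re z - Re zs) ltac:(lra)) as [g [Hg [Hgz Hdg]]].
  eapply Rle_trans; [|exact He1]. apply (Step g Hg Hdg z Hz).
  rewrite Rabs_minus_sym. lra.
Qed.

Lemma translate_multiple (al be eps t : R) : (forall z, rstrip al be z -> Cmod (u (z + RtoC t) - u z)%C <= eps) ->
  forall q z, rstrip al be z -> Cmod (u (z + RtoC (INR q * t)) - u z)%C <= INR q * eps.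
Proof.
  intros H q. induction q as [|q IH]; intros z Hz.
  - simpl INR. rewrite !Rmult_0_l. replace (z + RtoC 0)%C with z by ring.
    replace (u z - u z)%C with (RtoC 0) by ring. rewrite Cmod_0. lra.
  - rewrite S_INR. replace ((INR q + 1) * eps) with (eps + INR q * eps) by ring.
    eapply Rle_trans; [apply (Cmod_tri3 _ (u (z + RtoC (INR q * t))%C))|].
    apply Rplus_le_compat; [|apply IH, Hz].
    replace (z + RtoC ((INR q + 1) * t))%C with (z + RtoC (INR q * t) + RtoC t)%C
      by (rewrite !RtoC_mult, RtoC_plus; ring).
    apply H, rstrip_shift, Hz.
Qed.

(** Among the translates of [u] by [0, t, .., N t], with [t] Bohr-small, two agree roughly at
    [zs], hence everywhere; so [(j - i) t], and with it [N! t], is an almost period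
    of [u].  As [R] is divisible, the numbers [N! t] form a Bohr neighbourhood. *)
Lemma root_bap : non_null a b D -> bap a b u.
Proof.
  intros [zs [Hzs HDz]] a' b' Hs0 eps Heps.
  destruct (substrip_point a b zs Hzs) as [a1 [b1 [Hs1 Hz1]]].
  assert (Hs := substrip_union _ _ _ _ _ _ Hs0 Hs1).
  assert (Hz2 := rstrip_union_r a' b' a1 b1 zs Hz1).
  assert (Hin : forall z, rstrip a' b' z -> rstrip (Rmin a' a1) (Rmax b' b1) z)
    by (intros; apply rstrip_union_l; assumption).
  revert Hs Hz2 Hin. generalize (Rmin a' a1) (Rmax b' b1). intros al be Hs Hz2 Hin.
  destruct (agreement_spreads zs al be Hs Hz2 HDz) as [gam [G [Hgam [HG Spread]]]].
  destruct (proj2 Hu al be Hs) as [M [HM BM]].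
  destruct (disc_pigeonhole M gam HM Hgam) as [N HN].
  assert (HF : 0 < INR (fact N)) by apply INR_fact_lt_0.
  assert (He : 0 < eps / INR (fact N)) by (apply Rdiv_lt_0_compat; assumption).
  specialize (Spread _ He).
  apply near0_imp with (2 := near0_forall_le _ N (fun j _ =>
     near0_scale (INR j / INR (fact N)) _ (near0_and _ _ HG Spread))).
  intros tau Htau z Hz.
  set (t := tau / INR (fact N)).
  assert (Ej : forall j, INR j / INR (fact N) * tau = INR j * t) by (intros; unfold t; field; lra).
  destruct (HN (fun j => u (zs + RtoC (INR j * t))%C)) as [i [j [Hij Hd]]].
  { intros j. apply BM, rstrip_shift, Hz2. }
  destruct (Htau i ltac:(lia)) as [Gi _]. rewrite Ej in Gi.
  destruct (Htau (j - i)%nat ltac:(lia)) as [_ Sji]. rewrite Ej in Sji.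
  specialize (Sji _ Gi).
  assert (Hall : forall w, rstrip al be w ->
     Cmod (u (w + RtoC (INR (j - i) * t)) - u w)%C <= eps / INR (fact N)).
  { apply Sji. rewrite Cmod_minus_sym.
    replace (zs + RtoC (INR i * t) + RtoC (INR (j - i) * t))%C with (zs + RtoC (INR j * t))%C.
    - exact Hd.
    - rewrite minus_INR by lia. rewrite <- Cplus_assoc, <- RtoC_plus. do 2 f_equal. ring. }
  assert (Hdiv : exists q, (fact N = q * (j - i))%nat /\ (q <= fact N)%nat).
  { assert (F : forall n k, (0 < k <= n)%nat -> exists q, fact n = (q * k)%nat).
    { induction n as [|n IH]; intros k Hk; [lia|].
      destruct (Nat.eq_dec k (S n)) as [->|Ne].
      - exists (fact n). simpl. lia.
      - destruct (IH k ltac:(lia)) as [q Hq]. exists (S n * q)%nat.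
        change (fact (S n)) with (S n * fact n)%nat. rewrite Hq. lia. }
    destruct (F N (j - i)%nat ltac:(lia)) as [q Hq]. exists q. split; [exact Hq|]. nia. }
  destruct Hdiv as [q [Hq Hq2]].
  assert (T := translate_multiple al be _ _ Hall q z (Hin z Hz)).
  replace (INR q * (INR (j - i) * t)) with tau in T.
  - eapply Rle_trans; [exact T|].
    apply Rle_trans with (INR (fact N) * (eps / INR (fact N))); [|right; field; lra].
    apply Rmult_le_compat_r; [lra|]. apply le_INR, Hq2.
  - rewrite <- Rmult_assoc, <- mult_INR, <- Hq. unfold t. field. lra.
Qed.

End Root.

(** Simplicity of the root for its minimal equation turns almost periods of the coefficients
    into almost periods of the root. *)
Lemma HB_root_APH (a b : Rbar) (u : C -> C) (n : nat) (F : C -> C -> C) : HB a b u ->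
  APpoly a b n F -> (forall z, strip a b z -> F z (u z) = RtoC 0) ->
  (exists z v, strip a b z /\ F z v <> RtoC 0) -> APH a b u.
Proof.
  intros Hu HF EF NF. split; [exact Hu|].
  destruct (separable_equation a b u n F Hu HF EF NF) as [m [p [y [D [Hp [Hr [Hy [HD [ND E]]]]]]]]].
  apply (root_bap a b m p u y D); assumption.
Qed.

(** * Approximation by exponential sums *)

Definition is_es (E : C -> C) : Prop :=
  exists N c lam, forall z, E z = exp_sum N c lam z.

Lemma exp_sum_ext (N : nat) (c c' : nat -> C) (lam lam' : nat -> R) (z : C) :
  (forall k, (k <= N)%nat -> c k = c' k /\ lam k = lam' k) -> exp_sum N c lam z = exp_sum N c' lam' z.
Proof.
  induction N as [|N IH]; intros H.
  - rewrite !exp_sum_0. destruct (H O (le_n O)) as [-> ->]. reflexivity.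
  - rewrite !exp_sum_S. rewrite IH by (intros; apply H; lia).
    destruct (H (S N) (le_n (S N))) as [-> ->]. reflexivity.
Qed.

Lemma is_es_mono (c : C) (mu : R) : is_es (fun z => c * cexpi mu z)%C.
Proof.
  exists O, (fun _ => c), (fun _ => mu). intros z. rewrite exp_sum_0. reflexivity.
Qed.

Lemma is_es_plus (E F : C -> C) : is_es E -> is_es F -> is_es (fun z => E z + F z)%C.
Proof.
  intros HE [N [c [lam HF]]].
  assert (A : forall (G : C -> C) d mu, is_es G -> is_es (fun z => G z + d * cexpi mu z)%C).
  { intros G d mu [K [e [nu HG]]].
    exists (S K), (fun k => if Nat.eq_dec k (S K) then d else e k),
      (fun k => if Nat.eq_dec k (S K) then mu else nu k).
    intros z. rewrite exp_sum_S. destruct (Nat.eq_dec (S K) (S K)) as [_|Ne]; [|congruence].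
    rewrite HG. f_equal. apply exp_sum_ext. intros k Hk.
    destruct (Nat.eq_dec k (S K)); [lia|auto]. }
  revert F HF. induction N as [|N IH]; intros F HF.
  - destruct (A E (c O) (lam O) HE) as [K [e [nu HG]]]. exists K, e, nu.
    intros z. rewrite <- HG, HF, exp_sum_0. reflexivity.
  - destruct (A _ (c (S N)) (lam (S N)) (IH (exp_sum N c lam) (fun z => eq_refl))) as [K [e [nu HG]]].
    exists K, e, nu. intros z. rewrite <- HG, HF, exp_sum_S. ring.
Qed.

Lemma is_es_scal (d : C) (E : C -> C) : is_es E -> is_es (fun z => d * E z)%C.
Proof.
  intros [N [c [lam HE]]]. exists N, (fun k => d * c k)%C, lam. intros z. rewrite HE. clear HE.
  induction N as [|N IH].
  - rewrite !exp_sum_0. ring.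
  - rewrite !exp_sum_S, <- IH. ring.
Qed.

Inductive trig_poly : (R -> C) -> Prop :=
| tp_mono : forall (c : C) (mu : R) (K : R -> C), (forall t, K t = (c * eix (mu * t))%C) -> trig_poly K
| tp_plus : forall K1 K2 K, trig_poly K1 -> trig_poly K2 -> (forall t, K t = (K1 t + K2 t)%C) -> trig_poly K.

Lemma eix_plus (x y : R) : eix (x + y) = (eix x * eix y)%C.
Proof. unfold eix. rewrite cos_plus, sin_plus. apply injective_projections; simpl; ring. Qed.

Lemma tp_ext (K K' : R -> C) : trig_poly K -> (forall t, K' t = K t) -> trig_poly K'.
Proof.
  intros H E. destruct H as [c mu K H|K1 K2 K H1 H2 H].
  - apply (tp_mono c mu). intros t. rewrite E. apply H.
  - apply (tp_plus K1 K2); try assumption. intros t. rewrite E. apply H.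
Qed.

Lemma tp_mult (K L : R -> C) : trig_poly K -> trig_poly L -> trig_poly (fun t => K t * L t)%C.
Proof.
  intros HK HL. induction HK as [c mu K HK|K1 K2 K HK1 IH1 HK2 IH2 HK].
  - induction HL as [d nu L HL|L1 L2 L HL1 IH1 HL2 IH2 HL].
    + apply (tp_mono (c * d)%C (mu + nu)). intros t. rewrite HK, HL.
      replace ((mu + nu) * t) with (mu * t + nu * t) by ring. rewrite eix_plus. ring.
    + apply (tp_plus _ _ _ IH1 IH2). intros t. rewrite HL. ring.
  - apply (tp_plus _ _ _ IH1 IH2). intros t. rewrite HK. ring.
Qed.

Lemma tp_const (c : C) : trig_poly (fun _ => c).
Proof.
  apply (tp_mono c 0). intros t. rewrite Rmult_0_l. unfold eix. rewrite cos_0, sin_0.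
  apply injective_projections; simpl; ring.
Qed.

Lemma tp_pow (K : R -> C) (n : nat) : trig_poly K -> trig_poly (fun t => Cpow (K t) n).
Proof.
  intros H. induction n as [|n IH]; simpl; [apply tp_const|].
  apply (tp_mult K (fun t => Cpow (K t) n)); assumption.
Qed.

Lemma tp_cont (K : R -> C) (t : R) : trig_poly K -> cont_at dist_R K t.
Proof.
  intros H. induction H as [c mu K H|K1 K2 K H1 IH1 H2 IH2 H].
  - apply (cont_at_ext _ (fun t => c * eix (mu * t))%C); [intros; symmetry; apply H|].
    apply cont_at_mult; [apply cont_at_const|].
    assert (A := Cdiff_cont _ _ (Cdiff_cexpi mu (RtoC t))).
    apply (cont_at_ext _ (fun t => cexpi mu (RtoC t))); [intros; apply cexpi_real|].
    apply (cont_at_comp dist_R RtoC (cexpi mu) dist_C); [exact A|].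
    intros eps He. exists eps. split; [exact He|]. intros y Hy. unfold dist_C.
    rewrite <- RtoC_minus, Cmod_R. exact Hy.
  - apply (cont_at_ext _ (fun t => K1 t + K2 t)%C); [intros; symmetry; apply H|].
    apply cont_at_plus; assumption.
Qed.

(** * Means over long intervals *)

Section Means.

Variables (a b : Rbar) (a' b' : R).
Hypothesis (Hs : substrip a' b' a b).

Lemma translate_cont (g : C -> C) (z : C) (t : R) : holo a b g -> rstrip a' b' z ->
  cont_at dist_R (fun t => g (z + RtoC t)%C) t.
Proof.
  intros Hg Hz. apply (cont_at_comp dist_R (fun t => z + RtoC t)%C g dist_C).
  - apply Cdiff_cont, Hg, (rstrip_strip a' b'); [exact Hs|apply rstrip_shift, Hz].
  - intros eps He. exists eps. split; [exact He|]. intros y Hy. unfold dist_C.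
    replace (z + RtoC y - (z + RtoC t))%C with (RtoC (y - t)) by (rewrite RtoC_minus; ring).
    rewrite Cmod_R. exact Hy.
Qed.

Lemma translate_exCI (g : C -> C) (z : C) (s t : R) : holo a b g -> rstrip a' b' z -> s <= t ->
  exCI (fun t => g (z + RtoC t)%C) s t.
Proof. intros Hg Hz Hst. apply cont_exCI; [exact Hst|]. intros; apply translate_cont; assumption. Qed.

Lemma mean_shift_real (g : C -> C) (M T x : R) (z : C) : holo a b g ->
  (forall z, rstrip a' b' z -> Cmod (g z) <= M) -> rstrip a' b' z -> 0 <= x -> 0 <= T ->
  Cmod (CI (fun t => g (z + RtoC x + RtoC t)%C) (- T) T - CI (fun t => g (z + RtoC t)%C) (- T) T)%C
    <= 4 * M * x.
Proof.
  intros Hg BM Hz Hx HT.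
  assert (E : CI (fun t => g (z + RtoC x + RtoC t)%C) (- T) T
     = CI (fun t => g (z + RtoC t)%C) (- T + x) (T + x)).
  { rewrite <- (CI_shift (fun t => g (z + RtoC t)%C) x (- T) T) by (apply translate_exCI; auto; lra).
    apply CI_ext; [lra|]. intros t _. f_equal. rewrite RtoC_plus. ring. }
  rewrite E.
  assert (Ex : forall s t, s <= t -> exCI (fun t => g (z + RtoC t)%C) s t)
    by (intros; apply translate_exCI; auto).
  assert (C1 := CI_Chasles (fun t => g (z + RtoC t)%C) (- T) T (T + x) (Ex (- T) T ltac:(lra)) (Ex T (T + x) ltac:(lra))).
  assert (C2 := CI_Chasles (fun t => g (z + RtoC t)%C) (- T) (- T + x) (T + x) (Ex (- T) (- T + x) ltac:(lra)) (Ex (- T + x) (T + x) ltac:(lra))).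
  match type of C1 with (?A + ?B)%C = ?X => match type of C2 with (?P + ?Q)%C = _ =>
    replace (Q - A)%C with (B - P)%C end end.
  - eapply Rle_trans; [apply Cmod_minus_le|].
    assert (B1 : Cmod (CI (fun t => g (z + RtoC t)%C) T (T + x)) <= 2 * (M * (T + x - T)))
      by (apply CI_bound; [lra|apply Ex; lra|intros; apply BM, rstrip_shift, Hz]).
    assert (B2 : Cmod (CI (fun t => g (z + RtoC t)%C) (- T) (- T + x)) <= 2 * (M * (- T + x - - T)))
      by (apply CI_bound; [lra|apply Ex; lra|intros; apply BM, rstrip_shift, Hz]).
    replace (2 * (M * (T + x - T))) with (2 * M * x) in B1 by ring.
    replace (2 * (M * (- T + x - - T))) with (2 * M * x) in B2 by ring. lra.
  - rewrite <- C2 in C1. apply C_eq_minus.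
    match type of C1 with (?A + ?B)%C = (?P + ?Q)%C =>
      replace (B - P - (Q - A))%C with ((A + B) - (P + Q))%C by ring; rewrite C1; ring end.
Qed.

(** Moving the line of integration vertically: Goursat on a rectangle, whose vertical sides do
    not depend on the length [2 T]. *)
Lemma mean_shift_imag (g : C -> C) (M T y : R) (z : C) : holo a b g ->
  (forall z, rstrip a' b' z -> Cmod (g z) <= M) -> rstrip a' b' z ->
  rstrip a' b' (z + RtoC y * Ci)%C -> 0 < y -> 0 < T ->
  Cmod (CI (fun t => g (z + RtoC y * Ci + RtoC t)%C) (- T) T - CI (fun t => g (z + RtoC t)%C) (- T) T)%C
    <= 4 * M * y.
Proof.
  intros Hg BM Hz Hzy Hy HT.
  assert (Hin : forall s t, 0 <= s <= y -> rstrip a' b' (z + RtoC s * Ci + RtoC t)%C).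
  { intros s t Hst. unfold rstrip, Im in *. simpl in *. lra. }
  assert (G := goursat_rect (fun s t => z + RtoC s * Ci + RtoC t)%C (fun _ _ => Ci) (fun _ _ => RtoC 1)
    g 0 y (- T) T 1 Hy ltac:(lra) ltac:(lra)).
  cbv beta in G.
  assert (G0 : (CI (fun t => g (z + RtoC y * Ci + RtoC t) * 1)%C (- T) T -
     CI (fun t => g (z + RtoC 0 * Ci + RtoC t) * 1)%C (- T) T -
     (CI (fun s => g (z + RtoC s * Ci + RtoC T) * Ci)%C 0 y -
      CI (fun s => g (z + RtoC s * Ci + RtoC (- T)) * Ci)%C 0 y))%C = RtoC 0).
  { apply G.
    - intros s t. eapply is_pderiv_eq.
      + apply is_pderiv_plus; [|apply is_pderiv_const].
        apply is_pderiv_plus; [apply is_pderiv_const|].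
        apply is_pderiv_mult; [apply RtoC_deriv|apply is_pderiv_const].
      + cbv beta; ring.
    - intros s t. eapply is_pderiv_eq.
      + apply is_pderiv_plus; [apply is_pderiv_const|apply RtoC_deriv].
      + cbv beta; ring.
    - intros; apply cont_at_const.
    - intros; apply cont_at_const.
    - intros. rewrite Cmod_Ci. lra.
    - intros. rewrite Cmod_1. lra.
    - intros s t Hst _. apply Hg, (rstrip_strip a' b'); [exact Hs|apply Hin, Hst]. }
  clear G.
  assert (E1 : CI (fun t => g (z + RtoC y * Ci + RtoC t) * 1)%C (- T) T
    = CI (fun t => g (z + RtoC y * Ci + RtoC t)%C) (- T) T)
    by (apply CI_ext; [lra|]; intros; ring).
  assert (E2 : CI (fun t => g (z + RtoC 0 * Ci + RtoC t) * 1)%C (- T) T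
    = CI (fun t => g (z + RtoC t)%C) (- T) T).
  { apply CI_ext; [lra|]. intros t _. replace (z + RtoC 0 * Ci + RtoC t)%C with (z + RtoC t)%C by ring. ring. }
  rewrite E1, E2 in G0.
  assert (Side : forall x, Cmod (CI (fun s => g (z + RtoC s * Ci + RtoC x) * Ci)%C 0 y) <= 2 * (M * (y - 0))).
  { intros x. apply CI_bound; [lra| |].
    - apply cont_exCI; [lra|]. intros s Hs'. apply cont_at_mult; [|apply cont_at_const].
      apply (cont_at_comp dist_R (fun s => z + RtoC s * Ci + RtoC x)%C g dist_C).
      + apply Cdiff_cont, Hg, (rstrip_strip a' b'); [exact Hs|apply Hin, Hs'].
      + intros eps He. exists eps. split; [exact He|]. intros s2 Hs2. unfold dist_C.
        replace (z + RtoC s2 * Ci + RtoC x - (z + RtoC s * Ci + RtoC x))%C with (RtoC (s2 - s) * Ci)%C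
          by (rewrite RtoC_minus; ring).
        rewrite Cmod_mult, Cmod_Ci, Cmod_R, Rmult_1_r. exact Hs2.
    - intros s Hs'. rewrite Cmod_mult, Cmod_Ci, Rmult_1_r. apply BM, Hin. lra. }
  assert (S1 := Side T). assert (S2 := Side (- T)).
  match type of G0 with (?D - (?A - ?B))%C = _ => replace D with (A - B)%C end.
  - eapply Rle_trans; [apply Cmod_minus_le|]. lra.
  - symmetry. apply C_eq_minus, G0.
Qed.

(** Translating by an almost period brings [z] to within bounded distance of [w] at a small cost per
    unit length, and moving by a bounded distance changes the integral by a bounded amount. *)
Lemma mean_independent (g : C -> C) (eps : R) : APH a b g -> 0 < eps ->
  exists T0, 0 < T0 /\ forall T, T0 <= T -> forall z w, rstrip a' b' z -> rstrip a' b' w ->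
  Cmod (CI (fun t => g (z + RtoC t)%C) (- T) T - CI (fun t => g (w + RtoC t)%C) (- T) T)%C
    <= 2 * T * eps.
Proof.
  intros [[Hg Hb] Ha] He.
  destruct (Hb a' b' Hs) as [M [HM BM]].
  destruct (near0_dense _ (Ha a' b' Hs (eps / 4) ltac:(lra))) as [L [HL Dense]].
  set (W := b' - a'). assert (HW : 0 < W) by (unfold W; destruct Hs as [_ [H _]]; lra).
  set (T0 := 4 * M * (L + W) / eps).
  assert (HT0 : 0 < T0).
  { apply Rdiv_lt_0_compat; [|exact He]. apply Rmult_lt_0_compat; lra. }
  exists T0. split; [exact HT0|]. intros T HT z w Hz Hw.
  assert (HTe : 4 * M * (L + W) <= eps * T).
  { apply Rle_trans with (eps * T0); [right; unfold T0; field; lra|apply Rmult_le_compat_l; lra]. }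
  set (Q := fun z => CI (fun t => g (z + RtoC t)%C) (- T) T).
  assert (SR : forall z x, rstrip a' b' z -> Cmod (Q (z + RtoC x)%C - Q z)%C <= 4 * M * Rabs x).
  { intros z0 x Hz0. destruct (Rle_dec 0 x) as [P|P].
    - rewrite Rabs_pos_eq by exact P. apply mean_shift_real; auto; lra.
    - rewrite Rabs_left by lra. rewrite Cmod_minus_sym.
      assert (A := mean_shift_real g M T (- x) (z0 + RtoC x)%C Hg BM (rstrip_shift _ _ z0 x Hz0) ltac:(lra) ltac:(lra)).
      replace (z0 + RtoC x + RtoC (- x))%C with z0 in A by (rewrite RtoC_opp; ring). exact A. }
  assert (SI : forall z y, rstrip a' b' z -> rstrip a' b' (z + RtoC y * Ci)%C ->
     Cmod (Q (z + RtoC y * Ci)%C - Q z)%C <= 4 * M * Rabs y).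
  { intros z0 y Hz0 Hzy. destruct (Rtotal_order y 0) as [P|[P|P]].
    - rewrite Rabs_left by lra. rewrite Cmod_minus_sym.
      assert (E : z0 = (z0 + RtoC y * Ci + RtoC (- y) * Ci)%C) by (rewrite RtoC_opp; ring).
      assert (A := mean_shift_imag g M T (- y) (z0 + RtoC y * Ci)%C Hg BM Hzy
        ltac:(rewrite <- E; exact Hz0) ltac:(lra) ltac:(lra)).
      rewrite <- E in A. exact A.
    - subst y. replace (z0 + RtoC 0 * Ci)%C with z0 by ring.
      replace (Q z0 - Q z0)%C with (RtoC 0) by ring. rewrite Cmod_0, Rabs_R0. lra.
    - rewrite Rabs_pos_eq by lra. apply mean_shift_imag; auto. lra. }
  destruct (Dense (Re z - Re w)) as [tau [Htau Hper]].
  set (z' := (z + RtoC (- tau))%C).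
  assert (Hz' : rstrip a' b' z') by (apply rstrip_shift, Hz).
  set (x := Re z' - Re w). set (y := Im z' - Im w).
  assert (Ez : z' = (w + RtoC x + RtoC y * Ci)%C).
  { apply injective_projections; unfold x, y, Re, Im; simpl; ring. }
  assert (Hwx : rstrip a' b' (w + RtoC x)%C) by (apply rstrip_shift, Hw).
  assert (B1 := SR w x Hw).
  assert (B2 := SI (w + RtoC x)%C y Hwx ltac:(rewrite <- Ez; exact Hz')). rewrite <- Ez in B2.
  assert (B3 : Cmod (Q z - Q z') <= 2 * (eps / 4 * (T - - T))).
  { unfold Q. rewrite <- CI_minus; [|lra|apply translate_exCI; auto; lra|apply translate_exCI; auto; lra].
    apply CI_bound; [lra|apply exCI_minus; apply translate_exCI; auto; lra|].
    intros t _. replace (z + RtoC t)%C with (z' + RtoC t + RtoC tau)%C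
      by (unfold z'; rewrite RtoC_opp; ring).
    apply Hper, rstrip_shift, Hz'. }
  assert (Ax : Rabs x <= L).
  { unfold x, z'. replace (Re (z + RtoC (- tau))%C - Re w) with (- (tau - (Re z - Re w)))
      by (unfold Re; simpl; ring). rewrite Rabs_Ropp. exact Htau. }
  assert (Ay : Rabs y <= W) by (unfold y, W; destruct Hz', Hw; apply Rabs_le; lra).
  assert (M * Rabs x <= M * L) by (apply Rmult_le_compat_l; lra).
  assert (M * Rabs y <= M * W) by (apply Rmult_le_compat_l; lra).
  fold (Q z) (Q w).
  eapply Rle_trans; [apply (Cmod_tri3 _ (Q z'))|].
  eapply Rle_trans; [apply Rplus_le_compat_l, (Cmod_tri3 _ (Q (w + RtoC x)%C))|]. lra.
Qed.

(** Convolving with a trigonometric polynomial gives, up to a small error, an exponential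
    sum: the mean of [f (z + t) exp(i mu t)] is [exp(- i mu z)] times a constant. *)
Lemma convolution_es (f : C -> C) (K : R -> C) : APH a b f -> trig_poly K -> forall eps, 0 < eps ->
  exists T0, 0 < T0 /\ forall T, T0 <= T -> exists E, is_es E /\ forall z, rstrip a' b' z ->
    Cmod (CI (fun t => f (z + RtoC t) * K t)%C (- T) T - RtoC (2 * T) * E z)%C <= 2 * T * eps.
Proof.
  intros Hf HK. assert (HfH := proj1 (proj1 Hf)).
  induction HK as [c mu K HK|K1 K2 K HK1 IH1 HK2 IH2 HK]; intros eps He.
  - set (g := fun z => (f z * cexpi mu z)%C).
    assert (Hg : APH a b g) by (apply APH_mult; [exact Hf|apply APH_cexpi]).
    assert (Hab : a' < b') by apply Hs.
    set (A := exp (Rabs (- mu) * (Rabs a' + Rabs b'))).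
    assert (HA : 0 < A) by apply exp_pos.
    assert (Hc := Cmod_ge_0 c).
    assert (HcA : 0 <= Cmod c * A) by (apply Rmult_le_pos; lra).
    destruct (mean_independent g (eps / (Cmod c * A + 1)) Hg) as [T0 [HT0 H]];
      [apply Rdiv_lt_0_compat; lra|].
    exists T0. split; [exact HT0|]. intros T HT.
    set (w := (0, (a' + b') / 2) : C).
    assert (Hw : rstrip a' b' w) by (unfold rstrip, w; simpl; lra).
    set (Q := fun z => CI (fun t => g (z + RtoC t)%C) (- T) T).
    exists (fun z => (c * (/ RtoC (2 * T) * Q w)) * cexpi (- mu) z)%C.
    split; [apply is_es_mono|]. intros z Hz.
    assert (HT2 : RtoC (2 * T) <> RtoC 0) by (intros E; injection E; lra).
    assert (E : CI (fun t => f (z + RtoC t) * K t)%C (- T) T = (c * cexpi (- mu) z * Q z)%C).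
    { unfold Q. rewrite <- CI_scal by (apply translate_exCI; [apply Hg|exact Hz|lra]).
      apply CI_ext; [lra|]. intros t _. rewrite HK. unfold g.
      rewrite cexpi_plus, cexpi_real.
      assert (E0 := cexpi_freq (- mu) mu z). rewrite Rplus_opp_l, cexpi_0 in E0.
      replace (c * cexpi (- mu) z * (f (z + RtoC t) * (cexpi mu z * eix (mu * t))))%C
        with ((cexpi (- mu) z * cexpi mu z) * (f (z + RtoC t) * (c * eix (mu * t))))%C by ring.
      rewrite <- E0. ring. }
    rewrite E.
    replace (c * cexpi (- mu) z * Q z - RtoC (2 * T) * (c * (/ RtoC (2 * T) * Q w) * cexpi (- mu) z))%C
      with (c * cexpi (- mu) z * (Q z - Q w))%C by (field; exact HT2).
    rewrite !Cmod_mult.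
    assert (B := cexpi_strip_bound a' b' (- mu) Hab z Hz). fold A in B.
    apply Rle_trans with (Cmod c * A * (2 * T * (eps / (Cmod c * A + 1)))).
    + apply Rmult_le_compat; [apply Rmult_le_pos; apply Cmod_ge_0|apply Cmod_ge_0| |apply H; assumption].
      apply Rmult_le_compat_l; assumption.
    + replace (2 * T * eps) with ((Cmod c * A + 1) * (2 * T * (eps / (Cmod c * A + 1)))) by (field; lra).
      apply Rmult_le_compat_r; [|lra]. apply Rmult_le_pos; [lra|].
      left. apply Rdiv_lt_0_compat; lra.
  - destruct (IH1 (eps / 2) ltac:(lra)) as [T1 [HT1 H1]].
    destruct (IH2 (eps / 2) ltac:(lra)) as [T2 [HT2 H2]].
    exists (T1 + T2). split; [lra|]. intros T HT.
    destruct (H1 T ltac:(lra)) as [E1 [S1 B1]]. destruct (H2 T ltac:(lra)) as [E2 [S2 B2]].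
    exists (fun z => E1 z + E2 z)%C. split; [apply is_es_plus; assumption|]. intros z Hz.
    specialize (B1 z Hz). specialize (B2 z Hz).
    assert (Ex : forall L, trig_poly L -> exCI (fun t => f (z + RtoC t) * L t)%C (- T) T).
    { intros L HL. apply cont_exCI; [lra|]. intros t _.
      apply cont_at_mult; [apply translate_cont; assumption|apply tp_cont, HL]. }
    assert (E : CI (fun t => f (z + RtoC t) * K t)%C (- T) T =
      (CI (fun t => f (z + RtoC t) * K1 t)%C (- T) T + CI (fun t => f (z + RtoC t) * K2 t)%C (- T) T)%C).
    { rewrite <- CI_plus by (apply Ex; assumption). apply CI_ext; [lra|].
      intros t _. rewrite HK. ring. }
    rewrite E.
    match goal with |- Cmod (?x + ?y - ?s * (?u + ?v))%C <= _ =>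
      replace (x + y - s * (u + v))%C with ((x - s * u) + (y - s * v))%C by ring end.
    eapply Rle_trans; [apply Cmod_triangle|]. lra.
Qed.

End Means.

(** * The kernel *)

(** Nonnegative trigonometric polynomials: equal to [1] at [0], and exponentially small in [n] off a
    Bohr neighbourhood. *)
Fixpoint kernel (Lam : list R) (n : nat) (t : R) : R :=
  match Lam with
  | nil => 1
  | l :: Lam' => (cos (l * t) ^ 2) ^ n * kernel Lam' n t
  end.

Lemma cos2_bounds (x : R) : 0 <= cos x ^ 2 <= 1.
Proof.
  split; [apply pow2_ge_0|]. assert (H := sin2_cos2 x). unfold Rsqr in H.
  assert (0 <= sin x * sin x) by apply Rle_0_sqr. simpl. lra.
Qed.

Lemma kernel_bounds (Lam : list R) (n : nat) (t : R) : 0 <= kernel Lam n t <= 1.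
Proof.
  induction Lam as [|l Lam IH]; cbn [kernel]; [lra|].
  destruct (cos2_bounds (l * t)) as [H1 H2].
  assert (P1 : 0 <= (cos (l * t) ^ 2) ^ n) by (apply pow_le, H1).
  assert (P2 : (cos (l * t) ^ 2) ^ n <= 1).
  { rewrite <- (pow1 n). apply pow_incr. lra. }
  split; [apply Rmult_le_pos; lra|].
  replace 1 with (1 * 1) by ring. apply Rmult_le_compat; lra.
Qed.

Lemma kernel_trig_poly (Lam : list R) (n : nat) : trig_poly (fun t => RtoC (kernel Lam n t)).
Proof.
  induction Lam as [|l Lam IH]; cbn [kernel]; [apply tp_const|].
  apply (tp_ext (fun t => Cpow (RtoC (cos (l * t) ^ 2)) n * RtoC (kernel Lam n t))%C).
  - apply (tp_mult (fun t => Cpow (RtoC (cos (l * t) ^ 2)) n)); [|exact IH].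
    apply (tp_pow (fun t => RtoC (cos (l * t) ^ 2))).
    apply (tp_plus (fun _ => RtoC (/ 2)) (fun t => RtoC (/ 4) * eix (2 * l * t) + RtoC (/ 4) * eix (- (2 * l) * t))%C).
    + apply tp_const.
    + apply (tp_plus (fun t => RtoC (/ 4) * eix (2 * l * t))%C (fun t => RtoC (/ 4) * eix (- (2 * l) * t))%C).
      * apply (tp_mono (RtoC (/ 4)) (2 * l)). reflexivity.
      * apply (tp_mono (RtoC (/ 4)) (- (2 * l))). reflexivity.
      * reflexivity.
    + intros t. replace (- (2 * l) * t) with (- (2 * (l * t))) by ring.
      replace (2 * l * t) with (2 * (l * t)) by ring. unfold eix.
      rewrite cos_neg, sin_neg, cos_2a_cos. apply injective_projections; simpl; field.
  - intros t. rewrite RtoC_mult, <- RtoC_pow. reflexivity.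
Qed.

Lemma kernel_small (Lam : list R) (d : R) (n : nat) (t : R) : 0 <= d <= 1 -> ~ bohr Lam d t ->
  kernel Lam n t <= (1 - d * d) ^ n.
Proof.
  intros Hd Hb. induction Lam as [|l Lam IH].
  - exfalso. apply Hb. intros x [].
  - cbn [kernel]. destruct (cos2_bounds (l * t)) as [H1 H2].
    assert (P1 : 0 <= (cos (l * t) ^ 2) ^ n) by (apply pow_le, H1).
    assert (P2 : (cos (l * t) ^ 2) ^ n <= 1).
    { rewrite <- (pow1 n). apply pow_incr. lra. }
    assert (Kb := kernel_bounds Lam n t).
    destruct (Rle_dec (Rabs (sin (l * t))) d) as [Y|N].
    + assert (Hb' : ~ bohr Lam d t).
      { intros H. apply Hb. intros x [<-|Hx]; [exact Y|apply H, Hx]. }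
      specialize (IH Hb'). replace ((1 - d * d) ^ n) with (1 * (1 - d * d) ^ n) by ring.
      apply Rmult_le_compat; lra.
    + replace ((1 - d * d) ^ n) with ((1 - d * d) ^ n * 1) by ring.
      apply Rmult_le_compat; try lra. apply pow_incr. split; [exact H1|].
      assert (E := sin2_cos2 (l * t)). unfold Rsqr in E.
      assert (S : d * d <= sin (l * t) * sin (l * t)).
      { rewrite <- (Rabs_pos_eq (sin (l * t) * sin (l * t))) by apply Rle_0_sqr.
        rewrite Rabs_mult. apply Rmult_le_compat; lra. }
      simpl. lra.
Qed.

Lemma kernel_large (Lam : list R) (d : R) (n : nat) (t : R) : 0 <= d <= 1 -> bohr Lam d t ->
  ((1 - d * d) ^ length Lam) ^ n <= kernel Lam n t.
Proof.
  intros Hd Hb. induction Lam as [|l Lam IH].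
  - simpl. rewrite pow1. lra.
  - cbn [kernel length]. change ((1 - d * d) ^ S (length Lam)) with ((1 - d * d) * (1 - d * d) ^ length Lam). rewrite Rpow_mult_distr.
    assert (D2 : 0 <= 1 - d * d) by nra.
    apply Rmult_le_compat.
    + apply pow_le, D2.
    + apply pow_le, pow_le, D2.
    + apply pow_incr. split; [exact D2|].
      assert (E := sin2_cos2 (l * t)). unfold Rsqr in E.
      assert (Y := Hb l (or_introl eq_refl)).
      assert (S : sin (l * t) * sin (l * t) <= d * d).
      { rewrite <- (Rabs_pos_eq (sin (l * t) * sin (l * t))) by apply Rle_0_sqr.
        rewrite Rabs_mult. apply Rmult_le_compat; auto using Rabs_pos. }
      simpl. lra.
    + apply IH. intros x Hx. apply Hb. right. exact Hx.
Qed.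

Lemma bernoulli (x : R) (n : nat) : 0 <= x <= 1 -> 1 - INR n * x <= (1 - x) ^ n.
Proof.
  intros Hx. induction n as [|n IH]; [simpl; lra|].
  rewrite S_INR. simpl pow.
  assert (Hn := pos_INR n).
  assert (0 <= INR n * x) by (apply Rmult_le_pos; lra).
  assert (A : (1 - x) * (1 - INR n * x) <= (1 - x) * (1 - x) ^ n) by (apply Rmult_le_compat_l; lra).
  nra.
Qed.

Lemma Rabs_sin_le (x : R) : Rabs (sin x) <= Rabs x.
Proof.
  destruct (Rtotal_order x 0) as [H|[->|H]].
  - rewrite <- (Rabs_Ropp x), <- (Rabs_Ropp (sin x)), <- sin_neg, (Rabs_pos_eq (- x)) by lra.
    apply Rabs_le. split.
    + destruct (Rle_dec (- x) 1) as [Y|N].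
      * assert (0 <= sin (- x)) by (apply sin_ge_0; [lra|assert (P := PI2_1); lra]). lra.
      * destruct (SIN_bound (- x)). lra.
    + left. apply sin_lt_x. lra.
  - rewrite sin_0. lra.
  - rewrite (Rabs_pos_eq x) by lra. apply Rabs_le. split.
    + destruct (Rle_dec x 1) as [Y|N].
      * assert (0 <= sin x) by (apply sin_ge_0; [lra|assert (P := PI2_1); lra]). lra.
      * destruct (SIN_bound x). lra.
    + left. apply sin_lt_x. lra.
Qed.

Lemma bohr_thicken (Lam : list R) (d : R) : 0 < d -> exists s, 0 < s /\
  forall t t', bohr Lam (d / 2) t -> Rabs (t' - t) <= s -> bohr Lam d t'.
Proof.
  intros Hd. destruct (list_bound Lam) as [B [HB H]].
  exists (d / (2 * B)). split; [apply Rdiv_lt_0_compat; lra|].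
  intros t t' Ht Htt l Hl. specialize (Ht l Hl). specialize (H l Hl).
  replace (l * t') with (l * t + l * (t' - t)) by ring. rewrite sin_plus.
  assert (A : Rabs (cos (l * (t' - t))) <= 1) by (apply Rabs_le, COS_bound).
  assert (A2 : Rabs (cos (l * t)) <= 1) by (apply Rabs_le, COS_bound).
  assert (S : Rabs (sin (l * (t' - t))) <= d / 2).
  { eapply Rle_trans; [apply Rabs_sin_le|]. rewrite Rabs_mult.
    apply Rle_trans with (B * (d / (2 * B))); [|right; field; lra].
    apply Rmult_le_compat; auto using Rabs_pos. }
  eapply Rle_trans; [apply Rabs_triang|]. rewrite !Rabs_mult.
  assert (Rabs (sin (l * t)) * Rabs (cos (l * (t' - t))) <= d / 2 * 1)
    by (apply Rmult_le_compat; auto using Rabs_pos).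
  assert (Rabs (cos (l * t)) * Rabs (sin (l * (t' - t))) <= 1 * (d / 2))
    by (apply Rmult_le_compat; auto using Rabs_pos).
  lra.
Qed.

Lemma kernel_cont (Lam : list R) (n : nat) (t : R) : continuous (kernel Lam n) t.
Proof.
  apply (cont_at_fst (fun t => RtoC (kernel Lam n t))), tp_cont, kernel_trig_poly.
Qed.

Lemma kernel_ex (Lam : list R) (n : nat) (s t : R) : ex_RInt (kernel Lam n) s t.
Proof. apply (ex_RInt_continuous (V := R_CompleteNormedModule)). intros. apply kernel_cont. Qed.

(** The kernel carries a fixed proportion of its possible mass: Bohr neighbourhoods contain
    intervals of a fixed length with bounded gaps. *)
Lemma kernel_mass (Lam : list R) (d : R) : 0 < d <= 1 -> exists beta W, 0 < beta /\ 0 < W /\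
  forall k n, 2 * (INR k * W) * beta * (1 - d * d / 2) ^ n
    <= RInt (kernel Lam n) (- (INR k * W)) (INR k * W).
Proof.
  intros Hd.
  set (N := INR (length Lam) + 1). assert (HN : 1 <= N) by (unfold N; assert (P := pos_INR (length Lam)); lra).
  set (h := d / (2 * N)).
  assert (Hh : 0 < h) by (apply Rdiv_lt_0_compat; lra).
  assert (Hh1 : h * (2 * N) = d) by (unfold h; field; lra).
  assert (Hh2 : h <= 1) by nra.
  assert (Hhh : INR (length Lam) * (h * h) <= d * d / 2).
  { assert (INR (length Lam) <= N) by (unfold N; lra).
    assert (INR (length Lam) * (h * h) <= N * (h * h)) by (apply Rmult_le_compat_r; nra).
    assert (N * (h * h) = d * h / 2) by nra.
    assert (h <= d) by nra. nra. }
  destruct (bohr_thicken Lam h Hh) as [s [Hs Thick]].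
  destruct (near0_dense (bohr Lam (h / 2))) as [L [HL Dense]].
  { exists Lam, (h / 2). split; [lra|auto]. }
  set (W := 2 * (L + s)).
  assert (HW : 0 < W) by (unfold W; lra).
  exists (2 * s / W), (W / 2). split; [apply Rdiv_lt_0_compat; lra|]. split; [lra|].
  intros k n.
  set (q := (1 - d * d / 2) ^ n).
  assert (Hq0 : 0 <= q) by (apply pow_le; nra).
  assert (Big : forall t, bohr Lam h t -> q <= kernel Lam n t).
  { intros t Ht. eapply Rle_trans; [|apply (kernel_large Lam h n t); [lra|exact Ht]].
    apply pow_incr. split; [nra|]. eapply Rle_trans; [|apply bernoulli; nra]. lra. }
  assert (Block : forall x, 2 * s * q <= RInt (kernel Lam n) x (x + W)).
  { intros x. destruct (Dense (x + W / 2)) as [tau [Ht Hb]].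
    apply Rabs_le_between in Ht. unfold W in *.
    rewrite <- (RInt_Chasles (kernel Lam n) x (tau - s)) by apply kernel_ex.
    rewrite <- (RInt_Chasles (kernel Lam n) (tau - s) (tau + s)) by apply kernel_ex.
    assert (Pos : forall u v, u <= v -> 0 <= RInt (kernel Lam n) u v).
    { intros u v Huv. apply RInt_ge_0; [exact Huv|apply kernel_ex|]. intros; apply kernel_bounds. }
    assert (Mid : 2 * s * q <= RInt (kernel Lam n) (tau - s) (tau + s)).
    { replace (2 * s * q) with (RInt (fun _ => q) (tau - s) (tau + s)).
      - apply RInt_le; [lra|apply ex_RInt_const|apply kernel_ex|].
        intros t Htt. apply Big, (Thick tau); [exact Hb|]. apply Rabs_le. lra.
      - rewrite RInt_const. unfold scal; simpl; unfold mult; simpl. ring. }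
    assert (P1 := Pos x (tau - s) ltac:(lra)). assert (P2 := Pos (tau + s) (x + 2 * (L + s)) ltac:(lra)).
    unfold plus; simpl. lra. }
  assert (Sum : forall j x, INR j * (2 * s * q) <= RInt (kernel Lam n) x (x + INR j * W)).
  { induction j as [|j IH]; intros x.
    - simpl INR. rewrite !Rmult_0_l, Rplus_0_r, RInt_point. unfold zero; simpl. lra.
    - rewrite S_INR. replace (x + (INR j + 1) * W) with (x + INR j * W + W) by ring.
      rewrite <- (RInt_Chasles (kernel Lam n) x (x + INR j * W)) by apply kernel_ex.
      specialize (IH x). assert (B := Block (x + INR j * W)). unfold plus; simpl. lra. }
  assert (A := Sum k (- (INR k * (W / 2)))).
  replace (- (INR k * (W / 2)) + INR k * W) with (INR k * (W / 2)) in A by field.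
  eapply Rle_trans; [|exact A]. right. field. lra.
Qed.

(** Convolution with a large power of the kernel reproduces [f] up to [eps], because
    the kernel concentrates on a Bohr neighbourhood of [0]. *)
Lemma APH_AP (a b : Rbar) (f : C -> C) : APH a b f -> AP a b f.
Proof.
  intros Hf a' b' Hs eps He.
  destruct (proj2 (proj1 Hf) a' b' Hs) as [M [HM BM]].
  destruct (proj2 Hf a' b' Hs (eps / 8) ltac:(lra)) as [Lam [d0 [Hd0 Hper]]].
  set (d := Rmin d0 1).
  assert (Hd : 0 < d) by (apply Rmin_pos; lra).
  assert (Hd1 : d <= 1) by apply Rmin_r. assert (Hdd0 : d <= d0) by apply Rmin_l.
  assert (Near : forall t, bohr Lam d t -> forall z, rstrip a' b' z -> Cmod (f (z + RtoC t) - f z)%C <= eps / 8).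
  { intros t Ht. apply Hper. intros l Hl. eapply Rle_trans; [apply Ht, Hl|exact Hdd0]. }
  destruct (kernel_mass Lam d ltac:(lra)) as [beta [W [Hbeta [HW Mass]]]].
  set (q := 1 - d * d). set (q' := 1 - d * d / 2).
  assert (Hdd : 0 < d * d <= 1) by nra.
  assert (Hq : 0 <= q) by (unfold q; lra). assert (Hq' : 0 < q') by (unfold q'; lra).
  assert (Hr : 0 <= q / q' < 1).
  { split; [apply Rmult_le_pos; [exact Hq|left; apply Rinv_0_lt_compat, Hq']|].
    apply (Rmult_lt_reg_r q'); [exact Hq'|].
    replace (q / q' * q') with q by (field; lra). unfold q, q' in *. lra. }
  destruct (pow_lt_1_zero (q / q') ltac:(rewrite Rabs_pos_eq; lra) (eps * beta / (16 * M))) as [n Hn].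
  { apply Rdiv_lt_0_compat; [apply Rmult_lt_0_compat; assumption|lra]. }
  specialize (Hn n (le_n n)).
  assert (Hqn : 0 < q' ^ n) by (apply pow_lt, Hq').
  assert (Hn' : 16 * M * q ^ n <= eps * beta * q' ^ n).
  { rewrite Rabs_pos_eq in Hn by (apply pow_le; lra).
    assert (E : (q / q') ^ n = q ^ n / q' ^ n) by (unfold Rdiv; rewrite Rpow_mult_distr, pow_inv; reflexivity).
    rewrite E in Hn. left.
    replace (q ^ n) with (q ^ n / q' ^ n * q' ^ n) by (field; lra).
    replace (eps * beta * q' ^ n) with (16 * M * (eps * beta / (16 * M) * q' ^ n)) by (field; lra).
    apply Rmult_lt_compat_l; [lra|]. apply Rmult_lt_compat_r; assumption. }
  set (K := kernel Lam n).
  set (e2 := beta * q' ^ n * (eps / 2)).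
  assert (He2 : 0 < e2) by (repeat apply Rmult_lt_0_compat; lra).
  destruct (convolution_es a b a' b' Hs f (fun t => RtoC (K t)) Hf (kernel_trig_poly Lam n) e2 He2)
    as [T0 [HT0 Conv]].
  destruct (INR_unbounded (T0 / W)) as [k Hk].
  set (T := INR k * W).
  assert (HT : T0 <= T).
  { apply Rle_trans with (T0 / W * W); [right; field; lra|]. apply Rmult_le_compat_r; lra. }
  destruct (Conv T HT) as [E [HE BE]].
  specialize (Mass k n). fold T q' K in Mass.
  set (I := RInt K (- T) T) in *.
  assert (Hb2 : 0 < beta * q' ^ n) by (apply Rmult_lt_0_compat; assumption).
  assert (HI : 0 < I).
  { eapply Rlt_le_trans; [|exact Mass]. apply Rmult_lt_0_compat; [apply Rmult_lt_0_compat; lra|exact Hqn]. }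
  assert (HIC : RtoC I <> RtoC 0) by (intros X; injection X; lra).
  destruct (is_es_scal (/ RtoC I * RtoC (2 * T))%C E HE) as [N [c [lam HN]]].
  exists N, c, lam. intros z Hz. rewrite <- HN.
  change (Cmod (f z - / RtoC I * RtoC (2 * T) * E z)%C <= eps).
  specialize (BE z Hz).
  set (S := CI (fun t => f (z + RtoC t) * RtoC (K t))%C (- T) T) in *.
  assert (cK : forall t, cont_at dist_R (fun t => RtoC (K t)) t) by (intros; apply tp_cont, kernel_trig_poly).
  assert (cf : forall t, cont_at dist_R (fun t => f (z + RtoC t)%C) t).
  { intros t. apply (translate_cont a b a' b'); [exact Hs|apply Hf|exact Hz]. }
  assert (exK : exCI (fun t => RtoC (K t)) (- T) T) by (apply cont_exCI; [lra|auto]).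
  assert (exS : exCI (fun t => f (z + RtoC t) * RtoC (K t))%C (- T) T).
  { apply cont_exCI; [lra|]. intros t _. apply cont_at_mult; auto. }
  assert (EI : CI (fun t => RtoC (K t)) (- T) T = RtoC I).
  { unfold CI. apply injective_projections; simpl; [reflexivity|].
    rewrite RInt_const. unfold scal; simpl; unfold mult; simpl. ring. }
  assert (B1 : Cmod (S - f z * RtoC I) <= 2 * (eps / 8 * I + 2 * M * q ^ n * (2 * T))).
  { rewrite <- EI, <- (CI_scal (f z) _ _ _ exK). unfold S.
    rewrite <- CI_minus; [|lra|exact exS|apply exCI_scal, exK].
    assert (exG : ex_RInt (fun t => plus (scal (eps / 8) (K t)) (2 * M * q ^ n)) (- T) T).
    { apply (ex_RInt_plus (V := R_NormedModule) (fun t => scal (eps / 8) (K t)));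
        [apply (ex_RInt_scal (V := R_NormedModule)), kernel_ex|apply ex_RInt_const]. }
    assert (EG : RInt (fun t => plus (scal (eps / 8) (K t)) (2 * M * q ^ n)) (- T) T
       = eps / 8 * I + 2 * M * q ^ n * (2 * T)).
    { rewrite (RInt_plus (V := R_CompleteNormedModule));
        [|apply (ex_RInt_scal (V := R_NormedModule)), kernel_ex|apply ex_RInt_const].
      rewrite (RInt_scal (V := R_CompleteNormedModule)) by apply kernel_ex.
      rewrite RInt_const. fold I. unfold plus, scal; simpl; unfold mult; simpl. ring. }
    rewrite <- EG. apply CI_bound_fun; [lra|apply exCI_minus; [exact exS|apply exCI_scal, exK]|exact exG|].
    intros t _. change (Cmod (f (z + RtoC t) * RtoC (K t) - f z * RtoC (K t))%C <= eps / 8 * K t + 2 * M * q ^ n).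
    replace (f (z + RtoC t) * RtoC (K t) - f z * RtoC (K t))%C with ((f (z + RtoC t) - f z) * RtoC (K t))%C by ring.
    assert (Kb := kernel_bounds Lam n t). fold K in Kb.
    rewrite Cmod_mult, Cmod_R, Rabs_pos_eq by apply Kb.
    assert (Hqp : 0 <= 2 * M * q ^ n) by (apply Rmult_le_pos; [lra|apply pow_le, Hq]).
    destruct (classic (bohr Lam d t)) as [Y|No].
    - assert (A := Near t Y z Hz).
      assert (Cmod (f (z + RtoC t) - f z)%C * K t <= eps / 8 * K t) by (apply Rmult_le_compat_r; [apply Kb|exact A]).
      lra.
    - assert (A := kernel_small Lam d n t ltac:(lra) No). fold K q in A.
      assert (B : Cmod (f (z + RtoC t) - f z)%C <= 2 * M).
      { eapply Rle_trans; [apply Cmod_minus_le|].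
        assert (X1 := BM z Hz). assert (X2 := BM _ (rstrip_shift _ _ z t Hz)). lra. }
      assert (Cmod (f (z + RtoC t) - f z)%C * K t <= 2 * M * q ^ n)
        by (apply Rmult_le_compat; [apply Cmod_ge_0|apply Kb|exact B|exact A]).
      assert (0 <= eps / 8 * K t) by (apply Rmult_le_pos; lra). lra. }
  assert (B2 : 2 * T * (beta * q' ^ n) <= I) by (rewrite <- Rmult_assoc; exact Mass).
  assert (HT2 : 0 < T) by lra.
  assert (B3 : 2 * (2 * M * q ^ n * (2 * T)) <= eps / 4 * I).
  { apply Rle_trans with (eps / 4 * (2 * T * (beta * q' ^ n))); [|apply Rmult_le_compat_l; lra].
    replace (2 * (2 * M * q ^ n * (2 * T))) with (T / 2 * (16 * M * q ^ n)) by field.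
    replace (eps / 4 * (2 * T * (beta * q' ^ n))) with (T / 2 * (eps * beta * q' ^ n)) by field.
    apply Rmult_le_compat_l; lra. }
  assert (B4 : 2 * T * e2 <= eps / 2 * I).
  { unfold e2. replace (2 * T * (beta * q' ^ n * (eps / 2))) with (eps / 2 * (2 * T * (beta * q' ^ n))) by ring.
    apply Rmult_le_compat_l; lra. }
  apply (Rmult_le_reg_r I); [exact HI|].
  replace (Cmod (f z - / RtoC I * RtoC (2 * T) * E z)%C * I)
    with (Cmod ((S - RtoC (2 * T) * E z) - (S - f z * RtoC I))%C).
  - eapply Rle_trans; [apply Cmod_minus_le|]. lra.
  - rewrite <- (Rabs_pos_eq I) at 3 by lra. rewrite <- Cmod_R, <- Cmod_mult. f_equal. field. exact HIC.
Qed.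

(** * Meromorphic solutions *)

Lemma locally_disc (z0 : C) (P : C -> Prop) : locally (T := C_UniformSpace) z0 P ->
  exists r, 0 < r /\ forall w, Cmod (w - z0) <= r -> P w.
Proof.
  intros [e H]. assert (He := cond_pos e). exists (e / 2). split; [lra|]. intros w Hw.
  apply H. split.
  - change (Rabs (fst w - fst z0) < e). assert (A := Cmod_Re (w - z0)%C).
    change (Rabs (fst w - fst z0) <= Cmod (w - z0)) in A. lra.
  - change (Rabs (snd w - snd z0) < e). assert (A := Cmod_Im (w - z0)%C).
    change (Rabs (snd w - snd z0) <= Cmod (w - z0)) in A. lra.
Qed.

Lemma ex_derive_Cdiff (f : C -> C) (z : C) :
  ex_derive (K := C_AbsRing) (V := C_NormedModule) f z -> Cdiff f z.
Proof.
  intros [l [_ H]]. apply (eps_Cdiff f z l). intros eps He.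
  specialize (H z (fun P HP => HP) (mkposreal eps He)). destruct H as [d Hd].
  exists d. split; [apply cond_pos|]. intros w Hw. specialize (Hd w Hw).
  change (Cmod (f w - f z - (w - z) * l)%C <= eps * Cmod (w - z)) in Hd.
  replace (f w - (f z + l * (w - z)))%C with (f w - f z - (w - z) * l)%C by ring. exact Hd.
Qed.

Lemma analytic_disc (g : C -> C) (z0 : C) : analytic_at g z0 ->
  exists r, 0 < r /\ forall w, Cmod (w - z0) <= r -> Cdiff g w.
Proof.
  intros H. destruct (locally_disc z0 _ H) as [r [Hr Hw]]. exists r. split; [exact Hr|].
  intros w Hd. apply ex_derive_Cdiff, Hw, Hd.
Qed.

Lemma punctured_point (z0 : C) (r : R) : 0 < r -> exists z, z <> z0 /\ Cmod (z - z0) <= r.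
Proof.
  intros Hr. exists (z0 + RtoC r)%C. split.
  - intros E. assert (E2 : RtoC r = RtoC 0).
    { replace (RtoC r) with (z0 + RtoC r - z0)%C by ring. rewrite E. ring. }
    injection E2. lra.
  - replace (z0 + RtoC r - z0)%C with (RtoC r) by ring. rewrite Cmod_R, Rabs_pos_eq; lra.
Qed.

Lemma zero_by_continuity (h : C -> C) (z0 : C) (r : R) : 0 < r -> cont_at dist_C h z0 ->
  (forall z, z <> z0 -> Cmod (z - z0) <= r -> h z = RtoC 0) -> h z0 = RtoC 0.
Proof.
  intros Hr Hc H. apply Cmod_small. intros e He. destruct (Hc e He) as [d [Hd Hdel]].
  destruct (punctured_point z0 (Rmin r (d / 2))) as [z [Hz1 Hz2]]; [apply Rmin_pos; lra|].
  assert (Hz3 : Cmod (z - z0) <= r) by (eapply Rle_trans; [exact Hz2|apply Rmin_l]).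
  assert (Hz4 : Cmod (z - z0) <= d / 2) by (eapply Rle_trans; [exact Hz2|apply Rmin_r]).
  specialize (Hdel z ltac:(unfold dist_C; lra)). rewrite (H z Hz1 Hz3) in Hdel.
  replace (0 - h z0)%C with (- h z0)%C in Hdel by ring. rewrite Cmod_opp in Hdel. lra.
Qed.

(** Riemann's removable singularity theorem for a quotient by a power. *)
Lemma divide_zeros (z0 : C) (r X : R) (k : nat) : 0 < r -> forall G : C -> C,
  (forall z, Cmod (z - z0) <= r -> Cdiff G z) ->
  (forall z, z <> z0 -> Cmod (z - z0) <= r -> Cmod (G z) <= X * Cmod (z - z0) ^ k) ->
  exists U, (forall z, Cmod (z - z0) <= r -> Cdiff U z) /\
    forall z, G z = (Cpow (z - z0) k * U z)%C.
Proof.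
  intros Hr. induction k as [|k IH]; intros G DG BG.
  - exists G. split; [exact DG|]. intros z. simpl. ring.
  - assert (G0 : G z0 = RtoC 0).
    { apply Cmod_small. intros e He.
      assert (Dz : Cdiff G z0).
      { apply DG. rewrite Cmod_diag. lra. }
      destruct (Cdiff_cont G z0 Dz (e / 2) ltac:(lra)) as [d [Hd Hdel]].
      assert (HX : 0 <= Rabs X) by apply Rabs_pos.
      set (s := Rmin (Rmin r 1) (Rmin (d / 2) (e / (2 * (Rabs X + 1))))).
      assert (Hs : 0 < s).
      { apply Rmin_pos; apply Rmin_pos; try lra. apply Rdiv_lt_0_compat; lra. }
      assert (S1 : s <= r) by (Rmin_le).
      assert (S2 : s <= 1) by (Rmin_le).
      assert (S3 : s <= d / 2) by (Rmin_le).
      assert (S4 : s <= e / (2 * (Rabs X + 1))) by (Rmin_le).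
      destruct (punctured_point z0 s Hs) as [z [Hz1 Hz2]].
      assert (Hc := Cmod_ge_0 (z - z0)%C).
      specialize (Hdel z ltac:(unfold dist_C; lra)). specialize (BG z Hz1 ltac:(lra)).
      assert (P : Cmod (z - z0) ^ S k <= s).
      { simpl. rewrite <- (Rmult_1_r s). apply Rmult_le_compat; [exact Hc|apply pow_le, Hc|exact Hz2|].
        rewrite <- (pow1 k). apply pow_incr. lra. }
      assert (P0 : 0 <= Cmod (z - z0) ^ S k) by (apply pow_le, Hc).
      assert (B : Cmod (G z) <= e / 2).
      { eapply Rle_trans; [exact BG|].
        apply Rle_trans with (Rabs X * Cmod (z - z0) ^ S k);
          [apply Rmult_le_compat_r; [exact P0|apply Rle_abs]|].
        apply Rle_trans with ((Rabs X + 1) * (e / (2 * (Rabs X + 1)))); [|right; field; lra].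
        apply Rmult_le_compat; lra. }
      rewrite Cmod_minus_sym in Hdel. assert (T := Cmod_tri_inv (G z0) (G z)). lra. }
    destruct (divide_zero G z0 r Hr DG G0) as [G1 [E1 D1]].
    destruct (IH G1 D1) as [U [DU EU]].
    + intros z Hz1 Hz2. specialize (BG z Hz1 Hz2). rewrite E1, Cmod_mult in BG.
      assert (Hp : 0 < Cmod (z - z0)) by (apply Cmod_gt_0; intros E; apply Hz1, C_eq_minus, E).
      apply (Rmult_le_reg_l (Cmod (z - z0))); [exact Hp|].
      eapply Rle_trans; [exact BG|]. right. simpl. ring.
    + exists U. split; [exact DU|]. intros z. rewrite E1, EU. simpl. ring.
Qed.

(** Multiplying [sum_k A_k v^k = 0] by [A_(d+1)^d] turns it into a monic equation for
    [x = A_(d+1) v], whose non-leading part is [monic_tail A d z x (d + 1)]. *)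
Fixpoint monic_tail (A : nat -> C -> C) (d : nat) (z x : C) (n : nat) : C :=
  match n with
  | O => RtoC 0
  | S k => (monic_tail A d z x k + A k z * Cpow (A (S d) z) (d - k) * Cpow x k)%C
  end.

Lemma monic_tail_eq (A : nat -> C -> C) (d : nat) (z v : C) (n : nat) : (n <= d)%nat ->
  (Cpow (A (S d) z) d * psum A z v n)%C = monic_tail A d z (A (S d) z * v) (S n).
Proof.
  induction n as [|n IH]; intros Hn.
  - simpl. rewrite Nat.sub_0_r. ring.
  - change (monic_tail A d z (A (S d) z * v) (S (S n))) with
      (monic_tail A d z (A (S d) z * v) (S n) +
       A (S n) z * Cpow (A (S d) z) (d - S n) * Cpow (A (S d) z * v) (S n))%C.
    rewrite <- IH by lia.
    change (psum A z v (S n)) with (psum A z v n + A (S n) z * Cpow v (S n))%C.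
    rewrite Cpow_mult_l. set (t := A (S d) z).
    replace (Cpow t d) with (Cpow t (d - S n) * Cpow t (S n))%C
      by (rewrite <- Cpow_add_r; f_equal; lia).
    ring.
Qed.

Lemma monic_root (A : nat -> C -> C) (d : nat) (z v : C) : psum A z v (S d) = RtoC 0 ->
  (monic_tail A d z (A (S d) z * v) (S d) + Cpow (A (S d) z * v) (S d))%C = RtoC 0.
Proof.
  intros H. rewrite <- monic_tail_eq by lia.
  replace (Cpow (A (S d) z) d * psum A z v d + Cpow (A (S d) z * v) (S d))%C
    with (Cpow (A (S d) z) d * psum A z v (S d))%C.
  - rewrite H. ring.
  - change (psum A z v (S d)) with (psum A z v d + A (S d) z * Cpow v (S d))%C.
    rewrite Cpow_mult_l. simpl Cpow. ring.
Qed.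

Lemma monic_root_bound (A : nat -> C -> C) (d : nat) (B : R) (z x : C) : 1 <= B ->
  (forall k, (k <= S d)%nat -> Cmod (A k z) <= B) ->
  (monic_tail A d z x (S d) + Cpow x (S d))%C = RtoC 0 -> Cmod x <= INR (S d) * B ^ S d + 1.
Proof.
  intros HB HA H. set (X := Cmod x). assert (HX : 0 <= X) by apply Cmod_ge_0.
  assert (HBp : 0 < B ^ S d) by (apply pow_lt; lra).
  assert (HId : 0 <= INR (S d)) by apply pos_INR.
  destruct (Rle_dec X 1) as [Y|N].
  - assert (0 <= INR (S d) * B ^ S d) by (apply Rmult_le_pos; lra). lra.
  - assert (T : forall n, (n <= S d)%nat -> Cmod (monic_tail A d z x n) <= INR n * (B ^ S d * X ^ d)).
    { induction n as [|n IH]; intros Hn.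
      - simpl. rewrite Cmod_0. lra.
      - rewrite S_INR. cbn [monic_tail]. eapply Rle_trans; [apply Cmod_triangle|].
        rewrite Rmult_plus_distr_r, Rmult_1_l. apply Rplus_le_compat; [apply IH; lia|].
        rewrite !Cmod_mult, !Cmod_pow. fold X.
        assert (M1 : Cmod (A n z) * Cmod (A (S d) z) ^ (d - n) <= B ^ S d).
        { apply Rle_trans with (B * B ^ (d - n)).
          - apply Rmult_le_compat; [apply Cmod_ge_0|apply pow_le, Cmod_ge_0|apply HA; lia|].
            apply pow_incr. split; [apply Cmod_ge_0|apply HA; lia].
          - apply (Rle_pow B (S (d - n)) (S d)); [exact HB|lia]. }
        apply Rmult_le_compat; [apply Rmult_le_pos; [apply Cmod_ge_0|apply pow_le, Cmod_ge_0]|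
          apply pow_le, HX|exact M1|apply Rle_pow; [lra|lia]]. }
    specialize (T (S d) (le_n _)).
    assert (E : X ^ S d = Cmod (monic_tail A d z x (S d))).
    { unfold X. rewrite <- Cmod_pow, <- (Cmod_opp (monic_tail A d z x (S d))). f_equal.
      apply C_eq_minus. rewrite <- H. ring. }
    rewrite <- E in T. simpl pow at 1 in T.
    assert (HXd : 0 < X ^ d) by (apply pow_lt; lra).
    assert (X <= INR (S d) * B ^ S d); [|lra].
    apply (Rmult_le_reg_r (X ^ d)); [exact HXd|].
    eapply Rle_trans; [exact T|]. right. ring.
Qed.

Lemma monic_APpoly (a b : Rbar) (A : nat -> C -> C) (d : nat) : (forall k, APH a b (A k)) ->
  APpoly a b (S d) (fun z x => monic_tail A d z x (S d) + Cpow x (S d))%C.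
Proof.
  intros HA.
  assert (T : forall n, APpoly a b n (fun z x => monic_tail A d z x (S n))).
  { assert (Hc : forall k, APH a b (fun z => A k z * Cpow (A (S d) z) (d - k))%C).
    { intros k. apply (APH_mult a b (A k)); [apply HA|apply APH_pow, HA]. }
    induction n as [|n IH].
    - apply (APpoly_ext a b 0 (fun z _ => A O z * Cpow (A (S d) z) (d - 0))%C).
      + intros z v _. simpl. ring.
      + apply (APpoly_0 a b (fun z => A O z * Cpow (A (S d) z) (d - 0))%C), Hc.
    - apply (APpoly_S a b n (fun z x => monic_tail A d z x (S n))
        (fun z => A (S n) z * Cpow (A (S d) z) (d - S n))%C IH), Hc. }
  apply (APpoly_ext a b (S d) (fun z x => monic_tail A d z x (S d) + RtoC 1 * Cpow x (S d))%C);
    [intros; ring|].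
  apply (APpoly_S a b d (fun z x => monic_tail A d z x (S d)) (fun _ => RtoC 1)); [apply T|apply APH_const].
Qed.

Lemma psum_Cdiff (p : nat -> C -> C) (u : C -> C) (n : nat) (z : C) : (forall k, Cdiff (p k) z) ->
  Cdiff u z -> Cdiff (fun z => psum p z (u z) n) z.
Proof.
  intros Hp Hu. induction n as [|n IH]; simpl; [apply Hp|].
  apply (Cdiff_plus (fun z => psum p z (u z) n) (fun z => p (S n) z * (u z * Cpow (u z) n))%C z IH).
  apply Cdiff_mult; [apply Hp|]. apply (Cdiff_pow u z (S n) Hu).
Qed.

Section Meromorphic.

Variables (a b : Rbar) (w : C -> option C).
Hypothesis (hw : meromorphic_on (strip a b) w).

Lemma finite_around (z0 : C) : strip a b z0 -> exists r, 0 < r /\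
  forall z, z <> z0 -> Cmod (z - z0) <= r -> exists v, w z = Some v.
Proof.
  intros Hz. destruct (hw z0 Hz) as [[g [_ H]]|[_ [k [g [_ [_ [_ H]]]]]]].
  - destruct (locally_disc z0 _ H) as [r [Hr Hg]]. exists r. split; [exact Hr|].
    intros z _ Hd. eexists. apply Hg, Hd.
  - destruct (locally_disc z0 _ H) as [r [Hr Hg]]. exists r. split; [exact Hr|].
    intros z Hne Hd. eexists. apply Hg; assumption.
Qed.

Lemma finite_regular (z0 v : C) : strip a b z0 -> w z0 = Some v -> regular_at w z0.
Proof.
  intros Hz E. destruct (hw z0 Hz) as [H|[H _]]; [exact H|]. congruence.
Qed.

Definition finite_part (z : C) : C := match w z with Some v => v | None => RtoC 0 end.

Lemma finite_part_Cdiff (z0 v : C) : strip a b z0 -> w z0 = Some v -> Cdiff finite_part z0.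
Proof.
  intros Hz E. destruct (finite_regular z0 v Hz E) as [g [Hg Hw]].
  destruct (analytic_disc g z0 Hg) as [r1 [Hr1 D1]].
  destruct (locally_disc z0 _ Hw) as [r [Hr Hwg]].
  apply (Cdiff_local g finite_part z0 r Hr).
  - intros z Hd. unfold finite_part. rewrite Hwg by lra. reflexivity.
  - apply D1. rewrite Cmod_diag. lra.
Qed.

(** At a pole [z0], [al * w] is a bounded quotient of a holomorphic function by a power of
    [z - z0], so the numerator vanishes to at least that order. *)
Lemma product_extends (al : C -> C) : holo a b al ->
  (forall a' b', substrip a' b' a b -> exists X, forall z v, rstrip a' b' z -> w z = Some v ->
     Cmod (al z * v) <= X) ->
  exists u, holo a b u /\ forall z v, strip a b z -> w z = Some v -> u z = (al z * v)%C.
Proof.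
  intros Hal Hbd.
  assert (Loc : forall z0, strip a b z0 -> exists r U, 0 < r /\
    (forall z, Cmod (z - z0) <= r -> Cdiff U z) /\
    (forall z, z <> z0 -> Cmod (z - z0) <= r -> exists v, w z = Some v /\ U z = (al z * v)%C) /\
    (forall v, w z0 = Some v -> U z0 = (al z0 * v)%C)).
  { intros z0 Hz0. destruct (strip_open a b z0 Hz0) as [r0 [Hr0 O0]].
    destruct (hw z0 Hz0) as [[g [Hg Hw]]|[Hnone [k [g [Hk [Hg [_ Hw]]]]]]].
    - destruct (analytic_disc g z0 Hg) as [r1 [Hr1 D1]].
      destruct (locally_disc z0 _ Hw) as [r2 [Hr2 Hwg]].
      set (r := Rmin r0 (Rmin r1 r2)).
      assert (Hr : 0 < r) by (repeat apply Rmin_pos; assumption).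
      assert (L0 : r <= r0) by apply Rmin_l.
      assert (L1 : r <= r1) by (Rmin_le).
      assert (L2 : r <= r2) by (Rmin_le).
      exists r, (fun z => al z * g z)%C. split; [exact Hr|]. split; [|split].
      + intros z Hz. apply Cdiff_mult; [apply Hal, O0; lra|apply D1; lra].
      + intros z _ Hz. exists (g z). split; [apply Hwg; lra|reflexivity].
      + intros v E. rewrite Hwg in E; [injection E as <-; reflexivity|].
        rewrite Cmod_diag. lra.
    - destruct (analytic_disc g z0 Hg) as [r1 [Hr1 D1]].
      destruct (locally_disc z0 _ Hw) as [r2 [Hr2 Hwg]].
      destruct (substrip_point a b z0 Hz0) as [a' [b' [Hs Hz0']]].
      destruct (substrip_margin a' b' a b Hs) as [r3 [Hr3 Hs']].
      destruct (Hbd _ _ Hs') as [X HX].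
      set (r := Rmin (Rmin r0 r3) (Rmin r1 r2)).
      assert (Hr : 0 < r) by (apply Rmin_pos; apply Rmin_pos; assumption).
      assert (L0 : r <= r0) by (Rmin_le).
      assert (L3 : r <= r3) by (Rmin_le).
      assert (L1 : r <= r1) by (Rmin_le).
      assert (L2 : r <= r2) by (Rmin_le).
      assert (Hnz : forall z, z <> z0 -> Cpow (z - z0) k <> RtoC 0).
      { intros z Hne. apply Cpow_nz. intros E. apply Hne, C_eq_minus, E. }
      destruct (divide_zeros z0 r X k Hr (fun z => al z * g z)%C) as [U [DU EU]].
      + intros z Hz. apply Cdiff_mult; [apply Hal, O0; lra|apply D1; lra].
      + intros z Hne Hz. assert (E := Hwg z ltac:(lra) Hne).
        assert (B := HX z _ (rstrip_disc a' b' r3 z0 z Hz0' ltac:(lra)) E).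
        rewrite <- Cmod_pow.
        replace (al z * g z)%C with ((al z * (g z / Cpow (z - z0) k)) * Cpow (z - z0) k)%C
          by (field; apply Hnz, Hne).
        rewrite Cmod_mult. apply Rmult_le_compat_r; [apply Cmod_ge_0|exact B].
      + exists r, U. split; [exact Hr|]. split; [exact DU|]. split; [|congruence].
        intros z Hne Hz. eexists. split; [apply Hwg; [lra|exact Hne]|].
        assert (E := EU z). cbv beta in E.
        replace (al z * (g z / Cpow (z - z0) k))%C with ((al z * g z) / Cpow (z - z0) k)%C
          by (field; apply Hnz, Hne).
        rewrite E. field. apply Hnz, Hne. }
  set (ext := fun z0 x => exists r U, 0 < r /\
    (forall z, Cmod (z - z0) <= r -> Cdiff U z) /\
    (forall z, z <> z0 -> Cmod (z - z0) <= r -> exists v, w z = Some v /\ U z = (al z * v)%C) /\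
    U z0 = x).
  set (u := fun z => match w z with Some v => (al z * v)%C
     | None => epsilon (inhabits (RtoC 0)) (ext z) end).
  exists u. split.
  - intros z0 Hz0. destruct (Loc z0 Hz0) as [r [U [Hr [DU [EU E0]]]]].
    assert (Hc : Cmod (z0 - z0) <= r).
    { rewrite Cmod_diag. lra. }
    apply (Cdiff_local U u z0 r Hr); [|apply DU, Hc].
    intros z Hz. destruct (classic (z = z0)) as [->|Hne].
    + unfold u. destruct (w z0) as [v|] eqn:Ew; [apply E0; reflexivity|].
      assert (Hex : exists x, ext z0 x) by (exists (U z0), r, U; auto).
      destruct (epsilon_spec (inhabits (RtoC 0)) (ext z0) Hex) as [r' [U' [Hr' [DU' [EU' E']]]]].
      rewrite <- E'. apply C_eq_minus.
      assert (Hc' : Cmod (z0 - z0) <= r').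
      { rewrite Cmod_diag. lra. }
      apply (zero_by_continuity (fun z => U z - U' z)%C z0 (Rmin r r')); [apply Rmin_pos; assumption| |].
      * apply Cdiff_cont, Cdiff_minus; [apply DU, Hc|apply DU', Hc'].
      * intros x Hx1 Hx2.
        destruct (EU x Hx1 ltac:(eapply Rle_trans; [exact Hx2|apply Rmin_l])) as [v [V1 V2]].
        destruct (EU' x Hx1 ltac:(eapply Rle_trans; [exact Hx2|apply Rmin_r])) as [v' [V1' V2']].
        rewrite V1 in V1'. injection V1' as <-. rewrite V2, V2'. ring.
    + destruct (EU z Hne ltac:(lra)) as [v [V1 V2]]. unfold u. rewrite V1. exact V2.
  - intros z v _ E. unfold u. rewrite E. reflexivity.
Qed.

(** The product satisfies a monic equation, hence is bounded; so it extends over the poles and is a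
    bounded holomorphic root. *)
Lemma cleared_solution_APH (A : nat -> C -> C) (d : nat) : (forall k, APH a b (A k)) ->
  non_null a b (A (S d)) ->
  (forall z v, strip a b z -> w z = Some v -> psum A z v (S d) = RtoC 0) ->
  exists u, APH a b u /\ forall z v, strip a b z -> w z = Some v -> u z = (A (S d) z * v)%C.
Proof.
  intros HA HN Heq.
  set (Fz := fun z x => (monic_tail A d z x (S d) + Cpow x (S d))%C).
  assert (Bd : forall a' b', substrip a' b' a b -> exists X, 0 < X /\ forall z x, rstrip a' b' z ->
     Fz z x = RtoC 0 -> Cmod x <= X).
  { intros a' b' Hs. destruct (family_bound a b A (S d) a' b') as [B [HB H]];
      [intros k; apply (HA k)|exact Hs|].
    assert (HP : 0 < (B + 1) ^ S d) by (apply pow_lt; lra).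
    exists (INR (S d) * (B + 1) ^ S d + 1). split.
    - assert (0 <= INR (S d) * (B + 1) ^ S d) by (apply Rmult_le_pos; [apply pos_INR|lra]). lra.
    - intros z x Hz E. apply (monic_root_bound A d (B + 1) z x); [lra| |exact E].
      intros k Hk. specialize (H k z Hk Hz). lra. }
  destruct (product_extends (A (S d))) as [u [Hu Eu]].
  - apply HA.
  - intros a' b' Hs. destruct (Bd a' b' Hs) as [X [_ HX]]. exists X. intros z v Hz E.
    apply (HX z _ Hz). apply monic_root, Heq; [|exact E]. apply (rstrip_strip a' b'); assumption.
  - exists u. split; [|exact Eu].
    destruct (monic_APpoly a b A d HA) as [q [Hq Eq]].
    assert (Root : forall z, strip a b z -> Fz z (u z) = RtoC 0).
    { intros z0 Hz0. destruct (finite_around z0 Hz0) as [r1 [Hr1 Fin]].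
      destruct (strip_open a b z0 Hz0) as [r2 [Hr2 O2]].
      unfold Fz. rewrite Eq by exact Hz0.
      apply (zero_by_continuity (fun z => psum q z (u z) (S d)) z0 (Rmin r1 r2)); [apply Rmin_pos; assumption| |].
      - apply Cdiff_cont, psum_Cdiff; [intros k; apply (Hq k), Hz0|apply Hu, Hz0].
      - intros z Hne Hz.
        destruct (Fin z Hne ltac:(eapply Rle_trans; [exact Hz|apply Rmin_l])) as [v Ev].
        assert (Hzs : strip a b z) by (apply O2; eapply Rle_trans; [exact Hz|apply Rmin_r]).
        rewrite <- Eq by exact Hzs. rewrite (Eu z v Hzs Ev).
        apply monic_root, Heq; assumption. }
    assert (HBu : HB a b u).
    { split; [exact Hu|]. intros a' b' Hs. destruct (Bd a' b' Hs) as [X [HX HXz]].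
      exists X. split; [exact HX|]. intros z Hz. apply (HXz z _ Hz), Root.
      apply (rstrip_strip a' b'); assumption. }
    apply (HB_root_APH a b u (S d) Fz HBu); [apply monic_APpoly, HA|exact Root|].
    destruct HN as [z [Hz _]].
    destruct (substrip_point a b z Hz) as [a' [b' [Hs Hz']]].
    destruct (Bd a' b' Hs) as [X [HX HXz]].
    exists z, (RtoC (X + 1)). split; [exact Hz|]. intros E.
    specialize (HXz z _ Hz' E). rewrite Cmod_R, Rabs_pos_eq in HXz; lra.
Qed.

Section Quotient.

Variables (al u : C -> C).
Hypothesis (Hal : APH a b al) (Hu : APH a b u) (Nal : non_null a b al).
Hypothesis (Eu : forall z v, strip a b z -> w z = Some v -> u z = (al z * v)%C).

Lemma al_not_zero_nearby (z0 : C) (r : R) : strip a b z0 -> 0 < r ->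
  exists z, Cmod (z - z0) <= r /\ al z <> RtoC 0.
Proof.
  intros Hz Hr. apply NNPP. intros No. destruct Nal as [z1 [Hz1 N1]]. apply N1.
  apply (HB_identity a b al z0 r (proj1 Hal) Hz Hr); [|exact Hz1].
  intros z Hd. apply NNPP. intros Hne. apply No. exists z. auto.
Qed.

Lemma al_circle (z0 : C) (r : R) : strip a b z0 -> 0 < r ->
  exists rho m, 0 < rho /\ rho <= r /\ 0 < m /\ forall z, Cmod (z - z0) = rho -> m <= Cmod (al z).
Proof.
  intros Hz Hr. destruct (substrip_point a b z0 Hz) as [a' [b' [Hs Hz']]].
  destruct (substrip_margin a' b' a b Hs) as [R [HR Hs']].
  destruct (proj2 (proj1 Hal) _ _ Hs') as [M [HM BM]].
  destruct (al_not_zero_nearby z0 (R / 2) Hz ltac:(lra)) as [z1 [Hz1 N1]].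
  apply Cmod_gt_0 in N1.
  destruct (min_modulus M R r (Cmod (al z1)) ltac:(lra) HR Hr N1) as [m [Hm H]].
  destruct (H al z0) as [rho [R1 [R2 R3]]].
  - intros z Hd. assert (Hin := rstrip_disc a' b' R z0 z Hz' Hd). split; [|apply BM, Hin].
    apply (proj1 (proj1 Hal)), (rstrip_strip _ _ a b z Hs'), Hin.
  - exists z1. split; [exact Hz1|lra].
  - exists rho, m. auto.
Qed.

(** A pole recurs: if there were no pole near [z0 + tau] for a Bohr-small [tau], then [w] would be
    bounded there by its values on a circle, and [u = al w] translated back would contradict the size
    of [w] near [z0]. *)
Lemma poles_recur (z0 : C) : strip a b z0 -> w z0 = None ->
  exists al' be' rho, substrip al' be' a b /\ 0 < rho /\
  near0 (fun tau => exists p, rstrip al' be' p /\ Cmod (p - (z0 + RtoC tau))%C <= rho /\ w p = None).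
Proof.
  intros Hz0 Hnone.
  destruct (hw z0 Hz0) as [[g [_ Hg]]|[_ [k [g [Hk [Hg [Hg0 Hw]]]]]]].
  { exfalso. destruct (locally_disc z0 _ Hg) as [r [Hr H]].
    rewrite H in Hnone; [discriminate|]. rewrite Cmod_diag. lra. }
  destruct (substrip_point a b z0 Hz0) as [a' [b' [Hs Hz0']]].
  destruct (substrip_margin a' b' a b Hs) as [R [HR Hs']].
  assert (Hin : forall z, Cmod (z - z0) <= R -> rstrip (a' - R) (b' + R) z)
    by (intros; apply (rstrip_disc a' b' R z0); assumption).
  assert (Hst : forall z, rstrip (a' - R) (b' + R) z -> strip a b z)
    by (intros z Hz; apply (rstrip_strip _ _ a b z Hs' Hz)).
  destruct (proj2 (proj1 Hu) _ _ Hs') as [Mu [HMu BMu]].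
  destruct (locally_disc z0 _ Hw) as [r1 [Hr1 Hwg]].
  destruct (al_circle z0 (Rmin R r1) Hz0) as [rho [mu [Hrho [Hrho' [Hmu Circ]]]]]; [apply Rmin_pos; assumption|].
  assert (Hrho1 : rho <= R) by (eapply Rle_trans; [exact Hrho'|apply Rmin_l]).
  set (B := 4 * (2 * Mu / mu)).
  assert (HB : 0 < B).
  { unfold B. assert (0 < 2 * Mu / mu) by (apply Rdiv_lt_0_compat; lra). lra. }
  (* [w] tends to infinity at [z0], and [al] has no zero on suitable small circles. *)
  assert (Z1 : exists z1 v1, Cmod (z1 - z0) <= rho / 2 /\ w z1 = Some v1 /\ al z1 <> RtoC 0 /\ B + 1 <= Cmod v1).
  { destruct (analytic_disc g z0 Hg) as [r2 [Hr2 D2]].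
    destruct (nonzero_disc g z0) as [r3 [Hr3 N3]].
    { apply D2. rewrite Cmod_diag. lra. }
    { exact Hg0. }
    apply Cmod_gt_0 in Hg0. set (G0 := Cmod (g z0)) in *.
    set (s := Rmin (Rmin (rho / 2) r1) (Rmin (Rmin r3 1) (G0 / 2 / (B + 1)))).
    assert (Hs0 : 0 < s).
    { apply Rmin_pos; apply Rmin_pos; try lra; [apply Rmin_pos; lra|]. apply Rdiv_lt_0_compat; lra. }
    assert (L1 : s <= rho / 2) by (Rmin_le).
    assert (L2 : s <= r1) by (Rmin_le).
    assert (L3 : s <= r3) by (Rmin_le).
    assert (L4 : s <= 1) by (Rmin_le).
    assert (L5 : s <= G0 / 2 / (B + 1)) by (Rmin_le).
    destruct (al_circle z0 s Hz0 Hs0) as [rh [m [P1 [P2 [P3 P4]]]]].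
    set (z1 := (z0 + RtoC rh)%C).
    assert (Ed : Cmod (z1 - z0) = rh).
    { unfold z1. replace (z0 + RtoC rh - z0)%C with (RtoC rh) by ring. rewrite Cmod_R, Rabs_pos_eq; lra. }
    assert (Hne : z1 <> z0).
    { intros E. rewrite E in Ed. replace (z0 - z0)%C with (RtoC 0) in Ed by ring. rewrite Cmod_0 in Ed. lra. }
    assert (Hne' : Cpow (z1 - z0) k <> RtoC 0) by (apply Cpow_nz, Cmod_gt_0; lra).
    exists z1, (g z1 / Cpow (z1 - z0) k)%C. split; [lra|]. split; [apply Hwg; [lra|exact Hne]|]. split.
    - apply Cmod_gt_0. specialize (P4 z1 Ed). lra.
    - rewrite Cmod_div, Cmod_pow, Ed by exact Hne'.
      assert (Q : rh ^ k <= s).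
      { destruct k as [|k]; [lia|]. simpl. rewrite <- (Rmult_1_r s).
        apply Rmult_le_compat; [lra|apply pow_le; lra|exact P2|].
        rewrite <- (pow1 k). apply pow_incr. lra. }
      assert (Q0 : 0 < rh ^ k) by (apply pow_lt, P1).
      assert (N := N3 z1 ltac:(lra)).
      apply (Rmult_le_reg_r (rh ^ k)); [exact Q0|].
      replace (Cmod (g z1) / rh ^ k * rh ^ k) with (Cmod (g z1)) by (field; lra).
      eapply Rle_trans; [|exact N].
      apply Rle_trans with ((B + 1) * (G0 / 2 / (B + 1))); [|right; field; lra].
      apply Rmult_le_compat_l; lra. }
  destruct Z1 as [z1 [v1 [Hz1 [Ew1 [Na1 Bv1]]]]]. apply Cmod_gt_0 in Na1.
  set (kap := Cmod (al z1) / (B + 2)).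
  assert (Hkap : 0 < kap) by (apply Rdiv_lt_0_compat; lra).
  exists (a' - R), (b' + R), rho. split; [exact Hs'|]. split; [exact Hrho|].
  apply near0_imp with (2 := near0_and _ _ (proj2 Hal _ _ Hs' (mu / 2) ltac:(lra))
    (near0_and _ _ (proj2 Hal _ _ Hs' kap Hkap) (proj2 Hu _ _ Hs' kap Hkap))).
  intros tau [T1 [T2 T3]]. apply NNPP. intros No.
  assert (Fin : forall z, Cmod (z - (z0 + RtoC tau))%C <= rho ->
     rstrip (a' - R) (b' + R) z /\ exists v, w z = Some v).
  { intros z Hz.
    assert (Hzi : rstrip (a' - R) (b' + R) z).
    { replace z with ((z - RtoC tau) + RtoC tau)%C by ring. apply rstrip_shift, Hin.
      replace (z - RtoC tau - z0)%C with (z - (z0 + RtoC tau))%C by ring. lra. }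
    split; [exact Hzi|]. destruct (w z) as [v|] eqn:E; [exists v; reflexivity|].
    exfalso. apply No. exists z. auto. }
  assert (Bw : forall z, Cmod (z - (z0 + RtoC tau))%C <= rho / 2 -> Cmod (finite_part z) <= B).
  { apply (disc_bound finite_part (z0 + RtoC tau)%C rho (2 * Mu / mu) Hrho).
    - intros z Hz. destruct (Fin z Hz) as [Hzi [v Ev]]. apply (finite_part_Cdiff z v); [apply Hst, Hzi|exact Ev].
    - intros z Hz. destruct (Fin z ltac:(lra)) as [Hzi [v Ev]].
      unfold finite_part. rewrite Ev.
      set (y := (z - RtoC tau)%C).
      assert (Ey : z = (y + RtoC tau)%C) by (unfold y; ring).
      assert (Hy : Cmod (y - z0) = rho).
      { unfold y. replace (z - RtoC tau - z0)%C with (z - (z0 + RtoC tau))%C by ring. exact Hz. }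
      assert (A1 := Circ y Hy). assert (A2 := T1 y (Hin y ltac:(lra))). rewrite <- Ey in A2.
      rewrite Cmod_minus_sym in A2. assert (A3 := Cmod_tri_inv (al y) (al z)).
      assert (Ha : mu / 2 <= Cmod (al z)) by lra.
      assert (E := Eu z v (Hst z Hzi) Ev). assert (EC := f_equal Cmod E). rewrite Cmod_mult in EC.
      assert (BU := BMu z Hzi).
      apply (Rmult_le_reg_l (mu / 2)); [lra|].
      replace (mu / 2 * (2 * Mu / mu)) with Mu by (field; lra).
      apply Rle_trans with (Cmod (al z) * Cmod v); [|lra].
      apply Rmult_le_compat_r; [apply Cmod_ge_0|exact Ha]. }
  assert (Hz1t : Cmod (z1 + RtoC tau - (z0 + RtoC tau))%C <= rho / 2).
  { replace (z1 + RtoC tau - (z0 + RtoC tau))%C with (z1 - z0)%C by ring. exact Hz1. }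
  specialize (Bw _ Hz1t). destruct (Fin (z1 + RtoC tau)%C ltac:(lra)) as [Hz1i [v Ev]].
  unfold finite_part in Bw. rewrite Ev in Bw.
  assert (Hz1s : rstrip (a' - R) (b' + R) z1) by (apply Hin; lra).
  assert (E1 := f_equal Cmod (Eu z1 v1 (Hst z1 Hz1s) Ew1)). rewrite Cmod_mult in E1.
  assert (E2 := f_equal Cmod (Eu _ v (Hst _ Hz1i) Ev)). rewrite Cmod_mult in E2.
  specialize (T2 z1 Hz1s). specialize (T3 z1 Hz1s).
  assert (A1 := Cmod_tri_inv (al (z1 + RtoC tau)%C) (al z1)).
  assert (A2 := Cmod_tri_inv (u z1) (u (z1 + RtoC tau)%C)). rewrite Cmod_minus_sym in A2.
  assert (K : kap * (B + 2) = Cmod (al z1)) by (unfold kap; field; lra).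
  assert (Q1 : Cmod (al (z1 + RtoC tau)%C) * Cmod v <= (Cmod (al z1) + kap) * B)
    by (apply Rmult_le_compat; try apply Cmod_ge_0; lra).
  assert (Q2 : Cmod (al z1) * (B + 1) <= Cmod (al z1) * Cmod v1) by (apply Rmult_le_compat_l; lra).
  nra.
Qed.

(** Recurring poles have positive lower density, so their number is not [o(t)]. *)
Lemma few_poles_no_pole : (forall a' b', substrip a' b' a b -> few_poles w a' b') ->
  forall z0, strip a b z0 -> exists v, w z0 = Some v.
Proof.
  intros Few z0 Hz0. destruct (w z0) as [v|] eqn:Ew; [exists v; reflexivity|]. exfalso.
  destruct (poles_recur z0 Hz0 Ew) as [al' [be' [rho [Hs [Hrho Hrec]]]]].
  destruct (near0_dense _ Hrec) as [L [HL Dense]].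
  set (K := 2 * (L + rho) + 1). assert (HK : 0 < K) by (unfold K; lra).
  assert (Hp : forall n : nat, exists p, rstrip al' be' p /\ w p = None /\
     Rabs (Re p - (Re z0 + INR n * K)) <= L + rho).
  { intros n. destruct (Dense (INR n * K)) as [tau [Ht [p [P1 [P2 P3]]]]].
    exists p. split; [exact P1|]. split; [exact P3|].
    assert (A := Cmod_Re (p - (z0 + RtoC tau))%C).
    assert (E : Re (p - (z0 + RtoC tau))%C = Re p - Re z0 - tau) by (unfold Re; simpl; ring).
    rewrite E in A.
    replace (Re p - (Re z0 + INR n * K)) with ((Re p - Re z0 - tau) + (tau - INR n * K)) by ring.
    eapply Rle_trans; [apply Rabs_triang|]. lra. }
  set (p := fun n => proj1_sig (constructive_indefinite_description _ (Hp n))).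
  assert (Hpn : forall n, rstrip al' be' (p n) /\ w (p n) = None /\
     Rabs (Re (p n) - (Re z0 + INR n * K)) <= L + rho)
    by (intros n; apply (proj2_sig (constructive_indefinite_description _ (Hp n)))).
  assert (Hlt : forall i j, (i < j)%nat -> Re (p i) < Re (p j)).
  { intros i j Hij. destruct (Hpn i) as [_ [_ A1]]. destruct (Hpn j) as [_ [_ A2]].
    apply Rabs_le_between in A1. apply Rabs_le_between in A2.
    assert (INR i + 1 <= INR j) by (rewrite <- S_INR; apply le_INR; lia).
    assert (INR i * K + K <= INR j * K) by nra. unfold K in *. lra. }
  assert (Hinj : forall i j, p i = p j -> i = j).
  { intros i j E. destruct (Nat.lt_trichotomy i j) as [H|[H|H]]; [|exact H|];
      apply Hlt in H; rewrite E in H; lra. }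
  destruct (Few al' be' Hs) as [Nt [Hcard Hdom]].
  assert (He : 0 < / (2 * K)) by (apply Rinv_0_lt_compat; lra).
  destruct (Hdom (mkposreal _ He)) as [t0 Ht0].
  set (c := Rabs (Re z0) + L + rho + 1).
  assert (Hc : 0 < c) by (unfold c; assert (P := Rabs_pos (Re z0)); lra).
  destruct (INR_unbounded (c / K + Rabs t0 / K)) as [n Hn].
  set (t := INR n * K + c).
  assert (HnK : c + Rabs t0 < INR n * K).
  { replace (c + Rabs t0) with ((c / K + Rabs t0 / K) * K) by (field; lra).
    apply Rmult_lt_compat_r; assumption. }
  assert (Ht : t0 < t) by (unfold t; assert (A := Rle_abs t0); lra).
  specialize (Ht0 t Ht).
  assert (Ht1 : INR (Nt t) <= / (2 * K) * t).
  { change (Rabs (INR (Nt t)) <= / (2 * K) * Rabs t) in Ht0.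
    rewrite !Rabs_pos_eq in Ht0; [exact Ht0| |apply pos_INR].
    assert (A := Rabs_pos t0). unfold t. lra. }
  destruct (Hcard t) as [l [ND [Hlen Hl]]].
  assert (Hincl : incl (map p (seq 0 (S n))) l).
  { intros x Hx. apply in_map_iff in Hx. destruct Hx as [i [<- Hi]]. apply in_seq in Hi.
    apply Hl. destruct (Hpn i) as [B1 [B2 B3]]. split; [exact B1|]. split; [|exact B2].
    apply Rabs_le_between in B3. assert (Z := Rle_abs (Re z0)). assert (Z2 := Rle_abs (- Re z0)).
    rewrite Rabs_Ropp in Z2.
    assert (INR i <= INR n) by (apply le_INR; lia). assert (0 <= INR i) by apply pos_INR.
    assert (0 <= INR i * K) by (apply Rmult_le_pos; lra).
    assert (INR i * K <= INR n * K) by (apply Rmult_le_compat_r; lra).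
    apply Rabs_def1; unfold t, c; lra. }
  assert (NDm : NoDup (map p (seq 0 (S n))))
    by (apply FinFun.Injective_map_NoDup; [exact Hinj|apply seq_NoDup]).
  assert (Hle := NoDup_incl_length NDm Hincl). rewrite length_map, length_seq, Hlen in Hle.
  apply le_INR in Hle. rewrite S_INR in Hle.
  assert (E : / (2 * K) * t = INR n / 2 + c / (2 * K)) by (unfold t; field; lra).
  assert (Hck : c / (2 * K) <= INR n / 2).
  { apply (Rmult_le_reg_r (2 * K)); [lra|].
    replace (c / (2 * K) * (2 * K)) with c by (field; lra).
    assert (A := Rabs_pos t0). lra. }
  lra.
Qed.

(** By propagation [al] is uniformly not small near any point of the substrip, so every point is the
    centre of a small circle on which [al] is uniformly bounded below. *)
Lemma quotient_bdd : (forall z, strip a b z -> exists v, w z = Some v) -> HB a b finite_part.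
Proof.
  intros Fin.
  assert (Hf : holo a b finite_part).
  { intros z Hz. destruct (Fin z Hz) as [v Ev]. apply (finite_part_Cdiff z v Hz Ev). }
  split; [exact Hf|].
  assert (Euf : forall z, strip a b z -> u z = (al z * finite_part z)%C).
  { intros z Hz. destruct (Fin z Hz) as [v Ev]. unfold finite_part. rewrite Ev. apply Eu; assumption. }
  intros a' b' Hs0. destruct Nal as [zs [Hzs Nzs]]. apply Cmod_gt_0 in Nzs.
  destruct (substrip_point a b zs Hzs) as [a1 [b1 [Hs1 Hz1]]].
  assert (Hs := substrip_union _ _ _ _ _ _ Hs0 Hs1).
  assert (Hz2 := rstrip_union_r a' b' a1 b1 zs Hz1).
  assert (Hin : forall z, rstrip a' b' z -> rstrip (Rmin a' a1) (Rmax b' b1) z)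
    by (intros; apply rstrip_union_l; assumption).
  revert Hs Hz2 Hin. generalize (Rmin a' a1) (Rmax b' b1). intros lo hi Hs Hz2 Hin.
  destruct (substrip_margin lo hi a b Hs) as [R [HR Hs']].
  destruct (proj2 (proj1 Hal) _ _ Hs') as [M [HM BM]].
  destruct (proj2 (proj1 Hu) _ _ Hs') as [Mu [HMu BMu]].
  set (e := Cmod (al zs) / 4). assert (He : 0 < e) by (unfold e; lra).
  destruct (near0_dense _ (proj2 Hal lo hi Hs e He)) as [L [HL Dense]].
  destruct (propagation lo hi R M (R / 2) (L + (hi - lo)) e ltac:(lra) HR ltac:(lra) He) as [eta [Heta Carry]].
  assert (Hst : forall z, rstrip (lo - R) (hi + R) z -> strip a b z)
    by (intros z Hz; apply (rstrip_strip _ _ a b z Hs' Hz)).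
  assert (Hal' : forall z, rstrip (lo - R) (hi + R) z -> Cdiff al z /\ Cmod (al z) <= M).
  { intros z Hz. split; [apply (proj1 (proj1 Hal)), Hst, Hz|apply BM, Hz]. }
  destruct (min_modulus M R R eta ltac:(lra) HR HR Heta) as [m [Hm Circ]].
  exists (4 * (Mu / m)). split; [assert (0 < Mu / m) by (apply Rdiv_lt_0_compat; assumption); lra|].
  intros z0 Hz0. apply Hin in Hz0.
  assert (Hdisc : forall z, Cmod (z - z0) <= R -> rstrip (lo - R) (hi + R) z)
    by (intros; apply (rstrip_disc lo hi R z0); assumption).
  destruct (Circ al z0) as [rho [R1 [R2 R3]]].
  - intros z Hz. apply Hal', Hdisc, Hz.
  - apply NNPP. intros No.
    destruct (Dense (Re z0 - Re zs)) as [tau [Ht Htau]].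
    assert (Hzt : rstrip lo hi (zs + RtoC tau)%C) by (apply rstrip_shift, Hz2).
    assert (B : Cmod (al (zs + RtoC tau)%C) <= e).
    { apply (Carry al Hal' z0 Hz0); [|exact Hzt|].
      - intros z Hz. apply Rnot_lt_le. intros Lt. apply No. exists z. split; [exact Hz|lra].
      - eapply Rle_trans; [apply Cmod_le_parts|].
        assert (E1 : Re (zs + RtoC tau - z0)%C = tau - (Re z0 - Re zs)) by (unfold Re; simpl; ring).
        assert (E2 : Im (zs + RtoC tau - z0)%C = Im zs - Im z0) by (unfold Im; simpl; ring).
        rewrite E1, E2.
        assert (Rabs (Im zs - Im z0) <= hi - lo) by (destruct Hz0, Hz2; apply Rabs_le; lra). lra. }
    specialize (Htau zs Hz2). rewrite Cmod_minus_sym in Htau.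
    assert (T := Cmod_tri_inv (al zs) (al (zs + RtoC tau)%C)). unfold e in *. lra.
  - apply (disc_bound finite_part z0 rho (Mu / m) R1).
    + intros z Hz. apply Hf, Hst, Hdisc. lra.
    + intros z Hz. assert (Hzi : rstrip (lo - R) (hi + R) z) by (apply Hdisc; lra).
      assert (E := f_equal Cmod (Euf z (Hst z Hzi))). rewrite Cmod_mult in E.
      assert (BU := BMu z Hzi). specialize (R3 z Hz).
      apply (Rmult_le_reg_l m); [exact Hm|]. replace (m * (Mu / m)) with Mu by (field; lra).
      apply Rle_trans with (Cmod (al z) * Cmod (finite_part z)); [|lra].
      apply Rmult_le_compat_r; [apply Cmod_ge_0|exact R3].
    + rewrite Cmod_diag. lra.
Qed.

(** The quotient is a root of the linear polynomial [al v - u]. *)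
Lemma quotient_APH : (forall z, strip a b z -> exists v, w z = Some v) -> APH a b finite_part.
Proof.
  intros Fin.
  apply (HB_root_APH a b finite_part 1 (fun z v => - u z + al z * Cpow v 1)%C (quotient_bdd Fin)).
  - apply (APpoly_S a b 0 (fun z _ => - u z)%C al); [|exact Hal].
    apply (APpoly_opp a b 0 (fun z _ => u z)), APpoly_0, Hu.
  - intros z Hz. destruct (Fin z Hz) as [v Ev]. unfold finite_part. rewrite Ev, (Eu z v Hz Ev). simpl. ring.
  - destruct Nal as [z [Hz N]]. apply NNPP. intros No. apply N.
    assert (Z : forall v, (- u z + al z * Cpow v 1)%C = RtoC 0).
    { intros v. apply NNPP. intros Hne. apply No. exists z, v. auto. }
    assert (Z0 := Z (RtoC 0)). assert (Z1 := Z (RtoC 1)).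
    replace (al z) with ((- u z + al z * Cpow (RtoC 1) 1) - (- u z + al z * Cpow (RtoC 0) 1))%C by (simpl; ring).
    rewrite Z0, Z1. ring.
Qed.

End Quotient.

End Meromorphic.

Lemma sum_n_psum (A : nat -> C -> C) (z v : C) (n : nat) :
  sum_n (fun k => Cmult (A k z) (Cpow v k)) n = psum A z v n.
Proof.
  induction n as [|n IH].
  - rewrite sum_O. simpl. ring.
  - rewrite sum_Sn, IH. reflexivity.
Qed.

Lemma top_coefficient (a b : Rbar) (A : nat -> C -> C) (m : nat) :
  (exists k, (k <= m)%nat /\ non_null a b (A k)) ->
  exists M, (M <= m)%nat /\ non_null a b (A M) /\
    forall z v, strip a b z -> psum A z v m = psum A z v M.
Proof.
  induction m as [|m IH]; intros [k [Hk N]].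
  - exists O. split; [lia|]. split; [|reflexivity]. replace O with k by lia. exact N.
  - destruct (classic (non_null a b (A (S m)))) as [Y|No].
    + exists (S m). auto.
    + destruct IH as [M [HM [NM E]]].
      * exists k. split; [|exact N]. destruct (Nat.eq_dec k (S m)) as [->|]; [contradiction|lia].
      * exists M. split; [lia|]. split; [exact NM|]. intros z v Hz. cbn [psum].
        rewrite (not_non_null a b _ No z Hz), E by exact Hz. ring.
Qed.

Theorem theorem2 (a b : Rbar) (m : nat) (A : nat -> C -> C) (w : C -> option C)
  (hab : Rbar_lt a b)
  (hm : (1 <= m)%nat)
  (hA : forall k : nat, (k <= m)%nat -> AP a b (A k))
  (hA0 : exists k : nat, (k <= m)%nat /\ exists z : C, strip a b z /\ A k z <> RtoC 0)
  (hw : meromorphic_on (strip a b) w)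
  (heq : forall z v : C, strip a b z -> w z = Some v ->
     sum_n (fun k => Cmult (A k z) (Cpow v k)) m = RtoC 0)
  (hpoles : forall a' b' : R, substrip a' b' a b -> few_poles w a' b') :
  exists f : C -> C, AP a b f /\ forall z : C, strip a b z -> w z = Some (f z).
Proof.
  set (A' := fun k => if le_dec k m then A k else fun _ => RtoC 0).
  assert (HA' : forall k, APH a b (A' k)).
  { intros k. unfold A'. destruct (le_dec k m) as [L|_]; [apply AP_APH, hA, L|apply APH_const]. }
  assert (EA : forall k, (k <= m)%nat -> A' k = A k).
  { intros k Hk. unfold A'. destruct (le_dec k m); [reflexivity|contradiction]. }
  destruct (top_coefficient a b A' m) as [M [HM [NM EM]]].
  { destruct hA0 as [k [Hk N]]. exists k. split; [exact Hk|]. rewrite EA by exact Hk. exact N. }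
  assert (Heq : forall z v, strip a b z -> w z = Some v -> psum A' z v M = RtoC 0).
  { intros z v Hz Ev. rewrite <- EM, <- (heq z v Hz Ev), sum_n_psum by exact Hz.
    apply psum_ext. intros k Hk. rewrite EA by exact Hk. reflexivity. }
  destruct M as [|d].
  - (* The equation would read [A 0 = 0] at all finite points of [w]. *)
    exfalso. destruct NM as [z [Hz N]]. destruct (finite_around a b w hw z Hz) as [r1 [Hr1 Fin]].
    destruct (strip_open a b z Hz) as [r2 [Hr2 O2]].
    apply N, (zero_by_continuity (A' O) z (Rmin r1 r2)); [apply Rmin_pos; assumption| |].
    + apply Cdiff_cont, (HA' O), Hz.
    + intros x Hne Hx. destruct (Fin x Hne ltac:(eapply Rle_trans; [exact Hx|apply Rmin_l])) as [v Ev].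
      apply (Heq x v); [|exact Ev]. apply O2. eapply Rle_trans; [exact Hx|apply Rmin_r].
  - destruct (cleared_solution_APH a b w hw A' d HA' NM Heq) as [u [Hu Eu]].
    assert (Fin := few_poles_no_pole a b w hw (A' (S d)) u (HA' (S d)) Hu NM Eu hpoles).
    exists (finite_part w). split.
    + apply APH_AP. apply (quotient_APH a b w hw (A' (S d)) u (HA' (S d)) Hu NM Eu Fin).
    + intros z Hz. destruct (Fin z Hz) as [v Ev]. unfold finite_part. rewrite Ev. reflexivity.
Qed.
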